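(* Let $\{a_j\}_{j=1}^\infty\subset E$ be a sequence of pairwise different points with $a_j\to 0$, and let $B\subset E$ be a closed disc such that $0\in B$ and $a_j\notin B$ for all $j$. Let $\{r_j\}_{j=1}^\infty$ be a sequence of positive numbers such that $\bar\triangle(a_j,r_j)\cap\bar\triangle(a_k,r_k)=\emptyset$ for $j\ne k$ and $B\cap\bar\triangle(a_j,r_j)=\emptyset$ for all $j$, and let $M<\infty$ be a constant such that $$K_{D_N}(z)<M\quad\text{for all } z\in B,\ N=1,2,\ldots,\qquad\text{where } D_N=E\setminus\bigcup_{j=1}^N\bar\triangle(a_j,r_j).$$ Then there is a sequence $s_j\to 0$ with $0<s_j\le r_j$ such that $$G=E\setminus\left(\bigcup_{j=1}^\infty\bar\triangle(a_j,s_j)\cup\{0\}\right)$$ is a domain satisfying $K_G(z)<M$ for all $z\in B\cap G$.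
   Context: $E$ is the open unit disc in $\mathbb{C}$ and $\bar\triangle(a,r)=\{z\in\mathbb{C}:|z-a|\le r\}$. Closed discs have positive radius. For a bounded domain $\Omega\subset\mathbb{C}$, $L_h^2(\Omega)$ is the Hilbert space of square integrable (with respect to Lebesgue measure) holomorphic functions on $\Omega$. The Bergman kernel of $\Omega$ is $$K_\Omega(z)=\sup\left\{\frac{|f(z)|^2}{\|f\|_{L^2(\Omega)}^2}: f\in L_h^2(\Omega),\ f\not\equiv 0\right\},\quad z\in\Omega.$$ *)

(* Defs.v *)
From HB Require Import structures.
From mathcomp Require Import all_boot all_order all_algebra.
From mathcomp Require Import complex.
From mathcomp Require Import all_classical all_reals all_analysis.

Set Implicit Arguments.
Unset Strict Implicit.
Unset Printing Implicit Defensive.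

Import Order.TTheory GRing.Theory Num.Theory.
Import numFieldNormedType.Exports.

Local Open Scope classical_set_scope.
Local Open Scope ring_scope.
Local Open Scope complex_scope.

                                                                           
                                                                              
                                                         
Notation Cplx R := (R[i]^o).

Section Bergman.
Context {R : realType}.
Implicit Types (Omega : set (Cplx R)) (f : Cplx R -> Cplx R).

Definition unit_disc : set (Cplx R) := [set z | Normc.normc z < 1].

Definition closed_disc (a : Cplx R) (r : R) : set (Cplx R) :=
  [set z | Normc.normc (z - a) <= r].

Definition is_closed_disc (B : set (Cplx R)) : Prop :=
  exists c r, 0 < r /\ B = closed_disc c r.

Definition is_domain Omega : Prop :=
  [/\ open Omega, connected Omega & Omega !=set0].

                                                                        
                                                                        
                                      
Definition holomorphic_on Omega f : Prop :=
  forall z, Omega z -> derivable f z 1.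

Definition plane_set Omega : set (R * R) := [set p | Omega (p.1 +i* p.2)].

Definition sq_modulus f (p : R * R) : R :=
  Normc.normc (f (p.1 +i* p.2)) ^+ 2.

Definition L2h Omega f : Prop :=
  holomorphic_on Omega f /\
  (@lebesgue_measure R \x @lebesgue_measure R)%E.-integrable
    (plane_set Omega) (EFin \o sq_modulus f).

Definition sq_L2norm Omega f : R :=
  Rintegral (@lebesgue_measure R \x @lebesgue_measure R)%E
    (plane_set Omega) (sq_modulus f).

Definition bergman_kernel Omega (z : Cplx R) : \bar R :=
  ereal_sup [set (Normc.normc (f z) ^+ 2 / sq_L2norm Omega f)%:E
            | f in [set f | L2h Omega f /\ exists2 w, Omega w & f w != 0]].

End Bergman.

(* Main.v *)
Require Import Defs.
From mathcomp Require Import all_boot all_order all_algebra.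
From mathcomp Require Import complex.
From mathcomp Require Import all_classical all_reals all_analysis.
From mathcomp Require Import ring lra.

Set Implicit Arguments.
Unset Strict Implicit.
Unset Printing Implicit Defensive.

Import Order.TTheory GRing.Theory Num.Theory.
Import numFieldNormedType.Exports.

Local Open Scope classical_set_scope.
Local Open Scope ring_scope.

(* Let k_z(x) = (1 - x conj z)^-2, the Bergman kernel of the disc up
   to the factor 1/pi, and
     u_z(x) = conj x / (1 - conj x z) - 1 / (x - z),
   which vanishes on the unit circle and satisfies dbar u_z = conj k_z off its
   pole z. If f is holomorphic on an open subset of the disc and chi is a cutoff
   that vanishes near the complement of this set and equals 1 near z, then Stokes
   applied to chi f u_z gives
     pi f(z) = int chi f conj k_z + int f (dbar chi) u_z.
   By Cauchy-Schwarz, |f(z)|^2 / |f|^2 exceeds the kernel of the whole disc at z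
   by at most an amount controlled by int |(dbar chi) u_z|^2. Points have zero
   capacity, so around each a_j there is a cutoff of arbitrarily small energy that
   vanishes on a small disc; the radius s_j is chosen inside that disc, with an
   energy budget summable in j. The budget is uniform in z because
   |u_z(x)| <= 2 / |x - z|, and a cutoff of tiny energy at 0 absorbs all but
   finitely many holes. The room for the budget comes from D_1 alone: the kernel of
   the disc is radial and increasing in the modulus, so on B it is largest at a
   farthest point of B, where it is smaller than M by comparison with D_1. *)

(** * Measurability in the plane *)

(** Since f is only assumed complex differentiable, nothing is known beforehand about its
    derivative. Stokes is therefore proved by Goursat's bisection, which asks for differentiability
    and a continuous divergence; a product of f with a cutoff and a smoothed u_z qualifies, because
    its dbar derivative does not involve f'. Nothing controls f at the unit circle, so a cutoff is
    needed there too. It is cheap: its gradient is of order m on a ring where |u_z| is of order 1/m,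
    and the area of the ring tends to 0. The radii must be fixed before z is known. The cutoffs at
    the holes are therefore weighed against a bound of |u_z|^2 near each hole that holds for all z
    in B at once; z enters only through the cutoff at the circle, the cutoff at 0, and the number of
    holes treated one by one. The constant pi appears as the mass of a smoothed point mass. That
    this mass is the same at all points follows from the reproducing formula itself. *)

Section PlaneMeasure.
Context {R : realType}.
Local Notation mu := (@lebesgue_measure R).
Local Notation mu2 := (@lebesgue_measure R \x @lebesgue_measure R)%E.

Local Notation R2 := (measurableTypeR R * measurableTypeR R)%type.

(** Openness and continuity are spelled out with boxes, the form in which [near0_box] carries
    complex neighbourhoods over to pairs of reals. *)
Definition open2 (O : set (R * R)) := forall p, O p ->
  exists2 e : R, 0 < e & forall q, `|q.1 - p.1| < e -> `|q.2 - p.2| < e -> O q.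

Definition cont2 (f : R * R -> R) (p : R * R) := forall e : R, 0 < e ->
  exists2 d : R, 0 < d &
    forall q, `|q.1 - p.1| < d -> `|q.2 - p.2| < d -> `|f q - f p| < e.

(** Such a set is the union of the countably many open rational boxes that it contains. *)
Lemma open2_measurable (O : set (R * R)) : open2 O -> measurable (O : set R2).
Proof.
move=> oO.
pose box (i : rat * rat * rat * rat) : set (R * R) :=
  `]ratr i.1.1.1, ratr i.1.1.2[%classic `*` `]ratr i.1.2, ratr i.2[%classic.
pose F i := if pselect (box i `<=` O) then box i else set0.
have FE i : box i `<=` O -> F i = box i by rewrite /F; case: pselect.
have -> : O = \bigcup_i F i.
  apply/seteqP; split=> [p Op|p [i _]]; last first.
    by rewrite /F; case: pselect => // iO /iO.
  have [e e0 eO] := oO _ Op.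
  have [a Ha] := @rat_in_itvoo R (p.1 - e) p.1 ltac:(lra).
  have [b Hb] := @rat_in_itvoo R p.1 (p.1 + e) ltac:(lra).
  have [c Hc] := @rat_in_itvoo R (p.2 - e) p.2 ltac:(lra).
  have [d Hd] := @rat_in_itvoo R p.2 (p.2 + e) ltac:(lra).
  move: Ha Hb Hc Hd; rewrite !in_itv/=.
  move=> /andP[a1 a2] /andP[b1 b2] /andP[c1 c2] /andP[d1 d2].
  have bO : box (a, b, c, d) `<=` O.
    move=> q []; rewrite /= !in_itv/= => /andP[q1 q2] /andP[q3 q4].
    by apply: eO; rewrite ltr_norml; apply/andP; split; lra.
  exists (a, b, c, d); rewrite // FE//.
  by split; rewrite /= in_itv/=; apply/andP; split.
apply: countable_bigcupT_measurable => // i.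
have [iO|iO] := pselect (box i `<=` O).
  by rewrite FE//; apply: measurableX; exact: measurable_itv.
have -> : F i = set0 by rewrite /F; case: pselect.
exact: measurable0.
Qed.

Lemma cont2_measurable (D : set (R * R)) (f : R * R -> R) :
  open2 D -> (forall p, D p -> cont2 f p) -> measurable_fun (D : set R2) f.
Proof.
move=> oD cf; apply: (measurability _ (measurable_realfun.RGenOInfty.measurableE R)).
move=> _ [_ [a ->] <-]; apply: open2_measurable => p [Dp fpa].
rewrite /= in_itv/= andbT in fpa.
have [e e0 eD] := oD _ Dp.
have [d d0 df] := cf _ Dp (f p - a) ltac:(lra).
exists (Num.min e d); first by rewrite lt_min e0 d0.
move=> q; rewrite !lt_min => /andP[q1 q2] /andP[q3 q4].
split; first exact: eD.
rewrite /= in_itv/= andbT; have := df _ q2 q4; rewrite ltr_norml => /andP[]; lra.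
Qed.

Lemma cont2_continuous (f : R * R -> R) p : cont2 f p -> {for p, continuous f}.
Proof.
move=> cf; apply/cvgrPdist_lt => e e0; have [d d0 df] := cf _ e0.
exists (ball p.1 d, ball p.2 d) => /=; first by split; exact: nbhsx_ballx.
by case=> x y [/= h1 h2]; rewrite distrC; apply: df => /=; rewrite distrC.
Qed.

Lemma cont2_bounded (f : R * R -> R) (H : R) : (forall p, cont2 f p) ->
  exists2 M : R, 0 < M & forall p, `|p.1| <= H -> `|p.2| <= H -> `|f p| <= M.
Proof.
move=> cf.
have cK : compact (`[- H, H]%classic `*` `[- H, H]%classic : set (R * R)).
  by apply: compact_setX; exact: segment_compact.
have cfK : {within (`[- H, H]%classic `*` `[- H, H]%classic), continuous f}.
  by apply: continuous_subspaceT => p; exact: cont2_continuous.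
have /compact_bounded[M [_ hM]] := continuous_compact cfK cK.
exists (`|M| + 1); first by rewrite ltr_wpDl.
move=> p h1 h2; apply: (hM (`|M| + 1)); first by have := ler_norm M; lra.
exists p => //; split; rewrite /= in_itv/= -ler_norml//.
Qed.

Lemma mu2_box a b c d (h1 : bool) (h2 : bool) : a <= b -> c <= d ->
  mu2 ([set` Interval (BSide h1 a) (BRight b)] `*`
       [set` Interval (BSide h2 c) (BRight d)]) = ((b - a) * (d - c))%:E.
Proof.
move=> ab cd; rewrite product_measure1E; [|exact: measurable_itv..].
have E (x y : R) (h : bool) : x <= y ->
    mu [set` Interval (BSide h x) (BRight y)] = (y - x)%:E.
  rewrite le_eqVlt => /orP[/eqP<-|xy]; rewrite lebesgue_measure_itv/= ?ltxx.
    by rewrite subrr.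
  by rewrite lte_fin xy EFinB.
by rewrite EFinM; congr (_ * _)%E; exact: E.
Qed.

End PlaneMeasure.

(** * The divergence theorem for differentiable fields *)

(** Serves twice: as a mean value estimate on the small squares of the bisection, and with [c = 0]
    to bound an integral by the area of a support. *)
Lemma Rintegral_near_cst d (T : measurableType d) (R : realType)
    (m : {measure set T -> \bar R}) (A : set T) (f : T -> R) (c e r : R) :
  measurable A -> m A = r%:E -> m.-integrable A (EFin \o f) ->
  (forall x, A x -> `|f x - c| <= e) ->
  `|Rintegral m A f - c * r| <= e * r.
Proof.
move=> mA mAr intf fc.
have ic k : m.-integrable A (EFin \o cst k).
  apply: measurable_bounded_integrable => //; first by rewrite mAr ltry.
  exists `|k|; split; first exact: num_real.
  by move=> N kN x _; exact: ltW.
have E k : Rintegral m A (cst k) = k * r.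
  by rewrite [LHS]Rintegral_cst// mAr.
rewrite -(E c) -(E e) -RintegralB//.
have ifc : m.-integrable A (EFin \o (fun x => f x - c)).
  rewrite (_ : _ \o _ = (EFin \o f) \- (EFin \o cst c))%E; first exact: integrableB.
  by apply/funext => x /=; rewrite EFinB.
apply: le_trans (le_normr_Rintegral _ ifc) _ => //.
exact: (le_Rintegral mA (integrable_norm ifc) (ic e) fc).
exact: ic.
Qed.

Section Green.
Context {R : realType}.
Local Notation mu := (@lebesgue_measure R).
Local Notation mu2 := (@lebesgue_measure R \x @lebesgue_measure R)%E.

Local Notation R2 := (measurableTypeR R * measurableTypeR R)%type.

(** Half-open intervals make adjacent segments and rectangles disjoint, so the splitting lemmas
    involve no null sets. *)
Definition int1 (f : R -> R) (a b : R) := Rintegral mu `]a, b]%classic f.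

Definition int2 (f : R * R -> R) (a b c d : R) :=
  Rintegral mu2 (`]a, b]%classic `*` `]c, d]%classic) f.

Lemma int1_integrable (f : R -> R) a b : continuous f ->
  mu.-integrable `]a, b]%classic (EFin \o f).
Proof.
move=> cf; apply: (@integrableS _ _ _ mu `[a, b]%classic).
- exact: measurable_itv.
- exact: measurable_itv.
- by move=> x /=; rewrite !in_itv/= => /andP[/ltW-> ->].
- apply: continuous_compact_integrable; first exact: segment_compact.
  exact: continuous_subspaceT.
Qed.

Lemma int1_split (f : R -> R) a b c : continuous f -> a <= b -> b <= c ->
  int1 f a c = int1 f a b + int1 f b c.
Proof.
move=> cf ab bc; rewrite /int1.
have E : `]a, c]%classic = `]a, b]%classic `|` `]b, c]%classic.
  by rewrite -itv_bndbnd_setU// bnd_simp.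
rewrite E Rintegral_setU//; first by rewrite -E; exact: int1_integrable.
apply/disj_setPS => x [/=]; rewrite !in_itv/= => /andP[_ xb] /andP[bx _]; lra.
Qed.

Lemma int2_integrable (f : R * R -> R) a b c d : (forall p, cont2 f p) ->
  mu2.-integrable (`]a, b]%classic `*` `]c, d]%classic) (EFin \o f).
Proof.
move=> cf.
pose H := `|a| + `|b| + `|c| + `|d|.
have [M M0 fM] := cont2_bounded H cf.
have ub x y z : `|x| <= H -> `|y| <= H -> x < z <= y -> `|z| <= H.
  by rewrite !ler_norml => /andP[? ?] /andP[? ?] /andP[? ?]; apply/andP; split; lra.
have aH : `|a| <= H by rewrite /H -!addrA lerDl !addr_ge0.
have bH : `|b| <= H by rewrite /H (addrC `|a|) -!addrA lerDl !addr_ge0.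
have cH : `|c| <= H by rewrite /H (addrC _ `|c|) -!addrA lerDl !addr_ge0.
have dH : `|d| <= H by rewrite /H lerDr !addr_ge0.
apply: measurable_bounded_integrable.
- by apply: measurableX; exact: measurable_itv.
- apply: (@le_lt_trans _ _ (mu2 (`]- H, H]%classic `*` `]- H, H]%classic))).
    apply: le_measure; rewrite ?inE; [by apply: measurableX; exact: measurable_itv..|].
    have lo x : `|x| <= H -> - H <= x by rewrite ler_norml => /andP[].
    have hi x : `|x| <= H -> x <= H by rewrite ler_norml => /andP[].
    move: (lo _ aH) (hi _ bH) (lo _ cH) (hi _ dH) => ? ? ? ?.
    by case=> x y /= []; rewrite !in_itv/= => /andP[? ?] /andP[? ?]; split; apply/andP; split; lra.
  have H0 : 0 <= H by rewrite !addr_ge0.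
  by rewrite mu2_box ?ltry//; lra.
- by apply: measurable_funTS; apply: cont2_measurable => // p _; exists 1.
- exists M; split; first exact: num_real.
  move=> N MN [x y] /= [xab ycd]; apply: (le_trans _ (ltW MN)).
  apply: fM => /=.
    by move: xab; rewrite in_itv/=; exact: ub.
  by move: ycd; rewrite in_itv/=; exact: ub.
Qed.

Lemma int2_split1 (f : R * R -> R) a b c x y : (forall p, cont2 f p) ->
  a <= b -> b <= c -> int2 f a c x y = int2 f a b x y + int2 f b c x y.
Proof.
move=> cf ab bc; rewrite /int2.
have E : `]a, c]%classic `*` `]x, y]%classic =
    (`]a, b]%classic `*` `]x, y]%classic) `|` (`]b, c]%classic `*` `]x, y]%classic).
  rewrite (@itv_bndbnd_setU _ _ (BRight a) (BRight b) (BRight c)) ?bnd_simp//.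
  apply/seteqP; split=> -[u v]; first by move=> [[?|?] ?]; [left|right].
  by move=> [[? ?]|[? ?]]; split=> //; [left|right].
have mX (u v w t : R) : measurable (`]u, v]%classic `*` `]w, t]%classic : set R2).
  by apply: measurableX; exact: measurable_itv.
have I := int2_integrable a c x y cf.
rewrite E in I *; apply: (Rintegral_setU (mX _ _ _ _) (mX _ _ _ _) I).
apply/disj_setPS => -[u v] [/= []]; rewrite !in_itv/= => /andP[_ ub] _ [/andP[bu _] _]; lra.
Qed.

Lemma int2_split2 (f : R * R -> R) a b c x y : (forall p, cont2 f p) ->
  a <= b -> b <= c -> int2 f x y a c = int2 f x y a b + int2 f x y b c.
Proof.
move=> cf ab bc; rewrite /int2.
have E : `]x, y]%classic `*` `]a, c]%classic =
    (`]x, y]%classic `*` `]a, b]%classic) `|` (`]x, y]%classic `*` `]b, c]%classic).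
  rewrite (@itv_bndbnd_setU _ _ (BRight a) (BRight b) (BRight c)) ?bnd_simp//.
  apply/seteqP; split=> -[u v]; first by move=> [? [?|?]]; [left|right].
  by move=> [[? ?]|[? ?]]; split=> //; [left|right].
have mX (u v w t : R) : measurable (`]u, v]%classic `*` `]w, t]%classic : set R2).
  by apply: measurableX; exact: measurable_itv.
have I := int2_integrable x y a c cf.
rewrite E in I *; apply: (Rintegral_setU (mX _ _ _ _) (mX _ _ _ _) I).
apply/disj_setPS => -[u v] [/= [_]]; rewrite !in_itv/= => /andP[_ ub] [_ /andP[bu _]]; lra.
Qed.

Lemma cont2_line1 (f : R * R -> R) x : (forall p, cont2 f p) ->
  continuous (fun t => f (x, t)).
Proof.
move=> cf t; apply/cvgrPdist_lt => e e0; have [d d0 df] := cf (x, t) e e0.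
exists d => //= s; rewrite /= distrC => st; rewrite distrC; apply: df => //=.
by rewrite subrr normr0.
Qed.

Lemma cont2_line2 (f : R * R -> R) y : (forall p, cont2 f p) ->
  continuous (fun t => f (t, y)).
Proof.
move=> cf t; apply/cvgrPdist_lt => e e0; have [d d0 df] := cf (t, y) e e0.
exists d => //= s; rewrite /= distrC => st; rewrite distrC; apply: df => //=.
by rewrite subrr normr0.
Qed.

Section Goursat.
Variables (P Q D : R * R -> R).
Hypothesis cP : forall p, cont2 P p.
Hypothesis cQ : forall p, cont2 Q p.
Hypothesis cD : forall p, cont2 D p.

(** The defect of the divergence theorem on the square with lower left corner [(x, y)] and side [h]:
    outward flux of the field [(P, Q)] minus the integral of [D]. *)
Let flux (x y h : R) :=
  (int1 (fun t => P (x + h, t)) y (y + h) - int1 (fun t => P (x, t)) y (y + h))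
  + (int1 (fun t => Q (t, y + h)) x (x + h) - int1 (fun t => Q (t, y)) x (x + h))
  - int2 D x (x + h) y (y + h).

Let flux_split (x y h : R) : 0 <= h ->
  flux x y (h + h) =
    flux x y h + flux (x + h) y h + flux x (y + h) h + flux (x + h) (y + h) h.
Proof.
move=> h0; rewrite /flux !(addrA _ h h).
have yh : y <= y + h by lra.
have yhh : y + h <= y + h + h by lra.
have xh : x <= x + h by lra.
have xhh : x + h <= x + h + h by lra.
rewrite (int1_split (@cont2_line1 P (x + h + h) cP) yh yhh).
rewrite (int1_split (@cont2_line1 P x cP) yh yhh).
rewrite (int1_split (@cont2_line2 Q (y + h + h) cQ) xh xhh).
rewrite (int1_split (@cont2_line2 Q y cQ) xh xhh).
rewrite (int2_split1 _ _ cD xh xhh).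
rewrite (int2_split2 x (x + h) cD yh yhh).
rewrite (int2_split2 (x + h) (x + h + h) cD yh yhh).
ring.
Qed.

Let near_affine (F : R * R -> R) (p : R * R) (a b e d : R) :=
  forall q, `|q.1 - p.1| < d -> `|q.2 - p.2| < d ->
    `|F q - F p - (a * (q.1 - p.1) + b * (q.2 - p.2))|
      <= e * (`|q.1 - p.1| + `|q.2 - p.2|).

(** The affine parts contribute [a h^2] and [(D p - a) h^2], which cancel against [D p h^2]. The
    errors are [4 e h^2] for each pair of opposite sides and [e h^2] for the area, whence the 9. *)
Let flux_small (x y h : R) p (a b c e d : R) : 0 < h -> h < d -> 0 < e ->
  x <= p.1 <= x + h -> y <= p.2 <= y + h ->
  near_affine P p a b e d -> near_affine Q p c (D p - a) e d ->
  (forall q, `|q.1 - p.1| < d -> `|q.2 - p.2| < d -> `|D q - D p| < e) ->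
  `|flux x y h| <= 9 * e * h ^+ 2.
Proof.
move=> h0 hd e0 /andP[x1 x2] /andP[y1 y2] aP aQ aD.
have near t s : s <= t -> t <= s + h -> forall r, s <= r <= s + h -> `|r - t| <= h.
  by move=> ? ? r /andP[? ?]; rewrite ler_norml; apply/andP; split; lra.
have Nx := near _ _ x1 x2; have Ny := near _ _ y1 y2.
have xx : `|x - p.1| <= h by apply: Nx; lra.
have xxh : `|x + h - p.1| <= h by apply: Nx; lra.
have yy : `|y - p.2| <= h by apply: Ny; lra.
have yyh : `|y + h - p.2| <= h by apply: Ny; lra.
have bnd F u v w z : near_affine F p u v e d -> `|w - p.1| <= h -> `|z - p.2| <= h ->
    `|F (w, z) - F p - (u * (w - p.1) + v * (z - p.2))| <= 2 * e * h.
  move=> aF wp zp; apply: (le_trans (aF (w, z) _ _)) => /=; try lra.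
  have : e * (`|w - p.1| + `|z - p.2|) <= e * (h + h) by apply: ler_wpM2l; lra.
  lra.
have m1 a' : mu `]a', (a' + h)]%classic = h%:E.
  rewrite lebesgue_measure_itv/= lte_fin ltrDl h0.
  by rewrite -EFinB; congr EFin; lra.
have B1 : `|int1 (fun t => P (x + h, t)) y (y + h) - int1 (fun t => P (x, t)) y (y + h)
    - (a * h) * h| <= 4 * e * h * h.
  rewrite /int1 -RintegralB; [|exact: measurable_itv|
    by apply: int1_integrable; exact: cont2_line1..].
  apply: Rintegral_near_cst; [exact: measurable_itv|exact: m1| |].
    apply: (@int1_integrable (fun t => P (x + h, t) - P (x, t))).
    by move=> t; apply: cvgB; exact: cont2_line1.
  move=> t /=; rewrite in_itv/= => /andP[t1 t2].
  have tp : `|t - p.2| <= h by apply: Ny; lra.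
  have := bnd _ _ _ _ _ aP xx tp; have := bnd _ _ _ _ _ aP xxh tp.
  rewrite !ler_norml => /andP[? ?] /andP[? ?]; apply/andP; split; lra.
have B2 : `|int1 (fun t => Q (t, y + h)) x (x + h) - int1 (fun t => Q (t, y)) x (x + h)
    - ((D p - a) * h) * h| <= 4 * e * h * h.
  rewrite /int1 -RintegralB; [|exact: measurable_itv|
    by apply: int1_integrable; exact: cont2_line2..].
  apply: Rintegral_near_cst; [exact: measurable_itv|exact: m1| |].
    apply: (@int1_integrable (fun t => Q (t, y + h) - Q (t, y))).
    by move=> t; apply: cvgB; exact: cont2_line2.
  move=> t /=; rewrite in_itv/= => /andP[t1 t2].
  have tp : `|t - p.1| <= h by apply: Nx; lra.
  have := bnd _ _ _ _ _ aQ tp yy; have := bnd _ _ _ _ _ aQ tp yyh.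
  rewrite !ler_norml => /andP[? ?] /andP[? ?]; apply/andP; split; lra.
have B3 : `|int2 D x (x + h) y (y + h) - D p * (h * h)| <= e * (h * h).
  apply: Rintegral_near_cst.
  - by apply: measurableX; exact: measurable_itv.
  - transitivity ((x + h - x) * (y + h - y))%:E; first by apply: mu2_box; lra.
    by congr EFin; ring.
  - exact: int2_integrable.
  move=> [u v] [/=]; rewrite !in_itv/= => /andP[u1 u2] /andP[v1 v2].
  apply: ltW; apply: aD => /=; apply: le_lt_trans hd.
    by apply: Nx; lra.
  by apply: Ny; lra.
rewrite /flux; move: B1 B2 B3; rewrite !ler_norml expr2.
by move=> /andP[? ?] /andP[? ?] /andP[? ?]; apply/andP; split; lra.
Qed.

Hypothesis div : forall p, exists a b c, forall e, 0 < e -> exists2 d, 0 < d &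
  near_affine P p a b e d /\ near_affine Q p c (D p - a) e d.

(** One of the four quarters carries at least a quarter of the defect. The positivity of the side
    stands inside the existential so that choice yields a total function to iterate. *)
Let quarter (s : R * R * R) : exists s' : R * R * R,
  0 < s.2 -> [/\ s'.2 = s.2 / 2,
    s.1.1 <= s'.1.1 /\ s'.1.1 + s'.2 <= s.1.1 + s.2,
    s.1.2 <= s'.1.2 /\ s'.1.2 + s'.2 <= s.1.2 + s.2 &
    `|flux s.1.1 s.1.2 s.2| <= 4 * `|flux s'.1.1 s'.1.2 s'.2|].
Proof.
case: s => [[x y] h] /=; set k := h / 2.
have hk : h = k + k by rewrite /k; lra.
have [h0|h0] := ltP 0 h; last by exists (x, y, k) => ?; lra.
have k0 : 0 < k by rewrite /k; lra.
have lo (t : R) : t <= t /\ t + k <= t + h by split; lra.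
have hi (t : R) : t <= t + k /\ t + k + k <= t + h by split; lra.
have := @flux_split x y k (ltW k0); rewrite -hk => ->.
have T := ler_normD (flux x y k + flux (x + k) y k + flux x (y + k) k) (flux (x + k) (y + k) k).
have T' := ler_normD (flux x y k + flux (x + k) y k) (flux x (y + k) k).
have T'' := ler_normD (flux x y k) (flux (x + k) y k).
set S := `|_|.
have [H|H1] := leP S (4 * `|flux x y k|).
  by exists (x, y, k) => _; split.
have [H|H2] := leP S (4 * `|flux (x + k) y k|).
  by exists (x + k, y, k) => _; split.
have [H|H3] := leP S (4 * `|flux x (y + k) k|).
  by exists (x, y + k, k) => _; split.
have [H|H4] := leP S (4 * `|flux (x + k) (y + k) k|).
  by exists (x + k, y + k, k) => _; split.
exfalso; clear lo hi hk h0 k0; rewrite /S in H1 H2 H3 H4; lra.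
Qed.

(** The nested squares shrink to a point, and differentiability there makes the defect small
    compared with the area, while bisection keeps it at least a fixed multiple of the area. *)
Lemma flux0 x y h : 0 < h -> flux x y h = 0.
Proof.
move=> h0.
have [nxt nxtP] := choice quarter.
pose sq n := iter n nxt (x, y, h).
have sq0 n : 0 < (sq n).2.
  elim: n => //= n IH; have [-> _ _ _] := nxtP _ IH; lra.
have sqh n : (sq n).2 = h / 2 ^+ n.
  elim: n => [|n IH] /=; first by rewrite expr0 divr1.
  have [-> _ _ _] := nxtP _ (sq0 n); rewrite IH exprS; field.
  by rewrite expf_neq0.
have sqf n : `|flux x y h| <= 4 ^+ n * `|flux (sq n).1.1 (sq n).1.2 (sq n).2|.
  elim: n => [|n IH] /=; first by rewrite expr0 mul1r.
  have [_ _ _ H] := nxtP _ (sq0 n); apply: (le_trans IH).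
  by rewrite exprSr -mulrA ler_wpM2l// exprn_ge0.
have nest n m : (n <= m)%N ->
  [/\ (sq n).1.1 <= (sq m).1.1, (sq m).1.1 + (sq m).2 <= (sq n).1.1 + (sq n).2,
      (sq n).1.2 <= (sq m).1.2 & (sq m).1.2 + (sq m).2 <= (sq n).1.2 + (sq n).2].
  elim: m => [|m IH]; first by rewrite leqn0 => /eqP->; split.
  rewrite leq_eqVlt => /orP[/eqP->|]; first by split.
  rewrite ltnS => /IH[? ? ? ?].
  have [_ [? ?] [? ?] _] := nxtP _ (sq0 m); by split => /=; [apply: le_trans|apply: le_trans|apply: le_trans|apply: le_trans]; eassumption.
have lim (u : nat -> R) : (forall n m, (n <= m)%N ->
    u n <= u m /\ u m + (sq m).2 <= u n + (sq n).2) ->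
    exists l, forall n, u n <= l <= u n + (sq n).2.
  move=> hu; exists (sup (range u)) => n.
  have ubd m : ubound (range u) (u m + (sq m).2).
    move=> _ [k _ <-]; have := sq0 k; have := sq0 m.
    by have [/hu[]|/ltnW/hu[]] := leqP k m; lra.
  apply/andP; split; last by apply: ge_sup => //; exists (u 0), 0.
  by apply: ub_le_sup; [exists (u n + (sq n).2)|exists n].
have [l1 L1] := lim (fun n => (sq n).1.1) (fun n m nm => let: And4 a b _ _ := nest n m nm in conj a b).
have [l2 L2] := lim (fun n => (sq n).1.2) (fun n m nm => let: And4 _ _ a b := nest n m nm in conj a b).
have [a [b [c H]]] := div (l1, l2).
apply/eqP; rewrite -normr_eq0 eq_le normr_ge0 andbT.
apply/ler_addgt0Pr => e e0; rewrite add0r.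
(* In the final bound [4 ^+ n] cancels against the squared side [(h / 2 ^+ n) ^+ 2], and what
   remains, [9 * e' * h ^+ 2], is exactly [e]. *)
pose e' := e / (9 * h ^+ 2).
have h20 : 0 < 9 * h ^+ 2 by rewrite mulr_gt0// exprn_gt0.
have e'0 : 0 < e' by rewrite divr_gt0.
have [d d0 [aP aQ]] := H _ e'0.
have [d' d'0 aD] := @cD (l1, l2) _ e'0.
have [n nd] : exists n, (sq n).2 < Num.min d d'.
  have m0 : 0 < Num.min d d' by rewrite lt_min d0.
  pose N := Num.truncn (h / Num.min d d').
  exists N.+1; rewrite sqh ltr_pdivrMr ?exprn_gt0//.
  have : h / Num.min d d' < N.+1%:R by exact: truncnS_gt.
  rewrite ltr_pdivrMr// mulrC => /lt_le_trans; apply; rewrite ler_wpM2l ?(ltW m0)//.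
  by rewrite -natrX ler_nat ltnW// ltn_expl.
have nb F u v : near_affine F (l1, l2) u v e' d -> near_affine F (l1, l2) u v e' (Num.min d d').
  by move=> aF q; rewrite !lt_min => /andP[? _] /andP[? _]; exact: aF.
have := @flux_small (sq n).1.1 (sq n).1.2 (sq n).2 (l1, l2) a b c e' (Num.min d d')
  (sq0 n) nd e'0 (L1 n) (L2 n) (nb _ _ _ aP) (nb _ _ _ aQ).
have aD' (q : R * R) : `|q.1 - (l1, l2).1| < Num.min d d' -> `|q.2 - (l1, l2).2| < Num.min d d' ->
    `|D q - D (l1, l2)| < e'.
  by rewrite !lt_min => /andP[_ ?] /andP[_ ?]; exact: aD.
move=> /(_ aD') HF; apply: (le_trans (sqf n)).
apply: (@le_trans _ _ (4 ^+ n * (9 * e' * (sq n).2 ^+ 2))).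
  by rewrite ler_wpM2l// exprn_ge0.
have E4 : (4 : R) ^+ n = (2 ^+ n) ^+ 2.
  by rewrite -exprM mulnC exprM; congr (_ ^+ n); ring.
have h0' : h != 0 by rewrite gt_eqF.
have y0 : (2 : R) ^+ n != 0 by rewrite expf_neq0.
rewrite sqh /e' E4 le_eqVlt; apply/orP; left; apply/eqP.
by field; rewrite h0' y0.
Qed.

End Goursat.

(* The bisection argument of Goursat, applied to a field that is merely differentiable but has continuous divergence. *)
Lemma divergence0 (P Q D : R * R -> R) (H : R) :
  (forall p, cont2 P p) -> (forall p, cont2 Q p) -> (forall p, cont2 D p) ->
  (forall p, exists a b c, forall e, 0 < e -> exists2 d, 0 < d &
    forall q, `|q.1 - p.1| < d -> `|q.2 - p.2| < d ->
    `|P q - P p - (a * (q.1 - p.1) + b * (q.2 - p.2))|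
      <= e * (`|q.1 - p.1| + `|q.2 - p.2|) /\
    `|Q q - Q p - (c * (q.1 - p.1) + (D p - a) * (q.2 - p.2))|
      <= e * (`|q.1 - p.1| + `|q.2 - p.2|)) ->
  0 < H ->
  (forall p, H <= `|p.1| \/ H <= `|p.2| -> P p = 0 /\ Q p = 0) ->
  int2 D (- H) H (- H) H = 0.
Proof.
move=> cP cQ cD dif H0 van.
have dif' p : exists a b c, forall e, 0 < e -> exists2 d, 0 < d &
  (forall q, `|q.1 - p.1| < d -> `|q.2 - p.2| < d ->
    `|P q - P p - (a * (q.1 - p.1) + b * (q.2 - p.2))|
      <= e * (`|q.1 - p.1| + `|q.2 - p.2|)) /\
  (forall q, `|q.1 - p.1| < d -> `|q.2 - p.2| < d ->
    `|Q q - Q p - (c * (q.1 - p.1) + (D p - a) * (q.2 - p.2))|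
      <= e * (`|q.1 - p.1| + `|q.2 - p.2|)).
  have [a [b [c h]]] := dif p; exists a, b, c => e /h[d d0 hd].
  by exists d => //; split=> q h1 h2; have [] := hd q h1 h2.
have H20 : 0 < 2 * H by lra.
have := flux0 cP cQ cD dif' (- H) (- H) H20.
rewrite (_ : - H + 2 * H = H); last by lra.
have nH : `|H| = H by rewrite gtr0_norm.
have nH' : `|- H| = H by rewrite normrN.
have E f : (forall t, f t = 0) -> int1 f (- H) H = 0.
  by move=> f0; rewrite /int1 (_ : f = cst 0) ?Rintegral_cst ?mul0r//; apply/funext.
rewrite !E => [|t|t|t|t]; [lra| | | |].
- by have [] := van (t, - H) ltac:(right; rewrite /= nH').
- by have [] := van (t, H) ltac:(right; rewrite /= nH).
- by have [] := van (- H, t) ltac:(left; rewrite /= nH').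
- by have [] := van (H, t) ltac:(left; rewrite /= nH).
Qed.

End Green.

(** * Wirtinger calculus *)

Section Modulus.
Context {R : realType}.
Local Notation C := R[i].
Local Notation N := (@Normc.normc R).
Implicit Types (x y z w : C) (t : R).

Lemma normc0 : N 0 = 0. Proof. exact: Normc.normc0. Qed.

Lemma normc1 : N 1 = 1. Proof. exact: Normc.normc1. Qed.

Lemma normc_ge0 x : 0 <= N x. Proof. by case: x => a b; exact: sqrtr_ge0. Qed.

Lemma normcM x y : N (x * y) = N x * N y. Proof. exact: Normc.normcM. Qed.

Lemma normcV x : N x^-1 = (N x)^-1. Proof. exact: Normc.normcV. Qed.

Lemma normc_opp x : N (- x) = N x. Proof. exact: normcN. Qed.

Lemma normcD_le x y : N (x + y) <= N x + N y. Proof. exact: le_normcD. Qed.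

Lemma normcB_le x y : N (x - y) <= N x + N y.
Proof. by rewrite -(normc_opp y); exact: normcD_le. Qed.

Lemma normc_distC x y : N (x - y) = N (y - x).
Proof. by rewrite -normc_opp opprB. Qed.

Lemma normc_eq0 x : (N x == 0) = (x == 0).
Proof.
apply/eqP/eqP => [|->]; [exact: Normc.eq0_normc|exact: normc0].
Qed.

Lemma normc_gt0 x : (0 < N x) = (x != 0).
Proof. by rewrite lt_def normc_ge0 andbT normc_eq0. Qed.

Lemma normc_dist x y : `|N x - N y| <= N (x - y).
Proof.
rewrite ler_norml; apply/andP; split.
  by have := normcD_le x (y - x); rewrite addrC subrK normc_distC; lra.
by have := normcD_le y (x - y); rewrite addrC subrK; lra.
Qed.

Lemma normc_sqr x : N x ^+ 2 = complex.Re x ^+ 2 + complex.Im x ^+ 2.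
Proof. by case: x => a b /=; rewrite sqr_sqrtr// addr_ge0 ?sqr_ge0. Qed.

Lemma normr_Re_le x : `|complex.Re x| <= N x.
Proof.
rewrite -(ler_pXn2r (n := 2)) ?nnegrE ?normc_ge0// real_normK ?num_real// normc_sqr.
by rewrite lerDl sqr_ge0.
Qed.

Lemma normr_Im_le x : `|complex.Im x| <= N x.
Proof.
rewrite -(ler_pXn2r (n := 2)) ?nnegrE ?normc_ge0// real_normK ?num_real// normc_sqr.
by rewrite lerDr sqr_ge0.
Qed.

Lemma normc_real t : N t%:C%C = `|t|.
Proof. by rewrite /= expr0n addr0 sqrtr_sqr. Qed.

Lemma normc_conj x : N x^*%C = N x.
Proof. by case: x => a b /=; rewrite sqrrN. Qed.

Lemma normc_le_ReIm (a b : R) : N (a +i* b)%C <= `|a| + `|b|.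
Proof.
rewrite -(ler_pXn2r (n := 2)) ?nnegrE ?normc_ge0 ?addr_ge0// normc_sqr/=.
rewrite sqrrD !real_normK ?num_real// addrAC lerDl.
by rewrite mulrn_wge0// mulr_ge0.
Qed.

Lemma mul_conj x : x * x^*%C = (N x ^+ 2)%:C%C.
Proof.
case: x => a b; rewrite normc_sqr; apply/eqP; rewrite eq_complex/=.
by apply/andP; split; apply/eqP; ring.
Qed.

Lemma conjD x y : (x + y)^*%C = x^*%C + y^*%C. Proof. exact: rmorphD. Qed.
Lemma conjM x y : (x * y)^*%C = x^*%C * y^*%C. Proof. exact: rmorphM. Qed.
Lemma conjN x : (- x)^*%C = - x^*%C. Proof. exact: rmorphN. Qed.
Lemma ReD x y : complex.Re (x + y) = complex.Re x + complex.Re y.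
Proof. by case: x => ? ?; case: y => ? ?. Qed.
Lemma ReN x : complex.Re (- x) = - complex.Re x.
Proof. by case: x => ? ?. Qed.
Lemma ReRM t x : complex.Re (t%:C%C * x) = t * complex.Re x.
Proof. by case: x => a b /=; ring. Qed.
Lemma Re_conjc x : complex.Re x^*%C = complex.Re x.
Proof. by case: x. Qed.
Lemma real_complexD (a b : R) : (a + b)%:C%C = a%:C%C + b%:C%C :> C.
Proof. exact: rmorphD. Qed.
Lemma real_complexM (a b : R) : (a * b)%:C%C = a%:C%C * b%:C%C :> C.
Proof. exact: rmorphM. Qed.
Lemma real_complexN (a : R) : (- a)%:C%C = - a%:C%C :> C.
Proof. exact: rmorphN. Qed.

End Modulus.

Section Dbar.
Context {R : realType}.
Local Notation C := R[i].
Local Notation N := (@Normc.normc R).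
Implicit Types (F G d : C -> C) (r s : C -> C) (z w : C).

Definition near0 (P : C -> Prop) := exists2 e : R, 0 < e & forall w, N w < e -> P w.

Lemma near0I (P Q : C -> Prop) : near0 P -> near0 Q -> near0 (fun w => P w /\ Q w).
Proof.
move=> [a a0 aP] [b b0 bQ]; exists (Num.min a b); first by rewrite lt_min a0.
by move=> w; rewrite lt_min => /andP[/aP ? /bQ ?].
Qed.

Lemma near0S (P Q : C -> Prop) : (forall w, P w -> Q w) -> near0 P -> near0 Q.
Proof. by move=> PQ [a a0 aP]; exists a => // w /aP/PQ. Qed.

(** Landau symbols as [w] tends to 0, the value at 0 included: [lito1] is o(1), [litow] is o(|w|),
    [bigo1] is O(1) and [bigow] is O(|w|). *)
Definition lito1 r := forall e : R, 0 < e -> near0 (fun w => N (r w) <= e).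
Definition litow r := forall e : R, 0 < e -> near0 (fun w => N (r w) <= e * N w).
Definition bigo1 r := exists2 K : R, 0 < K & near0 (fun w => N (r w) <= K).
Definition bigow r := exists2 K : R, 0 < K & near0 (fun w => N (r w) <= K * N w).

Lemma lito1_bigo1 r : lito1 r -> bigo1 r.
Proof. by move=> /(_ 1 ltr01) h; exists 1. Qed.

Lemma litow_bigow r : litow r -> bigow r.
Proof. by move=> /(_ 1 ltr01) h; exists 1. Qed.

Lemma bigow_lito1 r : bigow r -> lito1 r.
Proof.
move=> [K K0 [d d0 h]] e e0; exists (Num.min d (e / K)).
  by rewrite lt_min d0 divr_gt0.
move=> w; rewrite lt_min => /andP[/h hw]; rewrite ltr_pdivlMr// => ?.
by apply: (le_trans hw); rewrite mulrC ltW.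
Qed.

Lemma bigo1_cst c : bigo1 (fun=> c).
Proof.
exists (N c + 1); first by rewrite ltr_wpDl ?normc_ge0.
by exists 1 => // w _; rewrite lerDl.
Qed.

Lemma bigo1D r s : bigo1 r -> bigo1 s -> bigo1 (fun w => r w + s w).
Proof.
move=> [K K0 h] [L L0 k]; exists (K + L); first exact: addr_gt0.
apply: near0S (near0I h k) => w [? ?]; apply: (le_trans (normcD_le _ _)); exact: lerD.
Qed.

Lemma bigowD r s : bigow r -> bigow s -> bigow (fun w => r w + s w).
Proof.
move=> [K K0 h] [L L0 k]; exists (K + L); first exact: addr_gt0.
apply: near0S (near0I h k) => w [? ?]; apply: (le_trans (normcD_le _ _)).
by rewrite mulrDl; exact: lerD.
Qed.

Lemma litowD r s : litow r -> litow s -> litow (fun w => r w + s w).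
Proof.
move=> h k e e0; have e2 : 0 < e / 2 by rewrite divr_gt0.
apply: near0S (near0I (h _ e2) (k _ e2)) => w [? ?]; apply: (le_trans (normcD_le _ _)).
by rewrite [e in e * _]splitr mulrDl; exact: lerD.
Qed.

Lemma lito1D r s : lito1 r -> lito1 s -> lito1 (fun w => r w + s w).
Proof.
move=> h k e e0; have e2 : 0 < e / 2 by rewrite divr_gt0.
apply: near0S (near0I (h _ e2) (k _ e2)) => w [? ?]; apply: (le_trans (normcD_le _ _)).
by rewrite [leRHS]splitr; exact: lerD.
Qed.

Lemma litowM r s : bigo1 r -> litow s -> litow (fun w => r w * s w).
Proof.
move=> [K K0 h] k e e0; have e2 : 0 < e / K by rewrite divr_gt0.
apply: near0S (near0I h (k _ e2)) => w [h1 h2]; rewrite normcM.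
apply: (le_trans (ler_pM (normc_ge0 _) (normc_ge0 _) h1 h2)).
by rewrite mulrA mulrCA divff ?mulr1 ?gt_eqF.
Qed.

Lemma lito1M r s : bigo1 r -> lito1 s -> lito1 (fun w => r w * s w).
Proof.
move=> [K K0 h] k e e0; have e2 : 0 < e / K by rewrite divr_gt0.
apply: near0S (near0I h (k _ e2)) => w [h1 h2]; rewrite normcM.
apply: (le_trans (ler_pM (normc_ge0 _) (normc_ge0 _) h1 h2)).
by rewrite mulrCA divff ?mulr1 ?gt_eqF.
Qed.

Lemma litow_mul r s : lito1 r -> bigow s -> litow (fun w => r w * s w).
Proof.
move=> h [K K0 k] e e0; have e2 : 0 < e / K by rewrite divr_gt0.
apply: near0S (near0I (h _ e2) k) => w [h1 h2]; rewrite normcM.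
apply: (le_trans (ler_pM (normc_ge0 _) (normc_ge0 _) h1 h2)).
by rewrite mulrA divfK ?gt_eqF.
Qed.

Lemma litow_le r s : (forall w, N (r w) <= N (s w)) -> litow s -> litow r.
Proof. by move=> rs h e /h; apply: near0S => w; exact: le_trans. Qed.

Lemma lito1_le r s : (forall w, N (r w) <= N (s w)) -> lito1 s -> lito1 r.
Proof. by move=> rs h e /h; apply: near0S => w; exact: le_trans. Qed.

Lemma litow_near r s : near0 (fun w => r w = s w) -> litow s -> litow r.
Proof. by move=> rs h e /h/(near0I rs); apply: near0S => w [->]. Qed.

Lemma lito1_near r s : near0 (fun w => r w = s w) -> lito1 s -> lito1 r.
Proof. by move=> rs h e /h/(near0I rs); apply: near0S => w [->]. Qed.

Lemma near0T (P : C -> Prop) : (forall w, P w) -> near0 P.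
Proof. by exists 1. Qed.

Definition ccont F z := lito1 (fun w => F (z + w) - F z).

(* [A] and [B] are the Wirtinger derivatives of [F] at [z]. *)
Definition wirt F z A B :=
  litow (fun w => F (z + w) - F z - (A * w + B * w^*%C)).

Lemma lin_bigow A B : bigow (fun w => A * w + B * w^*%C).
Proof.
exists (N A + N B + 1); first by rewrite ltr_wpDl// addr_ge0 ?normc_ge0.
apply: near0T => w; apply: (le_trans (normcD_le _ _)).
by rewrite !normcM normc_conj !mulrDl mul1r lerDl normc_ge0.
Qed.

Lemma wirt_bigow F z A B : wirt F z A B -> bigow (fun w => F (z + w) - F z).
Proof.
move=> h; have [K K0 k] := bigowD (litow_bigow h) (lin_bigow A B).
by exists K => //; apply: near0S k => w; rewrite subrK.
Qed.

Lemma wirt_ccont F z A B : wirt F z A B -> ccont F z.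
Proof. by move=> /wirt_bigow/bigow_lito1. Qed.

Lemma ccont_bigo1 F z : ccont F z -> bigo1 (fun w => F (z + w)).
Proof.
move=> h; have [K K0 k] := bigo1D (lito1_bigo1 h) (bigo1_cst (F z)).
by exists K => //; apply: near0S k => w; rewrite subrK.
Qed.

Lemma ccont_cst c z : ccont (fun=> c) z.
Proof. by move=> e e0; apply: near0T => w; rewrite subrr normc0 ltW. Qed.

Lemma ccontD F G z : ccont F z -> ccont G z -> ccont (fun x => F x + G x) z.
Proof.
move=> h k; apply: lito1_near (lito1D h k); apply: near0T => w /=; ring.
Qed.

Lemma ccontM F G z : ccont F z -> ccont G z -> ccont (fun x => F x * G x) z.
Proof.
move=> h k.
apply: lito1_near (lito1D (lito1M (ccont_bigo1 h) k) (lito1M (bigo1_cst (G z)) h)).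
by apply: near0T => w /=; ring.
Qed.

Lemma ccontN F z : ccont F z -> ccont (fun x => - F x) z.
Proof.
move=> h; apply: lito1_le h => w; rewrite -[in leRHS]normc_opp.
by rewrite le_eqVlt; apply/orP; left; apply/eqP; congr N; ring.
Qed.

Lemma near_neq0 F z : ccont F z -> F z != 0 ->
  near0 (fun w => F (z + w) != 0 /\ N (F (z + w))^-1 <= 2 / N (F z)).
Proof.
move=> h Fz; have n0 : 0 < N (F z) by rewrite normc_gt0.
have n2 : 0 < N (F z) / 2 by rewrite divr_gt0.
apply: near0S (h _ n2) => w hw.
have lb : N (F z) / 2 <= N (F (z + w)).
  by have := normc_dist (F (z + w)) (F z); rewrite ler_norml => /andP[]; lra.
have gt : 0 < N (F (z + w)) by lra.
split; first by rewrite -normc_gt0.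
by rewrite normcV -[2 / _]invf_div lef_pV2.
Qed.

Lemma ccontV F z : ccont F z -> F z != 0 -> ccont (fun x => (F x)^-1) z.
Proof.
move=> h Fz; have nF := near_neq0 h Fz.
have bV : bigo1 (fun w => (F (z + w))^-1 * - (F z)^-1).
  exists (2 / N (F z) * N (F z)^-1); last first.
    apply: near0S nF => w [_ hw]; rewrite normcM normc_opp; exact: ler_wpM2r (normc_ge0 _) _ _ hw.
  by rewrite normcV mulr_gt0 ?divr_gt0 ?invr_gt0 ?normc_gt0.
apply: lito1_near (lito1M bV h); apply: near0S nF => w [w0 _].
by field; rewrite Fz w0.
Qed.

Lemma wirtD F G z A B A' B' : wirt F z A B -> wirt G z A' B' ->
  wirt (fun x => F x + G x) z (A + A') (B + B').
Proof.
by move=> h k; apply: litow_near (litowD h k); apply: near0T => w /=; ring.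
Qed.

Lemma wirtM F G z A B A' B' : wirt F z A B -> wirt G z A' B' ->
  wirt (fun x => F x * G x) z (A * G z + F z * A') (B * G z + F z * B').
Proof.
move=> h k; have bF := ccont_bigo1 (wirt_ccont h).
have := litowD (litowD (litowM bF k) (litowM (bigo1_cst (G z)) h))
  (litow_mul (wirt_ccont h) (lin_bigow A' B')).
by apply: litow_near; apply: near0T => w /=; ring.
Qed.

Lemma wirtV F z A B : wirt F z A B -> F z != 0 ->
  wirt (fun x => (F x)^-1) z (- A / F z ^+ 2) (- B / F z ^+ 2).
Proof.
move=> h Fz; have cF := wirt_ccont h; have nF := near_neq0 cF Fz.
have bV c : bigo1 (fun w => (F (z + w))^-1 * c).
  exists (2 / N (F z) * (N c + 1)).
    by rewrite mulr_gt0 ?divr_gt0 ?normc_gt0// ltr_wpDl ?normc_ge0.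
  apply: near0S nF => w [_ hw]; rewrite normcM; apply: ler_pM; rewrite ?normc_ge0//.
  by rewrite lerDl.
have := litowD (litowM (bV (- (F z)^-1)) h)
  (litow_mul (lito1M (bV (F z ^- 2)) cF) (lin_bigow A B)).
apply: litow_near; apply: near0S nF => w [w0 _].
by field; rewrite Fz w0.
Qed.

Lemma wirt_conj z : wirt (fun x => x^*%C) z 0 1.
Proof.
move=> e e0; apply: near0T => w.
rewrite conjD (_ : _ - _ = 0) ?normc0 ?mulr_ge0 ?normc_ge0 ?ltW//; ring.
Qed.

Lemma wirt_id z : wirt id z 1 0.
Proof.
move=> e e0; apply: near0T => w.
rewrite (_ : _ - _ = 0) ?normc0 ?mulr_ge0 ?normc_ge0 ?ltW//; ring.
Qed.

Lemma wirt_cst c z : wirt (fun=> c) z 0 0.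
Proof.
move=> e e0; apply: near0T => w.
rewrite (_ : _ - _ = 0) ?normc0 ?mulr_ge0 ?normc_ge0 ?ltW//; ring.
Qed.

Definition pospart (t : R) := Num.max t 0.
(** The squared positive part is a simple C^1 function that vanishes on a half-line; all cutoffs are
    built from it. *)
Definition sqpos (t : R) := pospart t ^+ 2.

Lemma pospart_ge0 t : 0 <= pospart t. Proof. by rewrite le_max lexx orbT. Qed.

Lemma pospart_lip (s t : R) : `|pospart s - pospart t| <= `|s - t|.
Proof.
have h1 := ler_norm (s - t); have := ler_norm (t - s); rewrite (distrC t s) => h2.
have h3 := normr_ge0 (s - t); move: h1 h2 h3; set u := `|s - t| => h1 h2 h3.
by rewrite /pospart; case: (leP s 0) => ?; case: (leP t 0) => ?;
  rewrite ler_norml; apply/andP; split; lra.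
Qed.

Lemma sqpos_diff (s t : R) : `|sqpos s - sqpos t - 2 * pospart t * (s - t)| <= (s - t) ^+ 2.
Proof.
have q1 := sqr_ge0 s; have q2 := sqr_ge0 t; have q3 := sqr_ge0 (s - t).
rewrite /sqpos /pospart; case: (leP s 0) => hs; case: (leP t 0) => ht.
- by rewrite ler_norml; apply/andP; split; lra.
- have st : s * t <= 0 by rewrite mulr_le0_ge0// ltW.
  by rewrite ler_norml; apply/andP; split; lra.
- have st : s * t <= 0 by rewrite mulr_ge0_le0// ltW.
  by rewrite ler_norml; apply/andP; split; lra.
- by rewrite ler_norml; apply/andP; split; lra.
Qed.

Lemma wirt_sqpos (f : C -> R) z A B : wirt (fun x => (f x)%:C%C) z A B ->
  wirt (fun x => (sqpos (f x))%:C%C) z ((2 * pospart (f z))%:C%C * A)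
    ((2 * pospart (f z))%:C%C * B).
Proof.
move=> h; set p := (2 * _)%:C%C.
have c1 := wirt_ccont h; have b1 := wirt_bigow h.
have k1 : litow (fun w => (sqpos (f (z + w)))%:C%C - (sqpos (f z))%:C%C
    - p * ((f (z + w))%:C%C - (f z)%:C%C)).
  apply: litow_le (litow_mul c1 b1) => w.
  rewrite /p -!real_complexN -!real_complexD -!real_complexM -!real_complexN -!real_complexD !normc_real -expr2.
  by rewrite (ger0_norm (sqr_ge0 _)); exact: sqpos_diff.
apply: litow_near (litowD k1 (litowM (bigo1_cst p) h)).
by apply: near0T => w /=; ring.
Qed.

Lemma ccont_pospart (f : C -> R) z : ccont (fun x => (f x)%:C%C) z ->
  ccont (fun x => (pospart (f x))%:C%C) z.
Proof.
apply: lito1_le => w; rewrite -!real_complexN -!real_complexD !normc_real; exact: pospart_lip.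
Qed.

(** Real differentiability with a continuous dbar derivative only. The other Wirtinger derivative is
    left unconstrained, so that holomorphic functions qualify with [d = 0] at once. *)
Definition hasdbar F d z := (exists A, wirt F z A (d z)) /\ ccont d z.

Lemma hasdbar_ccont F d z : hasdbar F d z -> ccont F z.
Proof. by case=> -[A /wirt_ccont]. Qed.

Lemma hasdbar_near F G d d' z :
  near0 (fun w => F (z + w) = G (z + w) /\ d (z + w) = d' (z + w)) ->
  hasdbar F d z -> hasdbar G d' z.
Proof.
move=> h [[A hA] cd].
have [e e0 /(_ 0)] := h; rewrite normc0 addr0 => /(_ e0)[F0 d0].
split; last by apply: lito1_near cd; apply: near0S h => w [_ ->]; rewrite d0.
exists A; apply: litow_near hA; apply: near0S h => w [-> _].
by rewrite F0 d0.
Qed.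

Lemma hasdbar_eq F G d d' z : F =1 G -> d =1 d' ->
  hasdbar F d z -> hasdbar G d' z.
Proof. by move=> FG dd; apply: hasdbar_near; apply: near0T => w; rewrite FG dd. Qed.

Lemma hasdbar_cst c z : hasdbar (fun=> c) (fun=> 0) z.
Proof. by split; [exists 0; exact: wirt_cst|exact: ccont_cst]. Qed.

Lemma hasdbar_hol F A z : wirt F z A 0 -> hasdbar F (fun=> 0) z.
Proof. by split; [exists A|exact: ccont_cst]. Qed.

Lemma hasdbar_id z : hasdbar id (fun=> 0) z.
Proof. exact: hasdbar_hol (wirt_id z). Qed.

Lemma hasdbar_conj z : hasdbar (fun x => x^*%C) (fun=> 1) z.
Proof. by split; [exists 0; exact: wirt_conj|exact: ccont_cst]. Qed.

Lemma hasdbarD F G d d' z : hasdbar F d z -> hasdbar G d' z ->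
  hasdbar (fun x => F x + G x) (fun x => d x + d' x) z.
Proof.
move=> [[A hA] c] [[A' hA'] c']; split; last exact: ccontD.
by exists (A + A'); exact: wirtD.
Qed.

Lemma hasdbarM F G d d' z : hasdbar F d z -> hasdbar G d' z ->
  hasdbar (fun x => F x * G x) (fun x => d x * G x + F x * d' x) z.
Proof.
move=> hF hG; have cF := hasdbar_ccont hF; have cG := hasdbar_ccont hG.
case: hF => [[A hA] c]; case: hG => [[A' hA'] c'].
split; last by apply: ccontD; apply: ccontM.
by exists (A * G z + F z * A'); exact: wirtM.
Qed.

Lemma hasdbarN F d z : hasdbar F d z -> hasdbar (fun x => - F x) (fun x => - d x) z.
Proof.
move=> h; apply: hasdbar_eq (hasdbarM (hasdbar_cst (-1) z) h) => x /=; ring.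
Qed.

Lemma hasdbarV F d z : hasdbar F d z -> F z != 0 ->
  hasdbar (fun x => (F x)^-1) (fun x => - d x / F x ^+ 2) z.
Proof.
move=> hF Fz; have cF := hasdbar_ccont hF; case: hF => [[A hA] c]; split.
  by exists (- A / F z ^+ 2); exact: wirtV.
apply: ccontM; first exact: ccontN.
apply: (@ccontV (fun x => F x ^+ 2)); last by rewrite expf_neq0.
exact: (ccontM cF cF).
Qed.

Lemma hasdbar_sqpos (f : C -> R) d z : hasdbar (fun x => (f x)%:C%C) d z ->
  hasdbar (fun x => (sqpos (f x))%:C%C)
    (fun x => (2 * pospart (f x))%:C%C * d x) z.
Proof.
move=> hf; have cf := hasdbar_ccont hf; case: hf => [[A hA] c]; split.
  by exists ((2 * pospart (f z))%:C%C * A); exact: wirt_sqpos.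
apply: ccontM => //; have := ccontM (ccont_cst 2%:C%C z) (ccont_pospart cf).
by apply: lito1_near; apply: near0T => w; rewrite !real_complexM.
Qed.

(** A C^1 transition from 0 to 1: it equals [1 - (1 - t^2)^2] on [0, 1], is constant on either side,
    and has derivative [dstep]. *)
Definition step (t : R) := 1 - sqpos (1 - sqpos t).
Definition dstep (t : R) := 4 * pospart (1 - sqpos t) * pospart t.

Lemma hasdbar_step (f : C -> R) d z : hasdbar (fun x => (f x)%:C%C) d z ->
  hasdbar (fun x => (step (f x))%:C%C) (fun x => (dstep (f x))%:C%C * d x) z.
Proof.
move=> hf.
have h1 : hasdbar (fun x => (1 - sqpos (f x))%:C%C)
    (fun x => - ((2 * pospart (f x))%:C%C * d x)) z.
  apply: hasdbar_eq (hasdbarD (hasdbar_cst 1%:C%C z) (hasdbarN (hasdbar_sqpos hf))) => x.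
    by rewrite real_complexD real_complexN.
  by rewrite add0r.
apply: hasdbar_eq (hasdbarD (hasdbar_cst 1%:C%C z) (hasdbarN (hasdbar_sqpos h1))) => x.
  by rewrite /step real_complexD real_complexN.
by rewrite /dstep !real_complexM (_ : 4%:C%C = 2%:C%C * 2%:C%C); [ring|rewrite -real_complexM; congr _%:C%C; ring].
Qed.

Lemma sqpos_le0 t : t <= 0 -> sqpos t = 0.
Proof. by move=> t0; rewrite /sqpos /pospart max_r// expr0n. Qed.

Lemma sqpos_ge0 t : 0 <= sqpos t. Proof. exact: sqr_ge0. Qed.

Lemma step_le0 t : t <= 0 -> step t = 0.
Proof.
by move=> t0; rewrite /step (sqpos_le0 t0) subr0 /sqpos /pospart max_l// expr1n subrr.
Qed.

Lemma sqpos_ge1 t : 1 <= t -> 1 <= sqpos t.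
Proof. by move=> t1; rewrite /sqpos /pospart max_l; [nra|lra]. Qed.

Lemma step_ge1 t : 1 <= t -> step t = 1.
Proof. by move=> t1; have := sqpos_ge1 t1; rewrite /step => ?; rewrite sqpos_le0 ?subr0//; lra. Qed.

Lemma sqpos_le1 t : t <= 1 -> sqpos t <= 1.
Proof.
move=> t1; rewrite /sqpos expr_le1// ?pospart_ge0//.
by rewrite /pospart ge_max t1 ler01.
Qed.

Lemma step_ge0 t : 0 <= step t.
Proof. by rewrite subr_ge0 sqpos_le1// gerBl sqpos_ge0. Qed.

Lemma step_le1 t : step t <= 1.
Proof. by rewrite gerBl sqpos_ge0. Qed.

Lemma dstep_ge0 t : 0 <= dstep t.
Proof. by rewrite !mulr_ge0 ?pospart_ge0. Qed.

Lemma dstep_out t : t <= 0 \/ 1 <= t -> dstep t = 0.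
Proof.
rewrite /dstep => -[t0|/sqpos_ge1 t1]; first by rewrite [pospart t]max_r ?mulr0.
by rewrite /pospart max_r ?mulr0 ?mul0r//; lra.
Qed.

Lemma dstep_le4 t : dstep t <= 4.
Proof.
have [t1|t1] := leP 1 t; first by rewrite dstep_out; [lra|right].
have p1 : pospart t <= 1 by rewrite /pospart ge_max ler01 andbT ltW.
have p2 : pospart (1 - sqpos t) <= 1.
  by rewrite /pospart ge_max ler01 andbT gerBl sqpos_ge0.
rewrite /dstep -mulrA -[leRHS]mulr1 ler_wpM2l//.
by rewrite -[leRHS]mulr1 ler_pM ?pospart_ge0.
Qed.

End Dbar.

(** * Stokes' formula in the unit disc *)

Section DiscIntegral.
Context {R : realType}.
Local Notation C := R[i].
Local Notation N := (@Normc.normc R).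
Local Notation mu2 := (@lebesgue_measure R \x @lebesgue_measure R)%E.
Local Notation R2 := (measurableTypeR R * measurableTypeR R)%type.
Local Notation E2 := (plane_set (@unit_disc R)).
Implicit Types (F G d : C -> C) (z w : C).

Definition pt (p : R * R) : C := (p.1 +i* p.2)%C.

Definition copen (O : set C) := forall z, O z -> near0 (fun w => O (z + w)).

Lemma near0_box z (P : C -> Prop) : near0 (fun w => P (z + w)) ->
  exists2 e : R, 0 < e & forall q : R * R,
    `|q.1 - complex.Re z| < e -> `|q.2 - complex.Im z| < e -> P (pt q).
Proof.
move=> [e e0 he]; exists (e / 2); first by rewrite divr_gt0.
case=> a b /= h1 h2; have -> : pt (a, b) = z + ((a - complex.Re z) +i* (b - complex.Im z))%C.
  case: z {he h1 h2} => x y; apply/eqP; rewrite eq_complex /=.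
  by apply/andP; split; apply/eqP; ring.
by apply: he; apply: (le_lt_trans (normc_le_ReIm _ _)); lra.
Qed.

Lemma open2_plane (O : set C) : copen O -> open2 (plane_set O).
Proof. by move=> oO p /oO/near0_box. Qed.

Lemma cont2_Re G p : ccont G (pt p) -> cont2 (fun p => complex.Re (G (pt p))) p.
Proof.
move=> h e e0; have e2 : 0 < e / 2 by rewrite divr_gt0.
have [d d0 hd] := near0_box (P := fun x => N (G x - G (pt p)) <= e / 2) (h _ e2).
exists d => // q q1 q2; have := hd _ q1 q2; rewrite -ReN -ReD => hN.
by apply: (le_lt_trans (normr_Re_le _)); lra.
Qed.

Lemma copen_disc : copen (@unit_disc R).
Proof.
move=> z zE; exists (1 - N z); first by rewrite subr_gt0.
by move=> w hw; apply: (le_lt_trans (normcD_le _ _)); lra.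
Qed.

Lemma plane_measurable (O : set C) : copen O -> measurable (plane_set O : set R2).
Proof. by move=> oO; apply: open2_measurable; exact: open2_plane. Qed.

Lemma disc_measurable : measurable (E2 : set R2).
Proof. exact: plane_measurable copen_disc. Qed.

Lemma disc_box p : E2 p -> `|p.1| < 1 /\ `|p.2| < 1.
Proof.
by move=> pE; split; apply: le_lt_trans pE; [exact: (normr_Re_le (pt p))|exact: (normr_Im_le (pt p))].
Qed.

Lemma disc_lty : (mu2 E2 < +oo)%E.
Proof.
apply: (@le_lt_trans _ _ (mu2 (`]- 1, 1]%classic `*` `]- 1, 1]%classic : set R2))).
  apply: le_measure; rewrite ?inE; first exact: disc_measurable.
    by apply: measurableX; exact: measurable_itv.
  move=> p /disc_box[]; rewrite !ltr_norml => /andP[? ?] /andP[? ?].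
  by split; rewrite /= in_itv/=; apply/andP; split => //; exact: ltW.
have -> : mu2 (`]- 1, 1]%classic `*` `]- 1, 1]%classic : set R2) = ((1 - -1) * (1 - -1))%:E.
  by apply: mu2_box; lra.
by rewrite ltry.
Qed.

Lemma disc_integrable (O : set C) (f : R * R -> R) (M : R) :
  copen O -> O `<=` @unit_disc R -> (forall p, O (pt p) -> cont2 f p) ->
  (forall p, O (pt p) -> `|f p| <= M) -> mu2.-integrable (plane_set O) (EFin \o f).
Proof.
move=> oO OE cf fM; apply: measurable_bounded_integrable.
- exact: plane_measurable.
- apply: le_lt_trans disc_lty; apply: le_measure; rewrite ?inE.
  + exact: plane_measurable.
  + exact: disc_measurable.
  + by move=> p /OE.
- by apply: cont2_measurable => //; exact: open2_plane.
- exists M; split; first exact: num_real.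
  by move=> K MK p /fM h; apply: le_trans h (ltW MK).
Qed.

(** Real parts are enough: in [estimate], f is first multiplied by a unimodular constant that makes
    its value at z nonnegative. *)
Definition ReI G : R := Rintegral mu2 E2 (fun p => complex.Re (G (pt p))).

Lemma ReI_integrable G : (forall z, ccont G z) ->
  mu2.-integrable E2 (EFin \o (fun p => complex.Re (G (pt p)))).
Proof.
move=> cG; have cf p := @cont2_Re G p (cG (pt p)).
have [M M0 hM] := cont2_bounded 1 cf.
apply: (@disc_integrable _ _ M) => //; first exact: copen_disc.
by move=> p /disc_box[? ?]; apply: hM; exact: ltW.
Qed.

Lemma ReID F G : (forall z, ccont F z) -> (forall z, ccont G z) ->
  ReI (fun x => F x + G x) = ReI F + ReI G.
Proof.
move=> cF cG; rewrite /ReI -RintegralD; [|exact: disc_measurable|exact: ReI_integrable..].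
by congr Rintegral; apply/funext => p; rewrite ReD.
Qed.

Lemma ReIZ (t : R) G : (forall z, ccont G z) ->
  ReI (fun x => t%:C%C * G x) = t * ReI G.
Proof.
move=> cG; rewrite /ReI -RintegralZl; [|exact: disc_measurable|exact: ReI_integrable].
by congr Rintegral; apply/funext => p; rewrite ReRM.
Qed.

Lemma ReI_le F G : (forall z, ccont F z) -> (forall z, ccont G z) ->
  (forall z, unit_disc z -> complex.Re (F z) <= complex.Re (G z)) -> ReI F <= ReI G.
Proof.
move=> cF cG FG; apply: le_Rintegral; [exact: disc_measurable|exact: ReI_integrable..|].
by move=> p; exact: FG.
Qed.

(** The real field [(Re F, Re (i F))] has divergence [2 Re d], and it vanishes on the boundary of
    the square [-1, 1]^2, which contains the disc. *)
Lemma green F d : (forall z, hasdbar F d z) ->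
  (forall z, ~ unit_disc z -> F z = 0 /\ d z = 0) -> ReI d = 0.
Proof.
move=> h out.
have cF z : ccont F z := hasdbar_ccont (h z).
have cd z : ccont d z by case: (h z).
pose P p := complex.Re (F (pt p)).
pose Q p := complex.Re ('i%C * F (pt p)).
pose D p := complex.Re (2%:C%C * d (pt p)).
have cP p : cont2 P p by apply: cont2_Re.
have cQ p : cont2 Q p by apply: (@cont2_Re (fun z => 'i%C * F z)); apply: ccontM => //; exact: ccont_cst.
have c2d z : ccont (fun z => 2%:C%C * d z) z by apply: ccontM => //; exact: ccont_cst.
have cD p : cont2 D p by apply: (@cont2_Re (fun z => 2%:C%C * d z)).
have outP p : 1 <= `|p.1| \/ 1 <= `|p.2| -> ~ unit_disc (pt p).
  by move=> h1 /disc_box[]; lra.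
have H := @divergence0 _ P Q D 1 cP cQ cD _ ltr01 _.
have : int2 D (-1) 1 (-1) 1 = 0.
  apply: H => p; last first.
    by move=> /outP/out[F0 _]; rewrite /P /Q F0 mulr0.
  have [[A hA] _] := h (pt p).
  exists (complex.Re (A + d (pt p))), (complex.Re ('i%C * (A - d (pt p)))),
    (complex.Re ('i%C * (A + d (pt p)))) => e e0.
  have nr : near0 (fun w => N (F (pt p + w) - F (pt p) - (A * (pt p + w - pt p) +
     d (pt p) * (pt p + w - pt p)^*%C)) <= e * N (pt p + w - pt p)).
    by apply: near0S (hA e e0) => w; rewrite (_ : pt p + w - pt p = w)//; ring.
  have [r r0 hr] := near0_box (P := fun x => N (F x - F (pt p) - (A * (x - pt p) +
     d (pt p) * (x - pt p)^*%C)) <= e * N (x - pt p)) nr.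
  clear nr; exists r => // q q1 q2; have := hr q q1 q2; clear hr; rewrite /P /Q /D.
  set dz := pt q - pt p; have Edz : dz = ((q.1 - p.1) +i* (q.2 - p.2))%C by [].
  set X := F (pt q) - F (pt p) - _ => hX.
  have hX2 : N X <= e * (`|q.1 - p.1| + `|q.2 - p.2|).
    by apply: (le_trans hX); apply: ler_wpM2l (ltW e0) _ _ _; rewrite Edz; exact: normc_le_ReIm.
  have EX : F (pt q) = X + F (pt p) + (A * dz + d (pt p) * dz^*%C) by rewrite /X; ring.
  rewrite EX Edz; split.
    apply: le_trans hX2; apply: le_trans (normr_Re_le X); rewrite le_eqVlt; apply/orP; left; apply/eqP; congr (`|_|).
    by case: X {hX EX} => ? ?; case: (F (pt p)) => ? ?; case: A {hA} => ? ?; case: (d (pt p)) => ? ?; simpl; ring.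
  apply: le_trans hX2; apply: le_trans (normr_Im_le X); rewrite -[leRHS]normrN le_eqVlt; apply/orP; left; apply/eqP; congr (`|_|).
  by case: X {hX EX} => ? ?; case: (F (pt p)) => ? ?; case: A {hA} => ? ?; case: (d (pt p)) => ? ?; simpl; ring.
move=> I0; have : 2 * ReI d = 0.
  rewrite -ReIZ// -I0 /int2 /ReI.
  have E0 : E2 = (`](-1), 1]%classic `*` `](-1), 1]%classic) `&` E2.
    apply/seteqP; split; last by move=> p [].
    move=> p pE; split=> //; have [] := disc_box pE; rewrite !ltr_norml => /andP[? ?] /andP[? ?].
    by split; rewrite /= in_itv/=; apply/andP; split => //; exact: ltW.
  rewrite [in LHS]E0 Rintegral_mkcondr; congr Rintegral.
  apply/funext => p; rewrite patchE; case: ifPn => // /negP pE.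
  by rewrite /D; have [_ ->] := out (pt p) ltac:(by move=> ?; apply: pE; rewrite inE); rewrite mulr0.
lra.
Qed.

End DiscIntegral.

(** * The reproducing formula with a cutoff *)

Section Kernel.
Context {R : realType}.
Local Notation C := R[i].
Local Notation N := (@Normc.normc R).
Implicit Types (F G d f g : C -> C) (z w x : C) (t : R).

Lemma real_complex0 : 0%:C%C = 0 :> C. Proof. by []. Qed.

Definition den z x : C := 1 - x^*%C * z.
(* The Bergman kernel of the disc is [kern] divided by the constant [mass 0], whose value (pi) is never needed. *)
Definition kern z x : C := ((1 - x * z^*%C) ^+ 2)^-1.
(** The dbar derivative of the smoothed Cauchy kernel [vker]: a nonnegative approximate point mass,
    carried by the ring [t <= |x - z|^2 <= 2 t]. *)
Definition bump t z x : R := dstep (N (x - z) ^+ 2 / t - 1) / t.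
Definition vker t z x : C := (step (N (x - z) ^+ 2 / t - 1))%:C%C * (x - z)^-1.
(* [usol] has dbar derivative [conj (kern z) - bump t z]; its pole is smoothed at scale [sqrt t]. *)
Definition usol t z x : C := x^*%C * (den z x)^-1 - vker t z x.
(* The limit of [usol] as [t] tends to 0; it vanishes on the unit circle. *)
Definition ukern z x : C := x^*%C * (den z x)^-1 - (x - z)^-1.

Lemma conj_kern z x : (kern z x)^*%C = (den z x ^+ 2)^-1.
Proof.
by rewrite /kern /den fmorphV rmorphXn rmorphB rmorph1 rmorphM /= conjcK.
Qed.

Lemma normc_den_ge z x : unit_disc x -> 1 - N z <= N (den z x).
Proof.
rewrite /unit_disc /= => x1; have := normc_dist 1 (x^*%C * z); rewrite normc1 normcM normc_conj ler_norml => /andP[_].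
rewrite -/(den z x); have : N x * N z <= N z by rewrite ler_piMl ?normc_ge0 ?ltW.
lra.
Qed.

Lemma den_neq0 z x : unit_disc z -> unit_disc x -> den z x != 0.
Proof.
move=> z1 x1; rewrite -normc_gt0; apply: lt_le_trans (normc_den_ge z x1).
by rewrite subr_gt0.
Qed.

(** Over a common denominator the numerator is [|x|^2 - 1]. This linear decay at the circle pays for
    the gradient of the boundary cutoff. *)
Lemma normc_ukern z x : unit_disc z -> unit_disc x -> x != z ->
  N (ukern z x) = (1 - N x ^+ 2) / (N (den z x) * N (x - z)).
Proof.
move=> z1 x1 xz; have d0 := den_neq0 z1 x1.
have xz0 : x - z != 0 by rewrite subr_eq0.
have -> : ukern z x = (x * x^*%C - 1) / (den z x * (x - z)).
  by rewrite /ukern /den in d0 *; field; rewrite d0 xz0.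
rewrite mul_conj -[1]/(1%:C%C) -real_complexN -real_complexD normcM normcV normcM normc_real distrC ger0_norm// subr_ge0.
by rewrite expr_le1// ?normc_ge0// ltW.
Qed.

Lemma hasdbar_sqdist a t z :
  hasdbar (fun x => (N (x - a) ^+ 2 / t - 1)%:C%C) (fun x => (t^-1)%:C%C * (x - a)) z.
Proof.
have h1 := hasdbarD (hasdbar_id z) (hasdbar_cst (- a) z).
have h2 := hasdbarD (hasdbar_conj z) (hasdbar_cst (- a^*%C) z).
have h := hasdbarD (hasdbarM (hasdbarM h1 h2) (hasdbar_cst (t^-1)%:C%C z)) (hasdbar_cst (-1) z).
apply: hasdbar_eq h => x /=; last by ring.
by rewrite real_complexD real_complexM real_complexN -mul_conj rmorphB.
Qed.

Lemma hasdbar_vker t a z : 0 < t ->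
  hasdbar (vker t a) (fun x => (bump t a x)%:C%C) z.
Proof.
move=> t0; have [->|za] := eqVneq z a.
  apply: hasdbar_near (hasdbar_cst 0 a).
  (* For [|w| < min 1 t] one has [|w|^2 <= |w| < t], so both functions vanish identically near the
     pole. *)
  exists (Num.min 1 t); first by rewrite lt_min ltr01.
  move=> w; rewrite lt_min => /andP[w1 wt].
  have out : N w ^+ 2 / t - 1 <= 0.
    have : N w ^+ 2 <= N w by rewrite expr2 ler_piMl ?normc_ge0// ltW.
    by rewrite subr_le0 ler_pdivrMr// mul1r; lra.
  rewrite /vker /bump (_ : a + w - a = w); last by ring.
  by rewrite step_le0// dstep_out ?mul0r//; left.
have hinv : hasdbar (fun x => (x - a)^-1) (fun=> 0) z.
  apply: hasdbar_eq (hasdbarV (hasdbarD (hasdbar_id z) (hasdbar_cst (- a) z)) _) => //=.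
    by move=> x; rewrite addr0 oppr0 mul0r.
  by rewrite subr_eq0.
apply: hasdbar_eq (hasdbarM (hasdbar_step (hasdbar_sqdist a t z)) hinv) => // x /=.
rewrite mulr0 addr0 /bump (real_complexM (dstep _)) -mulrA; have [->|xa] := eqVneq x a.
  have D0 : dstep (- 1) = 0 :> R by apply: dstep_out; left; lra.
  by rewrite subrr normc0 expr0n mul0r sub0r D0 real_complex0 !mul0r.
by congr (_ * _); rewrite mulfK// subr_eq0.
Qed.

Lemma hasdbar_usol t a z : 0 < t -> unit_disc a -> unit_disc z ->
  hasdbar (usol t a) (fun x => (kern a x)^*%C - (bump t a x)%:C%C) z.
Proof.
move=> t0 a1 z1; apply: hasdbarD; last exact/hasdbarN/hasdbar_vker.
have hd : hasdbar (den a) (fun=> - a) z.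
  apply: hasdbar_eq (hasdbarD (hasdbar_cst 1 z)
    (hasdbarN (hasdbarM (hasdbar_conj z) (hasdbar_cst a z)))) => // x /=; ring.
have := hasdbarM (hasdbar_conj z) (hasdbarV hd (den_neq0 a1 z1)).
apply: hasdbar_near; apply: near0S (copen_disc z1) => w w1; split => //.
have d0 := den_neq0 a1 w1; rewrite conj_kern.
have E : den a (z + w) = 1 - (z + w)^*%C * a by [].
have EX : (z + w)^*%C * a = 1 - den a (z + w) by rewrite E; ring.
move: d0 EX; set D := den a (z + w) => d0 EX.
have -> : (z + w)^*%C * (- - a / D ^+ 2) = (z + w)^*%C * a / D ^+ 2 by ring.
rewrite EX.
by field.
Qed.

Lemma bump_ge0 t z x : 0 < t -> 0 <= bump t z x.
Proof. by move=> t0; rewrite divr_ge0 ?dstep_ge0// ltW. Qed.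

Lemma bump_out t z x : 0 < t -> 2 * t <= N (x - z) ^+ 2 ->
  vker t z x = (x - z)^-1 /\ bump t z x = 0.
Proof.
move=> t0 h; have h1 : 1 <= N (x - z) ^+ 2 / t - 1.
  by rewrite lerBrDr ler_pdivlMr//; lra.
by rewrite /vker /bump step_ge1// dstep_out ?mul0r ?mul1r//; right.
Qed.

Lemma ccont_bump t a z : 0 < t -> ccont (fun x => (bump t a x)%:C%C) z.
Proof. by move=> t0; case: (hasdbar_vker a z t0). Qed.

(** For [t <= rad z] the bump lives inside the disc: outside, [|x - z|^2] is at least
    [(1 - |z|)^2 = 4 rad z], hence at least [2 t]. *)
Definition rad z : R := (1 - N z) ^+ 2 / 4.

Lemma rad_gt0 z : unit_disc z -> 0 < rad z.
Proof.
by rewrite /unit_disc /= => z1; rewrite /rad divr_gt0// exprn_gt0//; lra.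
Qed.

Lemma far_out z x : ~ unit_disc x -> unit_disc z -> (1 - N z) ^+ 2 <= N (x - z) ^+ 2.
Proof.
rewrite /unit_disc /= => /negP; rewrite -leNgt => x1 z1.
have := normc_dist x z; rewrite ler_norml => /andP[_ h].
rewrite ler_pXn2r ?nnegrE ?normc_ge0//; lra.
Qed.

Definition mass z : R := ReI (fun x => (bump (rad z) z x)%:C%C).

(** The smoothed Cauchy kernels for [t] and [rad z] agree outside the disc, so [green] applies to
    their difference. *)
Lemma bump_mass t z : unit_disc z -> 0 < t -> t <= rad z ->
  ReI (fun x => (bump t z x)%:C%C) = mass z.
Proof.
move=> z1 t0 tr; have r0 := rad_gt0 z1.
have G := @green _ (fun x => vker t z x - vker (rad z) z x)
  (fun x => (bump t z x)%:C%C + (-1)%:C%C * (bump (rad z) z x)%:C%C).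
have : ReI (fun x => (bump t z x)%:C%C + (-1)%:C%C * (bump (rad z) z x)%:C%C) = 0.
  apply: G => [x|x x1].
    apply: hasdbar_eq (hasdbarD (hasdbar_vker z x t0) (hasdbarN (hasdbar_vker z x r0))) => // y.
    by rewrite real_complexN mulN1r.
  have far := far_out x1 z1.
  have f1 : 2 * t <= N (x - z) ^+ 2.
    by apply: le_trans far; move: r0 tr; rewrite /rad; lra.
  have f2 : 2 * rad z <= N (x - z) ^+ 2.
    by apply: le_trans far; move: r0; rewrite /rad; lra.
  have [-> ->] := bump_out t0 f1.
  have [-> ->] := bump_out r0 f2.
  by rewrite subrr mulr0 addr0.
rewrite ReID; [|by move=> x; exact: ccont_bump|]; last first.
  by move=> x; apply: ccontM; [exact: ccont_cst|exact: ccont_bump].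
rewrite ReIZ => [|x]; last exact: ccont_bump.
by rewrite /mass; lra.
Qed.

Lemma mass_ge0 z : unit_disc z -> 0 <= mass z.
Proof.
move=> z1; rewrite /mass /ReI; apply: Rintegral_ge0 => p _ /=.
exact/bump_ge0/rad_gt0.
Qed.

Lemma ccont_near0 F z : near0 (fun w => F (z + w) = 0) -> ccont F z.
Proof.
move=> h; have F0 : F z = 0 by case: h => e e0 /(_ 0); rewrite normc0 addr0; exact.
by apply: lito1_near (ccont_cst 0 z); apply: near0S h => w ->; rewrite F0.
Qed.

Lemma ccont_kern a z : unit_disc a -> unit_disc z -> ccont (fun x => (kern a x)^*%C) z.
Proof.
move=> a1 z1; have [_ h] := hasdbar_usol (rad_gt0 a1) a1 z1.
apply: lito1_near (ccontD h (ccont_bump a z (rad_gt0 a1))).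
by apply: near0T => w; rewrite !subrK.
Qed.

Section Repr.
Variables (O : set C) (f g : C -> C) (chi : C -> R) (z : C).
Hypothesis OE : O `<=` @unit_disc R.
Hypothesis hol : forall x, O x -> exists A, wirt f x A 0.
Hypothesis hchi : forall x, hasdbar (fun x => (chi x)%:C%C) g x.
Hypothesis chi0 : forall x, ~ O x -> near0 (fun w => chi (x + w) = 0 /\ g (x + w) = 0).
Hypothesis Oz : O z.
Hypothesis chi1 : near0 (fun w => chi (z + w) = 1 /\ g (z + w) = 0).

Let fg x := f x * g x * ukern z x.
Let fk x := (chi x)%:C%C * (f x * (kern z x)^*%C).

Let z1 : unit_disc z. Proof. exact: OE. Qed.

Let cf x : O x -> ccont f x.
Proof. by move=> /hol[A /wirt_ccont]. Qed.

Lemma repr_ccont1 x : ccont fg x.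
Proof.
have [->|xz] := eqVneq x z.
  by apply: ccont_near0; apply: near0S chi1 => w [_ g0]; rewrite /fg g0 mulr0 mul0r.
have [Ox|Ox] := pselect (O x); last first.
  by apply: ccont_near0; apply: near0S (chi0 Ox) => w [_ g0]; rewrite /fg g0 mulr0 mul0r.
have [_ cg] := hchi x.
apply: ccontM; first by apply: ccontM => //; exact: cf.
apply: ccontD.
  have h := hasdbar_ccont (hasdbar_usol (rad_gt0 z1) z1 (OE Ox)).
  have h2 := hasdbar_ccont (hasdbar_vker z x (rad_gt0 z1)).
  apply: lito1_near (ccontD h h2); apply: near0T => w; rewrite /usol !subrK//.
apply: ccontN; apply: (@ccontV _ (fun x => x - z)); last by rewrite subr_eq0.
by apply: ccontD; [exact: hasdbar_ccont (hasdbar_id x)|exact: ccont_cst].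
Qed.

Lemma repr_ccont2 x : ccont fk x.
Proof.
have [Ox|Ox] := pselect (O x); last first.
  by apply: ccont_near0; apply: near0S (chi0 Ox) => w [c0 _]; rewrite /fk c0 mul0r.
apply: ccontM; first exact: hasdbar_ccont (hchi x).
by apply: ccontM; [exact: cf|apply: ccont_kern => //; exact: OE].
Qed.

Let fb t x := (chi x)%:C%C * (f x * (bump t z x)%:C%C).

Let cfb t x : 0 < t -> ccont (fb t) x.
Proof.
move=> t0; have [Ox|Ox] := pselect (O x); last first.
  by apply: ccont_near0; apply: near0S (chi0 Ox) => w [c0 _]; rewrite /fb c0 mul0r.
apply: ccontM; first exact: hasdbar_ccont (hchi x).
by apply: ccontM; [exact: cf|exact: ccont_bump].
Qed.

(** Stokes for [chi f usol]. Its dbar derivative contains [usol] only in a product with [g], which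
    vanishes within distance [d] of z; farther out [usol] equals [ukern]. *)
Let repr_bump t (d : R) : 0 < t -> 0 < d -> 2 * t <= d ^+ 2 ->
  (forall w, N w < d -> chi (z + w) = 1 /\ g (z + w) = 0) ->
  ReI fg + ReI fk = ReI (fb t).
Proof.
move=> t0 d0 td near.
pose D x := fg x + (fk x + (-1)%:C%C * fb t x).
have c3 x : ccont (fun x => (-1)%:C%C * fb t x) x.
  by apply: ccontM; [exact: ccont_cst|exact: cfb].
have c23 x : ccont (fun x => fk x + (-1)%:C%C * fb t x) x.
  by apply: ccontD => //; exact: repr_ccont2.
suff : ReI D = 0.
  rewrite /D ReID//; last exact: repr_ccont1.
  rewrite ReID//; last exact: repr_ccont2.
  by rewrite ReIZ => [|x]; [lra|exact: cfb].
have ED x : D x = g x * (f x * usol t z x) +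
    (chi x)%:C%C * (f x * ((kern z x)^*%C - (bump t z x)%:C%C)).
  rewrite /D /fg /fk /fb real_complexN.
  suff -> : f x * g x * ukern z x = g x * (f x * usol t z x) by ring.
  have [xd|xd] := ltP (N (x - z)) d.
    have [_ ] := near _ xd; rewrite addrC subrK => ->; ring.
  have d2 : d ^+ 2 <= N (x - z) ^+ 2 by rewrite ler_pXn2r ?nnegrE ?normc_ge0 ?(ltW d0).
  have [E _] := bump_out t0 (le_trans td d2).
  by rewrite /usol E /ukern; ring.
apply: (@green _ (fun x => (chi x)%:C%C * (f x * usol t z x))) => x; last first.
  move=> x1; have /chi0[e e0 /(_ 0)] : ~ O x by move/OE.
  by rewrite normc0 addr0 => /(_ e0)[c0 g0]; rewrite ED c0 g0 !mul0r addr0.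
have [Ox|Ox] := pselect (O x); last first.
  apply: hasdbar_near (hasdbar_cst 0 x); apply: near0S (chi0 Ox) => w [c0 g0].
  by rewrite ED c0 g0 !mul0r addr0.
have [A hA] := hol Ox.
have h := hasdbarM (hchi x) (hasdbarM (hasdbar_hol hA) (hasdbar_usol t0 z1 (OE Ox))).
by apply: hasdbar_eq h => // y; rewrite ED; ring.
Qed.

(** The right-hand side does not depend on [t]; as [t] tends to 0 the bump concentrates at z, where
    f is continuous, and its mass stays the same. *)
Lemma reproducing : mass z * complex.Re (f z) = ReI fg + ReI fk.
Proof.
have [d d0 hd] := chi1.
have m0 := mass_ge0 z1; have r0 := rad_gt0 z1.
have est e : 0 < e -> `|ReI fg + ReI fk - mass z * complex.Re (f z)| <= e * mass z.
  move=> e0; have [d' d'0 hd'] := cf Oz e0.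
  pose k := Num.min d d'; have k0 : 0 < k by rewrite lt_min d0.
  have kd : k <= d by rewrite ge_min lexx.
  have kd' : k <= d' by rewrite ge_min lexx orbT.
  (* The first bound fixes the mass of the bump; the second confines it to the disc of radius [k],
     where [chi] is 1 and f differs from [f z] by at most [e]. *)
  pose t := Num.min (rad z) (k ^+ 2 / 2).
  have t0 : 0 < t by rewrite lt_min r0 divr_gt0// exprn_gt0.
  have tr : t <= rad z by rewrite ge_min lexx.
  have tk : 2 * t <= k ^+ 2.
    have : t <= k ^+ 2 / 2 by rewrite ge_min lexx orbT.
    lra.
  have td : 2 * t <= d ^+ 2.
    by apply: (le_trans tk); rewrite ler_pXn2r ?nnegrE ?(ltW d0) ?(ltW k0).
  rewrite (repr_bump t0 d0 td hd) -(bump_mass z1 t0 tr).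
  have cb x : ccont (fun x => (bump t z x)%:C%C) x by exact: ccont_bump.
  have cbz s x : ccont (fun x => s%:C%C * (bump t z x)%:C%C) x.
    by apply: ccontM => //; exact: ccont_cst.
  have pw x : `|complex.Re (fb t x) - complex.Re (f z) * bump t z x| <= e * bump t z x.
    have [xk|xk] := ltP (N (x - z)) k; last first.
      have k2 : k ^+ 2 <= N (x - z) ^+ 2 by rewrite ler_pXn2r ?nnegrE ?normc_ge0 ?(ltW k0).
      have [_ b0] := bump_out t0 (le_trans tk k2).
      by rewrite /fb b0 real_complex0 !mulr0 subr0 normr0.
    have [] := hd _ (lt_le_trans xk kd); have := hd' _ (lt_le_trans xk kd').
    rewrite (_ : z + (x - z) = x); last by ring.
    move=> hf c1 _; rewrite /fb c1 mul1r (mulrC (f x)) ReRM (mulrC (complex.Re (f z))).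
    rewrite -mulrBr normrM (ger0_norm (bump_ge0 _ _ t0)) mulrC ler_wpM2r ?bump_ge0//.
    by rewrite -ReN -ReD; apply: le_trans (normr_Re_le _) hf.
  have le1 : ReI (fb t) <= ReI (fun x => (complex.Re (f z) + e)%:C%C * (bump t z x)%:C%C).
    apply: ReI_le => // [x|x _]; first exact: cfb.
    by have := pw x; rewrite ReRM ler_norml => /andP[]/=; lra.
  have le2 : ReI (fun x => (complex.Re (f z) - e)%:C%C * (bump t z x)%:C%C) <= ReI (fb t).
    apply: ReI_le => // [x|x _]; first exact: cfb.
    by have := pw x; rewrite ReRM ler_norml => /andP[]/=; lra.
  rewrite !ReIZ// in le1 le2.
  by rewrite ler_norml; apply/andP; split; lra.
apply/eqP; rewrite eq_sym -subr_eq0 -normr_eq0 eq_le normr_ge0 andbT.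
apply/ler_addgt0Pr => e e0; rewrite add0r.
have e1 : 0 < e / (mass z + 1) by rewrite divr_gt0//; lra.
apply: (le_trans (est _ e1)); rewrite -mulrA ler_piMr ?(ltW e0)//.
by rewrite mulrC ler_pdivrMr; lra.
Qed.

End Repr.

End Kernel.

(** * Cutoffs at the unit circle *)

Section Boundary.
Context {R : realType}.
Local Notation C := R[i].
Local Notation N := (@Normc.normc R).
Local Notation mu2 := (@lebesgue_measure R \x @lebesgue_measure R)%E.
Local Notation E2 := (plane_set (@unit_disc R)).
Implicit Types (F G f : C -> C) (z w x : C).

(** The transition from 0 to 1 takes place in the ring [1/m <= 1 - |x|^2 <= 2/m]. *)
Definition bcut (m : R) x : R := step (m * (1 - N x ^+ 2) - 1).
Definition bgrad (m : R) x : C :=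
  (dstep (m * (1 - N x ^+ 2) - 1))%:C%C * (- m%:C%C * x).

Lemma hasdbar_bcut m z : hasdbar (fun x => (bcut m x)%:C%C) (bgrad m) z.
Proof.
apply: hasdbar_step.
have h := hasdbarD (hasdbarM (hasdbar_cst (- m%:C%C) z)
  (hasdbarM (hasdbar_id z) (hasdbar_conj z))) (hasdbar_cst (m - 1)%:C%C z).
apply: hasdbar_eq h => x /=; last by ring.
rewrite mul_conj -real_complexN -real_complexM -real_complexD; congr _%:C%C; ring.
Qed.

Lemma bcut_inner m x : 2 <= m * (1 - N x ^+ 2) -> bcut m x = 1 /\ bgrad m x = 0.
Proof.
move=> h; have h1 : 1 <= m * (1 - N x ^+ 2) - 1 by lra.
by rewrite /bcut /bgrad step_ge1// dstep_out ?real_complex0 ?mul0r//; right.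
Qed.

Lemma bcut_outer m x : m * (1 - N x ^+ 2) <= 1 -> bcut m x = 0 /\ bgrad m x = 0.
Proof.
move=> h; have h1 : m * (1 - N x ^+ 2) - 1 <= 0 by lra.
by rewrite /bcut /bgrad step_le0// dstep_out ?real_complex0 ?mul0r//; left.
Qed.

Lemma bcut_out m x : 0 < m -> ~ unit_disc x ->
  near0 (fun w => bcut m (x + w) = 0 /\ bgrad m (x + w) = 0).
Proof.
rewrite /unit_disc /= => m0 /negP; rewrite -leNgt => x1.
exists (Num.min 1 (1 / (2 * m))); first by rewrite lt_min ltr01 divr_gt0// mulr_gt0.
move=> w; rewrite lt_min => /andP[w1 wm]; apply: bcut_outer.
have h1 : 1 - N w <= N (x + w).
  by have := normc_dist (x + w) x; rewrite addrAC subrr add0r ler_norml => /andP[]; lra.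
have h2 : (1 - N w) ^+ 2 <= N (x + w) ^+ 2.
  rewrite ler_pXn2r ?nnegrE ?normc_ge0//; lra.
have h3 : N w * (2 * m) < 1 by rewrite -ltr_pdivlMr// mulr_gt0.
have h4 : 1 - N (x + w) ^+ 2 <= 2 * N w by have := sqr_ge0 (N w); lra.
have : m * (1 - N (x + w) ^+ 2) <= m * (2 * N w) by rewrite ler_wpM2l// ltW.
lra.
Qed.

Lemma bcut_near m z : unit_disc z -> 4 <= m * (1 - N z) ->
  near0 (fun w => bcut m (z + w) = 1 /\ bgrad m (z + w) = 0).
Proof.
rewrite /unit_disc /= => z1 m4.
have m0 : 0 < m.
  by rewrite -(pmulr_lgt0 _ (x := 1 - N z)); [lra|rewrite subr_gt0].
exists ((1 - N z) / 2); first by rewrite divr_gt0// subr_gt0.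
move=> w wz; apply: bcut_inner; have h1 := normcD_le z w.
have h2 : N (z + w) ^+ 2 <= N (z + w).
  rewrite expr2 ler_piMl ?normc_ge0//; lra.
have : m * ((1 - N z) / 2) <= m * (1 - N (z + w) ^+ 2).
  by rewrite ler_wpM2l ?(ltW m0)//; lra.
lra.
Qed.

(** The gradient is at most [4 m], and [1 - |x|^2 < 2 / m] where it is not 0, so [m] cancels. With
    [y = 1 - |z|] the denominator of [ukern] is at least [y * (y / 2)] there. *)
Lemma bgrad_ukern m z x : unit_disc z -> 0 < m -> 4 <= m * (1 - N z) -> unit_disc x ->
  N (bgrad m x * ukern z x) <= 16 / (1 - N z) ^+ 2.
Proof.
move=> z1 m0 m4 x1; set y := 1 - N z.
have y0 : 0 < y by rewrite subr_gt0.
have [h|h] := leP 2 (m * (1 - N x ^+ 2)).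
  by have [_ ->] := bcut_inner h; rewrite mul0r normc0 divr_ge0// sqr_ge0.
have x0 := normc_ge0 x; have x1' : N x < 1 by [].
have h2 : N x ^+ 2 <= N x by rewrite expr2 ler_piMl// ltW.
have h3 : m * (1 - N x) < m * (y / 2).
  apply: (@lt_le_trans _ _ 2); last by rewrite /y; lra.
  by apply: le_lt_trans h; rewrite ler_wpM2l ?(ltW m0)//; lra.
have h4 : y / 2 <= N (x - z).
  rewrite ltr_pM2l// in h3; have := normc_dist x z; rewrite ler_norml => /andP[_].
  by rewrite /y in h3 *; lra.
have xz : x != z by rewrite -subr_eq0 -normc_gt0; lra.
have dz := normc_den_ge z x1; rewrite -/y in dz.
have g4 : N (bgrad m x) <= 4 * m.
  rewrite /bgrad normcM normcM normc_opp !normc_real (gtr0_norm m0) (ger0_norm (dstep_ge0 _)).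
  apply: ler_pM; rewrite ?dstep_ge0 ?dstep_le4 ?mulr_ge0 ?(ltW m0)//.
  by rewrite ler_piMr ?(ltW m0)// ltW.
have u4 : N (ukern z x) <= (2 / m) / (y * (y / 2)).
  rewrite normc_ukern//; apply: ler_pM.
  - by rewrite subr_ge0; lra.
  - by rewrite invr_ge0 mulr_ge0 ?normc_ge0.
  - by rewrite ler_pdivlMr// mulrC ltW.
  rewrite lef_pV2 ?posrE ?mulr_gt0 ?divr_gt0//; try lra.
  by apply: ler_pM => //; rewrite ?divr_ge0 ?(ltW y0).
apply: (@le_trans _ _ ((4 * m) * ((2 / m) / (y * (y / 2))))).
  by rewrite normcM; apply: ler_pM; rewrite ?normc_ge0.
rewrite le_eqVlt; apply/orP; left; apply/eqP; field.
by rewrite !gt_eqF.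
Qed.

Definition layer (n : nat) : set C :=
  [set x | unit_disc x /\ n%:R * (1 - N x ^+ 2) < 2].

Lemma layer_open n : copen (layer n).
Proof.
move=> x [x1 xn].
have [d d0 hd] := copen_disc x1.
(* The successor in the denominator covers the case [n = 0]. *)
pose k := (2 - n%:R * (1 - N x ^+ 2)) / (2 * n.+1%:R).
have n0 : 0 < n.+1%:R :> R by rewrite ltr0n.
have k0 : 0 < k by rewrite divr_gt0 ?mulr_gt0//; lra.
exists (Num.min d k); first by rewrite lt_min d0.
move=> w; rewrite lt_min => /andP[wd wk]; have xw1 := hd _ wd; split=> //.
have [h1 h2] : N x < 1 /\ N (x + w) < 1 by [].
have h3 := normc_ge0 x; have h4 := normc_ge0 (x + w); have h5 := normc_ge0 w.
have h6 : N x - N w <= N (x + w).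
  by have := normc_dist (x + w) x; rewrite addrAC subrr add0r ler_norml => /andP[]; lra.
have h7 : N x ^+ 2 - 2 * N w <= N (x + w) ^+ 2.
  have [?|?] := leP (N x) (N w); first by have := sqr_ge0 (N (x + w)); nra.
  have : (N x - N w) ^+ 2 <= N (x + w) ^+ 2 by rewrite ler_pXn2r ?nnegrE//; lra.
  have : N x * N w <= N w by rewrite ler_piMl// ltW.
  by have := sqr_ge0 (N w); lra.
have h8 : N w * (2 * n.+1%:R) < 2 - n%:R * (1 - N x ^+ 2).
  by rewrite -ltr_pdivlMr ?mulr_gt0.
have h9 : n%:R * (1 - N (x + w) ^+ 2) <= n%:R * (1 - N x ^+ 2 + 2 * N w).
  by rewrite ler_wpM2l//; lra.
by rewrite -natr1 in h8; lra.
Qed.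

(** The layers decrease to the empty set, so continuity of the measure from above replaces a
    computation of areas. *)
Lemma layer_cvg : mu2 (plane_set (layer n)) @[n --> \oo] --> 0%E.
Proof.
have -> : (0 : \bar R)%E = mu2 (\bigcap_n plane_set (layer n)).
  rewrite (_ : \bigcap_n _ = set0) ?measure0//.
  apply/seteqP; split=> // p h.
  have [p1 _] := h 0%N I.
  have p2 : 0 < 1 - N (pt p) ^+ 2.
    by rewrite subr_gt0 expr_lt1// ?normc_ge0.
  have [_] := h (Num.truncn (2 / (1 - N (pt p) ^+ 2))).+1 I.
  have := truncnS_gt (2 / (1 - N (pt p) ^+ 2)).
  by rewrite ltr_pdivrMr// /pt => ?; lra.
apply: nonincreasing_cvg_mu.
- apply: le_lt_trans disc_lty; apply: le_measure; rewrite ?inE.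
  + by apply: plane_measurable; exact: layer_open.
  + exact: disc_measurable.
  + by move=> p [].
- by move=> n; apply: plane_measurable; exact: layer_open.
- apply: bigcap_measurable => // n _; apply: plane_measurable; exact: layer_open.
- move=> n m nm; apply/subsetPset => p [p1 h]; split=> //; apply: le_lt_trans h.
  by rewrite ler_wpM2r ?ler_nat// subr_ge0 expr_le1 ?normc_ge0// ltW.
Qed.

Lemma bcut_ccont m z : ccont (fun x => (1 - bcut m x)%:C%C) z.
Proof.
have := ccontD (ccont_cst 1 z) (ccontN (hasdbar_ccont (hasdbar_bcut m z))).
by apply: lito1_near; apply: near0T => w; rewrite !(real_complexD 1 (- bcut _ _)) !(real_complexN (bcut _ _)).
Qed.

Lemma bcut_int (e : R) : 0 < e ->
  exists n0 : nat, forall n, (n0 <= n)%N -> ReI (fun x => (1 - bcut n%:R x)%:C%C) <= e.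
Proof.
move=> e0.
have /fine_cvgP[hfin] := layer_cvg.
move=> /cvgrPdist_le /(_ e e0)[n2 _ hn2].
have [n1 _ hn1] := hfin.
exists (maxn n1 n2) => n; rewrite geq_max => /andP[/hn1/= fin /hn2/=].
rewrite sub0r normrN => he; apply: le_trans he.
apply: le_trans (ler_norm _).
have -> : ReI (fun x => (1 - bcut n%:R x)%:C%C) =
    Rintegral mu2 (plane_set (layer n)) (fun p => 1 - bcut n%:R (pt p)).
  rewrite /ReI (_ : plane_set (layer n) = E2 `&` plane_set (layer n)); last first.
    by apply/seteqP; split=> [p [? ?]|p []].
  rewrite Rintegral_mkcondr; apply: eq_Rintegral => p /set_mem pE /=.
  rewrite patchE; case: ifPn => // /negP pL; have [|-> _] := @bcut_inner n%:R (pt p); last by rewrite subrr.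
  by rewrite leNgt; apply/negP => h; apply: pL; rewrite inE.
have iL : mu2.-integrable (plane_set (layer n)) (EFin \o (fun p => 1 - bcut n%:R (pt p))).
  apply: integrableS (@ReI_integrable _ (fun x => (1 - bcut n%:R x)%:C%C) (bcut_ccont n%:R)).
  - exact: disc_measurable.
  - by apply: plane_measurable; exact: layer_open.
  - by move=> p [].
have := @Rintegral_near_cst _ _ _ mu2 (plane_set (layer n)) (fun p => 1 - bcut n%:R (pt p)) 0 1
  (fine (mu2 (plane_set (layer n)))) (plane_measurable (@layer_open n)) (esym (fineK fin)) iL.
rewrite mul0r subr0 mul1r => h; apply: le_trans (ler_norm _) (h _) => p _.
rewrite subr0 ger0_norm; last by rewrite subr_ge0 step_le1.
by rewrite gerBl step_ge0.
Qed.

(** A single continuous majorant [V] of small integral controls the gradient term, its square and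
    the loss [1 - chi]: the square serves [estimate], the other two serve [disc_repr]. *)
Lemma bcut_exists z (e : R) : unit_disc z -> 0 < e -> exists chi V g,
  [/\ (forall x, hasdbar (fun x => (chi x)%:C%C) g x),
      (forall x, 0 <= chi x <= 1),
      (forall x, ~ unit_disc x -> near0 (fun w => chi (x + w) = 0 /\ g (x + w) = 0)),
      near0 (fun w => chi (z + w) = 1 /\ g (z + w) = 0) &
      [/\ (forall x, ccont (fun x => (V x)%:C%C) x), (forall x, 0 <= V x),
      (forall x, unit_disc x -> [/\ N (g x * ukern z x) <= V x,
          N (g x * ukern z x) ^+ 2 <= V x & 1 - chi x <= V x]) &
      ReI (fun x => (V x)%:C%C) <= e]].
Proof.
move=> z1 e0; have y0 : 0 < 1 - N z by rewrite subr_gt0.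
pose K : R := 1 + 16 / (1 - N z) ^+ 2.
have K0 : 0 <= 16 / (1 - N z) ^+ 2 by rewrite divr_ge0// sqr_ge0.
have K1 : 1 <= K by rewrite lerDl.
have KK : K <= K ^+ 2 by rewrite expr2 ler_peMl; lra.
have K2 : 0 < K ^+ 2 by lra.
have [n0 hn0] := bcut_int (divr_gt0 e0 K2).
pose n := maxn n0 (Num.truncn (2 / (1 - N z))).+1.
have nn0 : (n0 <= n)%N by exact: leq_maxl.
have n2 : 2 <= n%:R * (1 - N z).
  rewrite -ler_pdivrMr// ltW//; apply: lt_le_trans (truncnS_gt _) _.
  by rewrite ler_nat leq_maxr.
have npos : 0 < n%:R :> R by rewrite ltr0n; apply: leq_trans (leq_maxr _ _).
(* Doubling puts every point with [m * (1 - |x|^2) < 2] in the region where [bcut n] is 0, so that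
   [V] takes its full value [K ^+ 2] wherever [bcut m] is not 1. *)
pose m : R := 2 * n%:R.
have m0 : 0 < m by rewrite mulr_gt0.
have m4 : 4 <= m * (1 - N z) by rewrite /m; lra.
have V0 x : 0 <= K ^+ 2 * (1 - bcut n%:R x).
  by rewrite mulr_ge0 ?(ltW K2)// subr_ge0 step_le1.
exists (bcut m), (fun x => K ^+ 2 * (1 - bcut n%:R x)), (bgrad m); split.
- exact: hasdbar_bcut.
- by move=> x; rewrite step_ge0 step_le1.
- by move=> x; exact: bcut_out.
- exact: bcut_near.
split => //.
- move=> x; have := ccontM (ccont_cst (K ^+ 2)%:C%C x) (bcut_ccont n%:R x).
  by apply: lito1_near; apply: near0T => w; rewrite !real_complexM.
- move=> x x1; have [h|h] := leP 2 (m * (1 - N x ^+ 2)).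
    have [-> ->] := bcut_inner h; by rewrite mul0r normc0 expr0n subrr.
  have -> : bcut n%:R x = 0.
    by have [] := @bcut_outer n%:R x _ => //; rewrite /m in h; lra.
  have b := bgrad_ukern z1 m0 m4 x1.
  have bK : N (bgrad m x * ukern z x) <= K by rewrite /K; lra.
  rewrite subr0 mulr1; split; [lra| |].
    by rewrite ler_pXn2r ?nnegrE ?normc_ge0//; lra.
  by have := @step_ge0 _ (m * (1 - N x ^+ 2) - 1); rewrite -/(bcut m x); lra.
- rewrite (_ : (fun x => _) = fun x => (K ^+ 2)%:C%C * (1 - bcut n%:R x)%:C%C); last first.
    by apply/funext => x; rewrite real_complexM.
  rewrite ReIZ; last exact: bcut_ccont.
  by rewrite mulrC -ler_pdivlMr//; exact: hn0.
Qed.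

End Boundary.

(** * The kernel of the disc and the main estimate *)

Lemma Rintegral_subset d (T : measurableType d) (R : realType)
    (m : {measure set T -> \bar R}) (A B : set T) (f : T -> R) :
  measurable A -> measurable B -> A `<=` B -> m.-integrable B (EFin \o f) ->
  (forall x, B x -> 0 <= f x) -> Rintegral m A f <= Rintegral m B f.
Proof.
move=> mA mB AB intf f0.
apply: fine_le.
- by apply: integrable_fin_num => //; exact: integrableS intf.
- exact: integrable_fin_num.
- by apply: ge0_subset_integral => //; exact: measurable_int intf.
Qed.

Lemma Rintegral_dist d (T : measurableType d) (R : realType)
    (m : {measure set T -> \bar R}) (A : set T) (f g h : T -> R) :
  measurable A -> m.-integrable A (EFin \o f) -> m.-integrable A (EFin \o g) ->
  m.-integrable A (EFin \o h) -> (forall x, A x -> `|f x - g x| <= h x) ->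
  `|Rintegral m A f - Rintegral m A g| <= Rintegral m A h.
Proof.
move=> mA intf intg inth fg; rewrite -RintegralB//.
have ifg : m.-integrable A (EFin \o (fun x => f x - g x)).
  rewrite (_ : _ \o _ = (EFin \o f) \- (EFin \o g))%E; first exact: integrableB.
  by apply/funext => x /=; rewrite EFinB.
apply: le_trans (le_normr_Rintegral _ ifg) _ => //.
exact: (le_Rintegral mA (integrable_norm ifg) inth fg).
Qed.

(** Recovers Cauchy-Schwarz from Young's inequality with a free weight, which can be integrated
    pointwise; the weight [l = a / F] does it. *)
Lemma amgm_sq (R : realType) (a F S : R) : 0 <= a -> 0 < F -> 0 <= S ->
  (forall l, 0 < l -> a <= (l * F + l^-1 * S) / 2) -> a ^+ 2 <= F * S.
Proof.
move=> a0 F0 S0 h; have [->|an0] := eqVneq a 0.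
  by rewrite expr0n mulr_ge0// ltW.
have a1 : 0 < a by rewrite lt_def an0.
have := h (a / F) (divr_gt0 a1 F0).
rewrite divfK ?gt_eqF// invf_div => h1.
have h2 : a <= F / a * S by lra.
have : a * a <= a * (F / a * S) by rewrite ler_wpM2l.
rewrite (_ : a * (F / a * S) = F * S); last by field.
by rewrite expr2.
Qed.

(** To be read with [y = |f|], [b = |kern|] and [a] the cutoff error: the main term loses only a
    factor [1 + t], and the small error pays [1 + t^-1]. *)
Lemma weighted_young (R : realType) (l t y a b w : R) : 0 < l -> 0 < t -> a ^+ 2 <= w ->
  y * (a + b) <= l / 2 * y ^+ 2 + l^-1 / 2 * ((1 + t) * b ^+ 2 + (1 + t^-1) * w).
Proof.
move=> l0 t0 aw; have l1 : 0 < l^-1 by rewrite invr_gt0.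
have t1 : 0 < t^-1 by rewrite invr_gt0.
have s2 : y * (a + b) <= l / 2 * y ^+ 2 + l^-1 / 2 * (a + b) ^+ 2.
  have : 0 <= l^-1 * (l * y - (a + b)) ^+ 2 by rewrite mulr_ge0 ?sqr_ge0 ?(ltW l1).
  rewrite (_ : l^-1 * _ = l * y ^+ 2 - 2 * (y * (a + b)) + l^-1 * (a + b) ^+ 2); last first.
    by field; rewrite gt_eqF.
  lra.
apply: (le_trans s2); rewrite lerD2l ler_wpM2l ?divr_ge0 ?(ltW l1)//.
have : 0 <= t^-1 * (t * b - a) ^+ 2 by rewrite mulr_ge0 ?sqr_ge0 ?(ltW t1).
rewrite (_ : t^-1 * _ = t * b ^+ 2 - 2 * (a * b) + t^-1 * a ^+ 2); last first.
  by field; rewrite gt_eqF.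
have : (1 + t^-1) * a ^+ 2 <= (1 + t^-1) * w by rewrite ler_wpM2l//; lra.
lra.
Qed.

Section Estimate.
Context {R : realType}.
Local Notation C := R[i].
Local Notation N := (@Normc.normc R).
Local Notation mu2 := (@lebesgue_measure R \x @lebesgue_measure R)%E.
Local Notation R2 := (measurableTypeR R * measurableTypeR R)%type.
Local Notation E2 := (plane_set (@unit_disc R)).
Implicit Types (f : C -> C) (z x : C).

Lemma normcX x n : N (x ^+ n) = N x ^+ n.
Proof. by elim: n => [|n IH]; rewrite ?expr0 ?normc1// !exprS normcM IH. Qed.

Lemma normc_kern z x : N (kern z x) = (N (den z x) ^+ 2)^-1.
Proof. by rewrite -normc_conj conj_kern normcV normcX. Qed.

Lemma normc_kern_le z x : unit_disc z -> unit_disc x -> N (kern z x) <= ((1 - N z) ^+ 2)^-1.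
Proof.
move=> z1 x1; have y0 : 0 < 1 - N z by rewrite subr_gt0.
have h := normc_den_ge z x1.
rewrite normc_kern lef_pV2 ?posrE ?exprn_gt0//; last exact: lt_le_trans h.
by rewrite ler_pXn2r ?nnegrE ?normc_ge0// ltW.
Qed.

Lemma wirt_kern z x : unit_disc z -> unit_disc x -> exists A, wirt (kern z) x A 0.
Proof.
move=> z1 x1.
have h := wirtD (wirt_cst 1 x) (wirtM (wirt_id x) (wirt_cst (- z^*%C) x)).
have h2 := wirtM h h.
have d0 : 1 + x * - z^*%C != 0.
  have := den_neq0 z1 x1; rewrite -(conjc_eq0 (den z x)) /den.
  by rewrite conjD conjN conjM conjcK conjc1 mulrN.
have h3 := wirtV h2 (mulf_neq0 d0 d0).
set A := (- _ / _) in h3; exists A.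
move: h3; rewrite (_ : - _ / _ = 0); last by rewrite !(mul0r, mulr0, addr0) oppr0 mul0r.
by apply: litow_near; apply: near0T => w; rewrite /kern !expr2 !mulrN.
Qed.

Lemma kern0 x : kern 0 x = 1.
Proof. by rewrite /kern conjc0 mulr0 subr0 expr1n invr1. Qed.

Lemma kern_at0 z : kern z 0 = 1.
Proof. by rewrite /kern mul0r subr0 expr1n invr1. Qed.

Definition kdiag z : R := ((1 - N z ^+ 2) ^+ 2)^-1.

Lemma kern_diag z : kern z z = (kdiag z)%:C%C.
Proof.
have E : (1 - N z ^+ 2)%:C%C = 1 - (N z ^+ 2)%:C%C by rewrite real_complexD real_complexN.
by rewrite /kern mul_conj -E /kdiag fmorphV rmorphXn.
Qed.

Lemma disc0 : @unit_disc R 0.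
Proof. by change (N 0 < 1); rewrite normc0. Qed.

Lemma ccont_cont2 (h : C -> R) p : ccont (fun x => (h x)%:C%C) (pt p) ->
  cont2 (fun p => h (pt p)) p.
Proof. by move=> /cont2_Re. Qed.

(** For bounded f the boundary cutoff can be removed: the gradient term and the loss [1 - chi] cost
    at most [M V] and [M K V], and [V] has arbitrarily small integral. *)
Lemma disc_repr f (M : R) z : (forall x, unit_disc x -> exists A, wirt f x A 0) ->
  (forall x, unit_disc x -> N (f x) <= M) -> unit_disc z ->
  mass z * complex.Re (f z) =
    Rintegral mu2 E2 (fun p => complex.Re (f (pt p) * (kern z (pt p))^*%C)).
Proof.
move=> hol fM z1.
have M0 : 0 <= M := le_trans (normc_ge0 _) (fM _ z1).
pose K : R := ((1 - N z) ^+ 2)^-1.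
have K0 : 0 <= K by rewrite invr_ge0 sqr_ge0.
have cfk x : unit_disc x -> ccont (fun x => f x * (kern z x)^*%C) x.
  move=> x1; have [A hA] := hol _ x1.
  by apply: ccontM; [exact: wirt_ccont hA|exact: ccont_kern].
have bk x : unit_disc x -> N (f x * (kern z x)^*%C) <= M * K.
  move=> x1; rewrite normcM normc_conj; apply: ler_pM; rewrite ?normc_ge0//; first exact: fM.
  exact: normc_kern_le.
have ik : mu2.-integrable E2 (EFin \o (fun p => complex.Re (f (pt p) * (kern z (pt p))^*%C))).
  apply: (@disc_integrable _ _ _ (M * K)); [exact: copen_disc|by []| |].
    by move=> p p1; apply: (@cont2_Re _ (fun x => f x * (kern z x)^*%C)); exact: cfk.
  by move=> p p1; apply: le_trans (normr_Re_le _) (bk _ p1).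
apply/eqP; rewrite -subr_eq0 -normr_eq0 eq_le normr_ge0 andbT.
apply/ler_addgt0Pr => e e0; rewrite add0r.
have L0 : 0 < M * (1 + K) + 1 by rewrite ltr_wpDl// mulr_ge0//; lra.
have [chi [V [g [h1 h2 h3 h4 [cV V0 hV iV]]]]] := bcut_exists z1 (divr_gt0 e0 L0).
have E := reproducing (fun x => id) hol h1 h3 z1 h4.
have c1 := repr_ccont1 (fun x => id) hol h1 h3 z1 h4.
have c2 := repr_ccont2 (fun x => id) hol h1 h3 z1.
have c12 x := ccontD (c1 x) (c2 x).
rewrite E -ReID//.
have cLV x : ccont (fun x => (M * (1 + K))%:C%C * (V x)%:C%C) x.
  by apply: ccontM => //; exact: ccont_cst.
have iLV := ReI_integrable cLV.
apply: (@le_trans _ _ (ReI (fun x => (M * (1 + K))%:C%C * (V x)%:C%C))); last first.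
  rewrite ReIZ//; apply: (@le_trans _ _ ((M * (1 + K)) * (e / (M * (1 + K) + 1)))).
    by rewrite ler_wpM2l// mulr_ge0//; lra.
  by rewrite mulrCA ler_piMr ?(ltW e0)// ler_pdivrMr//; lra.
apply: (Rintegral_dist (disc_measurable (R := R)) (ReI_integrable c12) ik iLV).
move=> p p1; rewrite -ReN -ReD; set x := pt p.
have x1 : unit_disc x by [].
have [v1 _ v3] := hV x x1.
rewrite ReRM /=; apply: le_trans (normr_Re_le _) _.
rewrite -addrA; apply: le_trans (normcD_le _ _) _.
rewrite (_ : M * (1 + K) * V x = M * V x + M * K * V x); last by ring.
apply: lerD.
  by rewrite -mulrA normcM; apply: ler_pM; rewrite ?normc_ge0//; exact: fM.
rewrite -[X in _ - X]mul1r -mulrBl normcM mulrC; apply: ler_pM; rewrite ?normc_ge0//; first exact: bk.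
rewrite normc_distC -[1]/(1%:C%C) -real_complexN -real_complexD normc_real ger0_norm//.
by have /andP[_ ?] := h2 x; rewrite subr_ge0.
Qed.

(** Reproducing the constant 1 at z and reproducing [kern z] at 0, where it equals 1, leads to the
    same integral, that of [Re (kern z)]. *)
Lemma mass_cst z : unit_disc z -> mass z = mass 0.
Proof.
move=> z1.
have w1 (x : C) : unit_disc x -> exists A, wirt (fun=> 1) x A 0.
  by exists 0; exact: wirt_cst.
have b1 (x : C) : unit_disc x -> N 1 <= 1 by rewrite normc1.
have E1 := disc_repr w1 b1 z1.
have E0 := disc_repr (fun x (x1 : unit_disc x) => wirt_kern z1 x1)
  (fun x (x1 : unit_disc x) => normc_kern_le z1 x1) disc0.
rewrite kern_at0 mulr1 in E0; rewrite mulr1 in E1.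
rewrite E1 E0; apply: eq_Rintegral => p _.
by rewrite mul1r Re_conjc kern0 conjc1 mulr1.
Qed.

Lemma kern_norm z : unit_disc z ->
  Rintegral mu2 E2 (fun p => N (kern z (pt p)) ^+ 2) = mass 0 * kdiag z.
Proof.
move=> z1; rewrite -(mass_cst z1).
have := disc_repr (fun x (x1 : unit_disc x) => wirt_kern z1 x1)
  (fun x (x1 : unit_disc x) => normc_kern_le z1 x1) z1.
rewrite kern_diag /= => ->; apply: eq_Rintegral => p _.
by rewrite mul_conj.
Qed.

Lemma kern_integrable z : unit_disc z ->
  mu2.-integrable E2 (EFin \o (fun p => N (kern z (pt p)) ^+ 2)).
Proof.
move=> z1; apply: (@disc_integrable _ _ _ ((((1 - N z) ^+ 2)^-1) ^+ 2)); [exact: copen_disc|by []| |].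
  move=> p p1; apply: (@ccont_cont2 (fun x => N (kern z x) ^+ 2)).
  have [A hA] := wirt_kern z1 p1; have c1 := wirt_ccont hA.
  apply: lito1_near (ccontM c1 (ccont_kern z1 p1)).
  by apply: near0T => w; rewrite !mul_conj.
move=> p p1; have K0 : 0 <= ((1 - N z) ^+ 2)^-1 by rewrite invr_ge0 sqr_ge0.
rewrite ger0_norm ?sqr_ge0// ler_pXn2r ?nnegrE ?normc_ge0 ?K0//.
exact: normc_kern_le.
Qed.

Lemma mu2_square (A : set C) z : copen A -> A z -> A `<=` @unit_disc R ->
  exists2 e : R, 0 < e & e <= fine (mu2 (plane_set A)).
Proof.
move=> oA Az AE; have [d d0 hd] := near0_box (oA z Az).
exists ((d / 2) * (d / 2)); first by rewrite mulr_gt0// divr_gt0.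
have mA := plane_measurable oA.
have fA : mu2 (plane_set A) \is a fin_num.
  rewrite ge0_fin_numE; last exact: measure_ge0.
  apply: le_lt_trans disc_lty; apply: le_measure; rewrite ?inE//; first exact: disc_measurable.
  by move=> p /AE.
rewrite -lee_fin fineK//.
have d2 : 0 < d / 2 by rewrite divr_gt0.
pose Q : set R2 := `](complex.Re z), (complex.Re z + d / 2)]%classic `*`
  `](complex.Im z), (complex.Im z + d / 2)]%classic.
apply: (@le_trans _ _ (mu2 Q)).
  rewrite le_eqVlt; apply/orP; left; apply/eqP.
  transitivity (((complex.Re z + d / 2 - complex.Re z) * (complex.Im z + d / 2 - complex.Im z))%:E).
    by congr EFin; ring.
  by apply/esym; apply: mu2_box; lra.
apply: le_measure; rewrite ?inE//.
  by apply: measurableX; exact: measurable_itv.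
move=> p [] /=; rewrite !in_itv/= => /andP[? ?] /andP[? ?].
by apply: hd; rewrite ger0_norm; lra.
Qed.

(** By [kern_norm] at 0, where the kernel is the constant 1, this mass is the area of the disc. *)
Lemma mass_gt0 : 0 < mass (0 : C).
Proof.
have := kern_norm disc0; rewrite /kdiag normc0 expr0n subr0 expr1n invr1 mulr1 => <-.
have [e e0 he] := mu2_square copen_disc disc0 (fun x => id).
apply: (lt_le_trans e0); apply: (le_trans he); rewrite le_eqVlt; apply/orP; left; apply/eqP.
transitivity (Rintegral mu2 E2 (cst 1)).
  by rewrite Rintegral_cst ?mul1r//; exact: disc_measurable.
by apply: eq_Rintegral => p _; rewrite kern0 normc1 expr1n.
Qed.

(** The reproducing formula followed by [weighted_young] under the integral and [amgm_sq] at the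
    end; [mass 0 * kdiag z] is the squared norm of [kern z] on the whole disc. *)
Lemma estimate (O : set C) f g (chi W : C -> R) z (delta theta : R) :
  copen O -> O `<=` @unit_disc R -> (forall x, O x -> exists A, wirt f x A 0) ->
  (forall x, hasdbar (fun x => (chi x)%:C%C) g x) -> (forall x, 0 <= chi x <= 1) ->
  (forall x, ~ O x -> near0 (fun w => chi (x + w) = 0 /\ g (x + w) = 0)) ->
  O z -> near0 (fun w => chi (z + w) = 1 /\ g (z + w) = 0) ->
  (forall x, ccont (fun x => (W x)%:C%C) x) -> (forall x, 0 <= W x) ->
  (forall x, O x -> N (g x * ukern z x) ^+ 2 <= W x) ->
  ReI (fun x => (W x)%:C%C) <= delta ->
  mu2.-integrable (plane_set O) (EFin \o (fun p => N (f (pt p)) ^+ 2)) ->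
  0 < theta -> 0 < Rintegral mu2 (plane_set O) (fun p => N (f (pt p)) ^+ 2) ->
  N (f z) ^+ 2 * mass 0 ^+ 2 <= Rintegral mu2 (plane_set O) (fun p => N (f (pt p)) ^+ 2) *
    ((1 + theta) * (mass 0 * kdiag z) + (1 + theta^-1) * delta).
Proof.
move=> oO OE hol hchi chi01 chi0 Oz chi1 cW W0 gW iW intf th0.
set F := Rintegral _ _ _ => F0; set S := _ + _.
have z1 := OE _ Oz; have m0 := mass_gt0.
have th1 : 0 < theta^-1 by rewrite invr_gt0.
have delta0 : 0 <= delta.
  by apply: le_trans iW; apply: Rintegral_ge0 => p _; exact: W0.
have S0 : 0 <= S.
  apply: addr_ge0; apply: mulr_ge0 => //; [lra| |lra].
  by rewrite mulr_ge0 ?(ltW m0)// invr_ge0 sqr_ge0.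
rewrite -exprMn; apply: amgm_sq => //; first by rewrite mulr_ge0 ?normc_ge0 ?ltW.
move=> l l0; have l1 : 0 < l^-1 by rewrite invr_gt0.
(* The unimodular factor that turns [f z] into [|f z|], so that the real parts in [reproducing] lose
   nothing. *)
pose al : C := if f z == 0 then 1 else (f z)^*%C / (N (f z))%:C%C.
have Nal : N al = 1.
  rewrite /al; case: ifPn => [_|fz]; first exact: normc1.
  have fz0 : 0 < N (f z) by rewrite normc_gt0.
  by rewrite normcM normc_conj normcV normc_real gtr0_norm// divff// gt_eqF.
have alf : al * f z = (N (f z))%:C%C.
  rewrite /al; case: ifPn => [/eqP->|fz]; first by rewrite mulr0 normc0.
  have fz0 : (N (f z))%:C%C != 0 :> C.
    by rewrite -normc_eq0 normc_real normr_eq0 normc_eq0.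
  by rewrite mulrAC (mulrC _ (f z)) mul_conj expr2 real_complexM mulfK.
pose h x := al * f x.
have holh x : O x -> exists A, wirt h x A 0.
  move=> /hol[A hA]; exists (0 * f x + al * A).
  by have := wirtM (wirt_cst al x) hA; rewrite mul0r mulr0 addr0.
have Nh x : N (h x) = N (f x) by rewrite /h normcM Nal mul1r.
have E := reproducing OE holh hchi chi0 Oz chi1.
have c1 := repr_ccont1 OE holh hchi chi0 Oz chi1.
have c2 := repr_ccont2 OE holh hchi chi0 Oz.
have c12 x := ccontD (c1 x) (c2 x).
have mO := plane_measurable oO.
rewrite {1}/h alf /= mass_cst// mulrC -ReID// in E; rewrite E.
set T := (fun x => _).
(* The cutoff and its gradient vanish off [O], so only the part of the disc where f is square
   integrable contributes. *)
have TO : ReI T = Rintegral mu2 (plane_set O) (fun p => complex.Re (T (pt p))).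
  rewrite /ReI [in RHS](_ : plane_set O = E2 `&` plane_set O); last first.
    by apply/seteqP; split=> [p pO|p []//]; split=> //; exact: OE.
  rewrite Rintegral_mkcondr; apply: eq_Rintegral => p _.
  rewrite patchE; case: ifPn => // /negP pO.
  have [|e e0 /(_ 0)] := chi0 (pt p); first by move=> ?; apply: pO; rewrite inE.
  by rewrite normc0 addr0 => /(_ e0)[c0 g0]; rewrite /T c0 g0 mulr0 !mul0r addr0.
pose om p := (l^-1 / 2) * ((1 + theta) * N (kern z (pt p)) ^+ 2 + (1 + theta^-1) * W (pt p)).
have iZ (A : set R2) (t : R) (q : R * R -> R) : measurable A -> mu2.-integrable A (EFin \o q) ->
    mu2.-integrable A (EFin \o (fun p => t * q p)).
  move=> mA iq; rewrite (_ : _ \o _ = (fun p => t%:E * (EFin \o q) p)%E); first exact: integrableZl.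
  by apply/funext => p /=; rewrite EFinM.
have iD (A : set R2) (q r : R * R -> R) : measurable A -> mu2.-integrable A (EFin \o q) ->
    mu2.-integrable A (EFin \o r) -> mu2.-integrable A (EFin \o (fun p => q p + r p)).
  move=> mA iq ir; rewrite (_ : _ \o _ = (EFin \o q) \+ (EFin \o r))%E; first exact: integrableD.
  by apply/funext => p /=; rewrite EFinD.
have mE := @disc_measurable R.
have i1 := kern_integrable z1.
have i2 : mu2.-integrable E2 (EFin \o (fun p => W (pt p))) := ReI_integrable cW.
have i1' := iZ _ (1 + theta) _ mE i1.
have i2' := iZ _ (1 + theta^-1) _ mE i2.
have i12 := iD _ _ _ mE i1' i2'.
have iom : mu2.-integrable E2 (EFin \o om) := iZ _ (l^-1 / 2) _ mE i12.
have om0 p : E2 p -> 0 <= om p.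
  move=> _; rewrite /om mulr_ge0//; first by rewrite divr_ge0 ?(ltW l1).
  by apply: addr_ge0; apply: mulr_ge0; rewrite ?sqr_ge0//; lra.
have OE2 : plane_set O `<=` E2 by move=> p /OE.
have iomO : mu2.-integrable (plane_set O) (EFin \o om) by exact: integrableS iom.
have Iom : Rintegral mu2 E2 om <= l^-1 * S / 2.
  rewrite [X in X <= _]RintegralZl// RintegralD// !RintegralZl// kern_norm//.
  rewrite (mulrAC _ S) ler_wpM2l ?divr_ge0 ?(ltW l1)// /S lerD2l ler_wpM2l//; lra.
have if' := iZ _ (l / 2) _ mO intf.
have iT : mu2.-integrable (plane_set O) (EFin \o (fun p => complex.Re (T (pt p)))).
  by apply: integrableS (ReI_integrable c12).
rewrite TO.
apply: (@le_trans _ _ (Rintegral mu2 (plane_set O) (fun p => (l / 2) * N (f (pt p)) ^+ 2 + om p))).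
  apply: le_Rintegral => //; first exact: iD.
  move=> p pO; set x := pt p; have Ox : O x by [].
  apply: le_trans (ler_norm _) _; apply: le_trans (normr_Re_le _) _.
  rewrite /T; apply: le_trans (normcD_le _ _) _.
  rewrite -mulrA !normcM -normcM Nh normc_real normc_conj.
  have /andP[k0 k1] := chi01 x; rewrite (ger0_norm k0).
  have := gW _ Ox; set a := N (g x * _); set b := N (kern z x); set y := N (f x).
  have a0 : 0 <= a := normc_ge0 _; have b0 : 0 <= b := normc_ge0 _; have y0 : 0 <= y := normc_ge0 _.
  move=> aW; rewrite /om -/x -/b.
  rewrite -normcM -/a.
  have s1 : chi x * (y * b) <= y * b by rewrite ler_piMl// mulr_ge0.
  by apply: le_trans (weighted_young y b l0 th0 aW); rewrite mulrDr lerD2l.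
rewrite RintegralD// RintegralZl// -/F.
have : Rintegral mu2 (plane_set O) om <= Rintegral mu2 E2 om by exact: Rintegral_subset.
lra.
Qed.

End Estimate.

(** * Cutoffs at the holes *)

Section LogCutoff.
Context {R : realType}.
Local Notation C := R[i].
Local Notation N := (@Normc.normc R).
Local Notation mu2 := (@lebesgue_measure R \x @lebesgue_measure R)%E.
Local Notation R2 := (measurableTypeR R * measurableTypeR R)%type.
Local Notation E2 := (plane_set (@unit_disc R)).
Implicit Types (z x a : C).

Definition rcont (h : C -> R) := forall x, ccont (fun x => (h x)%:C%C) x.

Definition RI (h : C -> R) : R := ReI (fun x => (h x)%:C%C).

Lemma RI0 : RI (fun=> 0) = 0.
Proof.
rewrite /RI /ReI (_ : (fun _ => _) = cst 0) ?Rintegral_cst ?mul0r//.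
exact: disc_measurable.
Qed.

Lemma rcontD (h k : C -> R) : rcont h -> rcont k -> rcont (fun x => h x + k x).
Proof.
move=> ch ck x; apply: lito1_near (ccontD (ch x) (ck x)).
by apply: near0T => w; rewrite !(real_complexD (h _)).
Qed.

Lemma rcontZ (t : R) (h : C -> R) : rcont h -> rcont (fun x => t * h x).
Proof.
move=> ch x; apply: lito1_near (ccontM (ccont_cst t%:C%C x) (ch x)).
by apply: near0T => w; rewrite !(real_complexM t).
Qed.

Lemma RID (h k : C -> R) : rcont h -> rcont k -> RI (fun x => h x + k x) = RI h + RI k.
Proof.
by move=> ch ck; rewrite /RI -ReID.
Qed.

Lemma RIZ (t : R) (h : C -> R) : rcont h -> RI (fun x => t * h x) = t * RI h.
Proof.
move=> ch; rewrite /RI -ReIZ; last exact: ch.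
by congr ReI; apply/funext => x; rewrite (real_complexM t).
Qed.

Lemma rcont_sq (g : C -> C) : (forall x, ccont g x) -> rcont (fun x => N (g x) ^+ 2).
Proof.
move=> cg x; have cgJ : ccont (fun x => (g x)^*%C) x.
  by apply: lito1_le (cg x) => w; rewrite -conjN -conjD normc_conj.
by apply: lito1_near (ccontM (cg x) cgJ); apply: near0T => w; rewrite !mul_conj.
Qed.

Lemma RI_bump (h : C -> R) a (K r : R) : rcont h -> 0 < r ->
  (forall x, 0 <= h x <= K) -> (forall x, r <= N (x - a) -> h x = 0) ->
  RI h <= K * (4 * r ^+ 2).
Proof.
move=> ch r0 hK h0.
have K0 : 0 <= K by have /andP[] := hK a; exact: le_trans.
pose Q : set R2 := `](complex.Re a - r), (complex.Re a + r)]%classic `*`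
  `](complex.Im a - r), (complex.Im a + r)]%classic.
have mQ : measurable Q by apply: measurableX; exact: measurable_itv.
have muQ : mu2 Q = (4 * r ^+ 2)%:E.
  transitivity (((complex.Re a + r - (complex.Re a - r)) *
      (complex.Im a + r - (complex.Im a - r)))%:E).
    by apply: mu2_box; lra.
  by congr EFin; ring.
have mE := @disc_measurable R.
have mEQ : measurable (E2 `&` Q : set R2) by exact: measurableI.
have lEQ : (mu2 (E2 `&` Q) <= mu2 Q)%E.
  by apply: le_measure; rewrite ?inE//; apply: subIsetr.
have fin : mu2 (E2 `&` Q) \is a fin_num.
  rewrite ge0_fin_numE; last exact: measure_ge0.
  by apply: le_lt_trans lEQ _; rewrite muQ ltry.
have iEQ : mu2.-integrable (E2 `&` Q) (EFin \o (fun p => h (pt p))).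
  by apply: integrableS (ReI_integrable ch) => //; apply: subIsetl.
have -> : RI h = Rintegral mu2 (E2 `&` Q) (fun p => h (pt p)).
  rewrite Rintegral_mkcondr; apply: eq_Rintegral => p _ /=.
  rewrite patchE; case: ifPn => // /negP pQ; apply: h0; rewrite leNgt; apply/negP => pr.
  apply: pQ; rewrite inE; have hr := normr_Re_le (pt p - a); have hi := normr_Im_le (pt p - a).
  have ImB (x y : C) : complex.Im (x - y) = complex.Im x - complex.Im y.
    by case: x => ? ?; case: y.
  rewrite ReD ReN in hr; rewrite ImB in hi.
  have := le_lt_trans hi pr; have := le_lt_trans hr pr.
  rewrite !ltr_norml /= => /andP[? ?] /andP[? ?].
  by split; rewrite /= in_itv/=; apply/andP; split; lra.
have := @Rintegral_near_cst _ _ _ mu2 (E2 `&` Q) (fun p => h (pt p)) 0 K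
  (fine (mu2 (E2 `&` Q))) mEQ (esym (fineK fin)) iEQ.
rewrite mul0r subr0 => H; apply: le_trans (ler_norm _) _.
apply: (le_trans (H _)).
  by move=> p _; rewrite subr0; have /andP[h1 h2] := hK (pt p); rewrite ger0_norm.
by rewrite ler_wpM2l// -lee_fin fineK// -muQ.
Qed.

(** Each dyadic ring adds 1 to the cutoff. The Dirichlet energy is scale invariant in the plane, so
    each ring costs the same, at most [(32 / t) * (8 * t) = 256]. *)
Lemma dyadic_cutoff a (rho : R) (m : nat) : 0 < rho -> exists (chi : C -> R) (g : C -> C),
  [/\ forall x, hasdbar (fun x => (chi x)%:C%C) g x,
      forall x, 0 <= chi x <= m%:R,
      forall x, N (x - a) ^+ 2 <= rho ^+ 2 / 2 ^+ m -> chi x = 0 /\ g x = 0,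
      forall x, rho ^+ 2 <= N (x - a) ^+ 2 -> chi x = m%:R /\ g x = 0 &
      RI (fun x => N (g x) ^+ 2) <= m%:R * 256].
Proof.
move=> rho0; have rho2 : 0 < rho ^+ 2 by rewrite exprn_gt0.
elim: m => [|m [chi [g [h1 h2 h3 h4 h5]]]].
  exists (fun=> 0), (fun=> 0); split => //.
  - by move=> x; exact: hasdbar_cst.
  - by rewrite lexx.
  - have E : (fun _ : C => N (0 : C) ^+ 2) = (fun=> 0).
      by apply/funext => x; rewrite normc0 expr0n.
    by rewrite E RI0 mul0r.
pose t : R := rho ^+ 2 / 2 ^+ m.+1.
have t0 : 0 < t by rewrite divr_gt0// exprn_gt0.
have t2 : 2 * t = rho ^+ 2 / 2 ^+ m.
  by rewrite /t (exprS 2 m); field; rewrite expf_neq0.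
pose ph x := N (x - a) ^+ 2 / t - 1.
pose g' x := (dstep (ph x))%:C%C * ((t^-1)%:C%C * (x - a)).
have hd x : hasdbar (fun x => (step (ph x))%:C%C) g' x := hasdbar_step (hasdbar_sqdist a t x).
have in0 x : N (x - a) ^+ 2 <= t -> step (ph x) = 0 /\ g' x = 0.
  move=> xt; have p0 : ph x <= 0 by rewrite /ph subr_le0 ler_pdivrMr// mul1r.
  by rewrite /g' step_le0// dstep_out ?real_complex0 ?mul0r//; left.
have out1 x : 2 * t <= N (x - a) ^+ 2 -> step (ph x) = 1 /\ g' x = 0.
  move=> xt; have p1 : 1 <= ph x by rewrite /ph lerBrDr ler_pdivlMr//; lra.
  by rewrite /g' step_ge1// dstep_out ?real_complex0 ?mul0r//; right.
have cg x : ccont g x by case: (h1 x).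
have cg' x : ccont g' x by case: (hd x).
exists (fun x => chi x + step (ph x)), (fun x => g x + g' x); split.
- move=> x; apply: hasdbar_eq (hasdbarD (h1 x) (hd x)) => // y.
  by rewrite (real_complexD (chi y)).
- move=> x; have /andP[? ?] := h2 x; rewrite -natr1.
  by rewrite addr_ge0 ?step_ge0//= lerD ?step_le1.
- move=> x xt; have [-> ->] := in0 x xt.
  have [|-> ->] := h3 x; last by rewrite !addr0.
  by rewrite -t2; rewrite -/t in xt; lra.
- move=> x xr; have [-> ->] := h4 x xr; have [|-> ->] := out1 x.
    apply: le_trans xr; rewrite t2 ler_pdivrMr ?exprn_gt0// ler_peMr ?(ltW rho2)//.
    by rewrite exprn_ege1// ler1n.
  by rewrite natr1 addr0.
(* The old and the new gradient are never both nonzero, hence energies add without cross terms. *)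
- have E : RI (fun x => N (g x + g' x) ^+ 2) = RI (fun x => N (g x) ^+ 2 + N (g' x) ^+ 2).
    congr RI; apply/funext => x; have [xt|xt] := leP (2 * t) (N (x - a) ^+ 2).
      by have [_ ->] := out1 x xt; rewrite addr0 normc0 expr0n addr0.
    by have [|_ ->] := h3 x; [rewrite -t2 ltW|rewrite add0r normc0 expr0n add0r].
  rewrite E RID; [|exact: rcont_sq|exact: rcont_sq].
  rewrite -natr1 mulrDl mul1r lerD//.
  have s0 : 0 < Num.sqrt (2 * t) by rewrite sqrtr_gt0 mulr_gt0.
  have s2 : Num.sqrt (2 * t) ^+ 2 = 2 * t by rewrite sqr_sqrtr// mulr_ge0// ltW.
  apply: (@le_trans _ _ ((32 / t) * (4 * Num.sqrt (2 * t) ^+ 2))); last first.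
    rewrite s2 le_eqVlt; apply/orP; left; apply/eqP; field.
    by rewrite gt_eqF.
  apply: (@RI_bump _ a) => //; first exact: rcont_sq.
    move=> x; rewrite sqr_ge0 /=; have [xt|xt] := leP (2 * t) (N (x - a) ^+ 2).
      by have [_ ->] := out1 x xt; rewrite normc0 expr0n divr_ge0// ltW.
    rewrite /g' !normcM !normc_real (ger0_norm (dstep_ge0 _)) gtr0_norm ?invr_gt0//.
    rewrite (_ : (_ * _) ^+ 2 = dstep (ph x) ^+ 2 * (t^-1 ^+ 2 * N (x - a) ^+ 2)); last first.
      by set d := dstep _; ring.
    have d4 : dstep (ph x) ^+ 2 <= 4 ^+ 2.
      by rewrite ler_pXn2r ?nnegrE ?dstep_ge0// dstep_le4.
    apply: (@le_trans _ _ (4 ^+ 2 * (t^-1 ^+ 2 * (2 * t)))).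
      apply: ler_pM; [exact: sqr_ge0|by rewrite mulr_ge0 ?sqr_ge0|exact: d4|].
      by rewrite ler_wpM2l ?sqr_ge0// ltW.
    rewrite le_eqVlt; apply/orP; left; apply/eqP; field.
    by rewrite gt_eqF.
  move=> x xs; have [|_ ->] := out1 x; last by rewrite normc0 expr0n.
  by rewrite -s2 ler_pXn2r ?nnegrE ?normc_ge0// ltW.
Qed.

(* Averaging [m] dyadic cutoffs makes the Dirichlet energy [O(1/m)]: points have zero capacity. *)
Lemma hole_cutoff a (rho e : R) : 0 < rho -> 0 < e ->
  exists (s : R) (chi : C -> R) (g : C -> C),
  [/\ 0 < s < rho, forall x, hasdbar (fun x => (chi x)%:C%C) g x,
      forall x, 0 <= chi x <= 1,
      forall x, N (x - a) < s -> chi x = 0 /\ g x = 0 &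
      (forall x, rho <= N (x - a) -> chi x = 1 /\ g x = 0) /\
      RI (fun x => N (g x) ^+ 2) <= e].
Proof.
move=> rho0 e0; pose m := (Num.truncn (256 / e)).+1.
have me : 256 / e <= m%:R by rewrite ltW// truncnS_gt.
have m0 : 0 < m%:R :> R by rewrite ltr0n.
have [chi [g [h1 h2 h3 h4 h5]]] := dyadic_cutoff a m rho0.
have p1 : 1 < 2 ^+ m :> R by rewrite exprn_egt1// ltr1n.
have p0 : 0 < 2 ^+ m :> R by lra.
(* The square of this radius is [rho^2 / 4^m], below the threshold [rho^2 / 2^m] of [dyadic_cutoff];
   a smaller radius than necessary avoids a square root. *)
exists (rho / 2 ^+ m), (fun x => m%:R^-1 * chi x), (fun x => (m%:R^-1)%:C%C * g x); split.
- by rewrite divr_gt0//= ltr_pdivrMr// ltr_pMr.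
- move=> x; apply: hasdbar_eq (hasdbarM (hasdbar_cst (m%:R^-1)%:C%C x) (h1 x)) => y.
    by rewrite (real_complexM (m%:R^-1)).
  by rewrite mul0r add0r.
- move=> x; have /andP[c0 c1] := h2 x; rewrite mulr_ge0 ?invr_ge0 ?(ltW m0)//=.
  by rewrite mulrC ler_pdivrMr// mul1r.
- move=> x xs; have [|-> ->] := h3 x; last by rewrite !mulr0.
  apply: (@le_trans _ _ ((rho / 2 ^+ m) ^+ 2)).
    rewrite ler_pXn2r ?nnegrE ?normc_ge0 ?(ltW xs)// divr_ge0 ?(ltW rho0)//; lra.
  rewrite expr_div_n ler_wpM2l ?sqr_ge0// lef_pV2 ?posrE ?exprn_gt0//.
  by rewrite expr2 ler_peMr ?(ltW p0)// ltW.
split.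
  move=> x xr; have [|-> ->] := h4 x; last by rewrite mulr0 mulVf// gt_eqF.
  by rewrite ler_pXn2r ?nnegrE ?normc_ge0// ltW.
have cg x : ccont g x by case: (h1 x).
have -> : (fun x => N ((m%:R^-1)%:C%C * g x) ^+ 2) = (fun x => m%:R^-1 ^+ 2 * N (g x) ^+ 2).
  by apply/funext => x; rewrite normcM normc_real exprMn real_normK// num_real.
rewrite RIZ; last exact: rcont_sq.
apply: (@le_trans _ _ (m%:R^-1 ^+ 2 * (m%:R * 256))).
  by rewrite ler_wpM2l// sqr_ge0.
rewrite (_ : _ * _ = 256 / m%:R); last by field; rewrite gt_eqF.
by rewrite ler_pdivrMr// mulrC -ler_pdivrMr.
Qed.

Lemma cutoff_mul (chi1 chi2 : C -> R) (g1 g2 : C -> C) :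
  (forall x, hasdbar (fun x => (chi1 x)%:C%C) g1 x) ->
  (forall x, hasdbar (fun x => (chi2 x)%:C%C) g2 x) ->
  forall x, hasdbar (fun x => (chi1 x * chi2 x)%:C%C)
    (fun x => g1 x * (chi2 x)%:C%C + (chi1 x)%:C%C * g2 x) x.
Proof.
move=> h1 h2 x; apply: hasdbar_eq (hasdbarM (h1 x) (h2 x)) => // y.
by rewrite (real_complexM (chi1 y)).
Qed.

Section Holes.
Variables (a : nat -> C) (s rho : nat -> R) (chi : nat -> C -> R) (g : nat -> C -> C).
Variables (w : nat -> R) (delta : R).
Hypothesis w0 : forall j, 0 <= w j.
Hypothesis sep : forall i j x, N (x - a i) < rho i -> N (x - a j) < rho j -> i = j.
Hypothesis hd : forall j x, hasdbar (fun x => (chi j x)%:C%C) (g j) x.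
Hypothesis chi01 : forall j x, 0 <= chi j x <= 1.
Hypothesis inn : forall j x, N (x - a j) < s j -> chi j x = 0 /\ g j x = 0.
Hypothesis out : forall j x, rho j <= N (x - a j) -> chi j x = 1 /\ g j x = 0.
Hypothesis en : forall j, w j * RI (fun x => N (g j x) ^+ 2) <= delta / 2 ^+ j.+1.

(** [X] is the product of the first [n] cutoffs. By [sep] at most one gradient is nonzero at each
    point, and the other factors are 1 there, so no constant grows with [n]. The number [t] stands
    for [|ukern|^2] at x: the majorant [W] is thus chosen without reference to z. The bound on
    [RI W] is a geometric sum. *)
Lemma holes n : exists (X : C -> R) (G : C -> C) (W : C -> R),
  [/\ forall x, hasdbar (fun x => (X x)%:C%C) G x, forall x, 0 <= X x <= 1,
    forall j x, (j < n)%N -> N (x - a j) < s j -> X x = 0 /\ G x = 0,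
    forall x, (forall j, (j < n)%N -> rho j <= N (x - a j)) -> X x = 1 /\ G x = 0 &
    [/\ rcont W, forall x, 0 <= W x,
      forall x t, 0 <= t -> (forall j, (j < n)%N -> N (x - a j) < rho j -> t <= w j) ->
        N (G x) ^+ 2 * t <= W x &
      RI W <= delta * (1 - (2 ^+ n)^-1)]].
Proof.
elim: n => [|n [X [G [W [h1 h2 h3 h4 [c1 c2 c3 c4]]]]]].
  exists (fun=> 1), (fun=> 0), (fun=> 0); split => //.
  - by move=> x; exact: hasdbar_cst.
  - by move=> x; rewrite ler01 lexx.
  split => //.
  - by move=> x; exact: ccont_cst.
  - by move=> x t _ _; rewrite normc0 expr0n mul0r.
  - by rewrite expr0 invr1 subrr mulr0 RI0.
have cg x : ccont (g n) x by case: (hd n x).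
exists (fun x => X x * chi n x),
  (fun x => G x * (chi n x)%:C%C + (X x)%:C%C * g n x),
  (fun x => W x + w n * N (g n x) ^+ 2); split.
- exact: cutoff_mul.
- move=> x; have /andP[x0 x1] := h2 x; have /andP[y0 y1] := chi01 n x.
  by rewrite mulr_ge0//= -[leRHS]mulr1 ler_pM.
- move=> j x; rewrite ltnS leq_eqVlt => /orP[/eqP->|jn] /[dup] xs.
    by move=> /inn[-> ->]; rewrite real_complex0 !mulr0 addr0.
  by move=> /(h3 _ _ jn)[-> ->]; rewrite real_complex0 !mul0r addr0.
- move=> x xo; have [-> ->] := h4 x (fun j jn => xo j (ltnW jn)).
  by have [-> ->] := out (xo n (ltnSn n)); rewrite mul0r mulr0 addr0 mulr1.
split.
- by apply: rcontD => //; apply: rcontZ; exact: rcont_sq.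
- by move=> x; rewrite addr_ge0// mulr_ge0// sqr_ge0.
- move=> x t t0 ht; have [xn|xn] := leP (rho n) (N (x - a n)).
    have [-> ->] := out xn; rewrite mulr0 addr0 mulr1 normc0 expr0n mulr0 addr0.
    by apply: c3 => // j jn; apply: ht; exact: ltnW.
  have [|-> ->] := h4 x.
    move=> j jn; rewrite leNgt; apply/negP => xj.
    by have := sep xn xj => nj; rewrite nj ltnn in jn.
  rewrite mul0r add0r mul1r; apply: ler_wpDl => //.
  by rewrite mulrC ler_wpM2r ?sqr_ge0//; exact: ht.
- rewrite RID; [|by []|by apply: rcontZ; exact: rcont_sq].
  rewrite RIZ; last exact: rcont_sq.
  apply: (le_trans (lerD c4 (en n))).
  rewrite le_eqVlt; apply/orP; left; apply/eqP; rewrite !(exprS 2); field.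
  by rewrite expf_neq0.
Qed.

End Holes.

End LogCutoff.

(** * Topology of the perforated disc *)

Section Topology.
Context {R : realType}.
Local Notation C := (Cplx R).
Local Notation N := (@Normc.normc R).
Implicit Types (z x a : C).

Lemma nbhs_near0 z (A : set C) : nbhs z A <-> near0 (fun w => A (z + w)).
Proof.
split=> [/nbhs_normP[e /= e0 eA]|[e e0 eA]].
  (* The norm takes complex values; a positive complex number is real, so its real part serves as
     radius. *)
  have := e0; rewrite ltcE /= => /andP[/eqP ie re].
  exists (complex.Re e) => // w we; apply: eA => /=.
  rewrite opprD addNKr normrN; have -> : e = (complex.Re e)%:C%C.
    by apply/eqP; rewrite eq_complex /= ie !eqxx.
  by rewrite -[`|w|]/((N w)%:C%C) ltcR.
apply: (proj2 (@nbhs_normP _ C z A)); exists (e%:C%C : R[i]); first by rewrite /= -[0]/(0%:C%C) ltcR.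
move=> y /=; rewrite distrC -[`|_|]/((N _)%:C%C) ltcR => ye.
by have := eA _ ye; rewrite addrC subrK.
Qed.

Lemma open_copen (A : set C) : open A <-> copen A.
Proof.
rewrite openE; split=> h z /h; first by move/nbhs_near0.
by move=> hz; apply/nbhs_near0.
Qed.

Lemma derivable_wirt (f : C -> C) z : derivable f z 1 <-> exists A, wirt f z A 0.
Proof.
have E (A w : C) (e : R) : w != 0 ->
    (`|A - w^-1 *: (f (w *: (1 : C) + z) - f z)| <= (e%:C%C : R[i])) =
    (N (f (z + w) - f z - (A * w + 0 * w^*%C)) <= e * N w).
  move=> w0; rewrite -[`|_|]/((N _)%:C%C) lecR -ler_pdivrMr ?normc_gt0//.
  congr (_ <= _); rewrite -normcV -normcM -[LHS]normc_opp; congr N.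
  rewrite -[w *: _]/(w * 1) mulr1 (addrC w z) -[_ *: _]/(_ * _).
  by set y := f (z + w); field.
split.
  move=> /cvg_ex[A /cvgrPdist_le h]; exists A => e e0.
  have ec0 : 0 < (e%:C%C : R[i]) by rewrite -[0]/(0%:C%C) ltcR.
  have /nbhs_near0[d d0 hd] : nbhs (0 : C) (fun t : C => t != 0 ->
    `|A - t^-1 *: ((f \o shift z) (t *: (1 : C)) - f z)| <= (e%:C%C : R[i])) := h _ ec0.
  exists d => // w wd; have [->|w0] := eqVneq w 0.
    by rewrite addr0 subrr conjc0 !mulr0 addr0 subrr normc0 mulr0.
  have := hd w wd; rewrite add0r => /(_ w0) /=.
  by rewrite E.
move=> [A hA]; apply/cvg_ex; exists A; apply/cvgrPdist_le => e e0.
have := e0; rewrite ltcE /= => /andP[/eqP ie re].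
have [d d0 hd] := hA _ re.
suff : nbhs (0 : C) (fun t : C => t != 0 ->
    `|A - t^-1 *: ((f \o shift z) (t *: (1 : C)) - f z)| <= e) by [].
apply/nbhs_near0; exists d => // w wd; rewrite add0r => w0 /=.
have -> : e = (complex.Re e)%:C%C by apply/eqP; rewrite eq_complex /= ie !eqxx.
by rewrite E//; exact: hd.
Qed.

Lemma continuous_ReIm (u v : R -> R) : continuous u -> continuous v ->
  continuous (fun t => (u t +i* v t)%C : C).
Proof.
move=> cu cv t A /nbhs_near0[e e0 eA].
have e2 : 0 < e / 2 by rewrite divr_gt0.
have /cvgrPdist_lt/(_ _ e2) hu := cu t.
have /cvgrPdist_lt/(_ _ e2) hv := cv t.
suff : \forall s \near t, A (u s +i* v s)%C by [].
near=> s.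
have -> : (u s +i* v s)%C = (u t +i* v t)%C + ((u s - u t) +i* (v s - v t))%C.
  by apply/eqP; rewrite eq_complex /=; apply/andP; split; apply/eqP; ring.
apply: eA; apply: le_lt_trans (normc_le_ReIm _ _) _.
rewrite [ltRHS]splitr; apply: ltrD; rewrite distrC; near: s; [exact: hu|exact: hv].
Unshelve. all: by end_near. Qed.

Lemma polar (w : C) : exists t : R, w = ((N w * cos t) +i* (N w * sin t))%C.
Proof.
case: w => x y; set r := N _.
have r2 : r ^+ 2 = x ^+ 2 + y ^+ 2 by rewrite /r normc_sqr.
have r0 : 0 <= r := normc_ge0 _.
have [re0|rn0] := eqVneq r 0.
  exists 0; apply/eqP; rewrite eq_complex /= re0 !mul0r.
  by have /eqP := re0; rewrite normc_eq0 eq_complex /=.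
have rp : 0 < r by rewrite lt_def rn0.
have xr : - 1 <= x / r <= 1.
  by rewrite ler_pdivrMr// ler_pdivlMr// mulN1r mul1r -ler_norml; exact: (normr_Re_le (x +i* y)%C).
have cx : r * cos (acos (x / r)) = x by rewrite acosK ?in_itv//= mulrCA divff ?mulr1.
have sy : (r * sin (acos (x / r))) ^+ 2 = y ^+ 2.
  rewrite exprMn sin2cos2 acosK ?in_itv//= mulrBr mulr1 expr_div_n mulrCA divff ?mulr1; last first.
    by rewrite expf_neq0.
  by rewrite r2; ring.
move: sy => /eqP; rewrite eqf_sqr => /orP[] /eqP sy.
  by exists (acos (x / r)); rewrite cx sy.
by exists (- acos (x / r)); rewrite cosN sinN cx mulrN sy opprK.
Qed.

(** The annulus is the union of its middle circle and its radial segments, each of which meets that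
    circle. With [s = 0] this covers the punctured disc. *)
Lemma annulus_connected a (s t : R) : 0 <= s -> s < t ->
  connected [set x : C | s < N (x - a) < t].
Proof.
move=> s0 st.
pose P (r u : R) : C := ((complex.Re a + r * cos u) +i* (complex.Im a + r * sin u))%C.
have PN r u : 0 <= r -> N (P r u - a) = r.
  move=> r0; have -> : P r u - a = ((r * cos u) +i* (r * sin u))%C.
    rewrite /P; case: (a) => b c; apply/eqP; rewrite eq_complex /=.
    by apply/andP; split; apply/eqP; ring.
  apply/eqP; rewrite -(eqrXn2 (n := 2)) ?normc_ge0// normc_sqr /= !exprMn -mulrDr.
  by rewrite cos2Dsin2 mulr1.
pose r0 := (s + t) / 2.
have r00 : 0 <= r0 by rewrite divr_ge0//; lra.
pose circ := [set P r0 u | u in [set: R]].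
pose ray u := [set P r u | r in `]s, t[%classic].
have ccirc : connected circ.
  apply: connected_continuous_connected.
    by apply/connected_intervalP => x y _ _ z _.
  apply: continuous_subspaceT; apply: continuous_ReIm => u.
    by apply: cvgD; [exact: cvg_cst|apply: cvgM; [exact: cvg_cst|exact: continuous_cos]].
  by apply: cvgD; [exact: cvg_cst|apply: cvgM; [exact: cvg_cst|exact: continuous_sin]].
have cray u : connected (ray u).
  apply: connected_continuous_connected.
    by apply/connected_intervalP; exact: interval_is_interval.
  apply: continuous_subspaceT; apply: continuous_ReIm => r.
    by apply: cvgD; [exact: cvg_cst|apply: cvgM; [exact: cvg_id|exact: cvg_cst]].
  by apply: cvgD; [exact: cvg_cst|apply: cvgM; [exact: cvg_id|exact: cvg_cst]].
have mid : s < r0 < t by rewrite /r0; apply/andP; split; lra.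
have -> : [set x : C | s < N (x - a) < t] = \bigcup_(u in [set: R]) (circ `|` ray u).
  apply/seteqP; split=> [x /= xst|x [u _ [[v _ <-]|[r]]]] /=.
  - have [u xu] := polar (x - a); exists u => //; right; exists (N (x - a)); first by rewrite /= in_itv.
    have -> : x = a + (x - a) by rewrite addrC subrK.
    rewrite [in RHS]xu addrAC subrr add0r /P; case: (a) => b c.
    by apply/eqP; rewrite eq_complex /=; apply/andP; split; apply/eqP.
  - by rewrite PN.
  - rewrite /= in_itv/= => rst <-; rewrite PN//; have /andP[? _] := rst; lra.
apply: bigcup_connected; first by exists (P r0 0) => u _; left; exists 0.
move=> u _; apply: connectedU => //.
by exists (P r0 u); split; [exists u|exists r0; rewrite //= in_itv].
Qed.

Lemma connected_sub_or (A G U : set C) (O K : set C) : connected A -> A `<=` G ->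
  open O -> closed K -> U = G `&` O -> U = G `&` K -> A `<=` U \/ A `&` U = set0.
Proof.
move=> cA AG oO cK UO UK.
have [|/set0P AU] := eqVneq (A `&` U) set0; first by right.
left; have <- : A `&` U = A; last by move=> x [].
apply: cA => //; [exists O|exists K] => //.
- by rewrite UO; apply/seteqP; split=> [x [xA [xG xO]]|x [xA xO]]; [by split|by split=> //; split=> //; exact: AG].
- by rewrite UK; apply/seteqP; split=> [x [xA [xG xO]]|x [xA xO]]; [by split|by split=> //; split=> //; exact: AG].
Qed.

Lemma disc_open a (r : R) : copen [set x : C | N (x - a) < r].
Proof.
move=> x /= xr; exists (r - N (x - a)); first by rewrite subr_gt0.
move=> w hw; rewrite addrAC; apply: le_lt_trans (normcD_le _ _) _; lra.
Qed.

(* A clopen piece of the perforated disc extends over each hole, because the collar of a hole is connected; hence it is everything, the punctured disc being connected. *)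
Lemma perforated_connected (a : nat -> C) (s rho : nat -> R) :
  let G := @unit_disc R `\` (\bigcup_j closed_disc (a j) (s j) `|` [set 0]) in
  copen G -> (forall j, 0 < s j < rho j) ->
  (forall j x, N (x - a j) < rho j -> unit_disc x /\ x != 0) ->
  (forall i j x, N (x - a i) < rho i -> N (x - a j) < rho j -> i = j) ->
  connected G.
Proof.
move=> G oG srho hin sep U.
move=> [y Uy] [Q oQ UO] [K cK UK].
pose Ep : set C := [set x | 0 < N (x - 0) < 1].
have cEp : connected Ep by exact: annulus_connected.
have EpE x : Ep x <-> unit_disc x /\ x != 0.
  rewrite /Ep /unit_disc /= subr0 normc_gt0; split; first by move/andP=> [].
  by move=> [? ?]; apply/andP.
pose An j : set C := [set x | s j < N (x - a j) < rho j].
pose Dj j : set C := [set x | N (x - a j) < rho j].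
have closedD j x : closed_disc (a j) (s j) x -> Dj j x.
  by rewrite /closed_disc /Dj /= => h; apply: le_lt_trans h _; have /andP[] := srho j.
have GD j x : G x -> Dj j x -> An j x.
  move=> [_ nG] xD; apply/andP; split=> //; rewrite ltNge; apply/negP => h.
  by apply: nG; left; exists j.
have AnG j : An j `<=` G.
  move=> x /andP[x1 x2]; have [xE x0] := hin _ _ x2; split=> //.
  case=> [[k _ xk]|/= xe]; last by rewrite xe eqxx in x0.
  have jk := sep _ _ _ x2 (closedD _ _ xk); rewrite -jk /closed_disc /= in xk; by move: x1; rewrite ltNge xk.
have An_or j : An j `<=` U \/ An j `&` U = set0.
  have /andP[s0 sr] := srho j.
  apply: (@connected_sub_or _ G U Q K) => //.
  by apply: annulus_connected => //; exact: ltW.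
have Vopen : copen (G `&` ~` K).
  have /open_copen oK : open (~` K) by exact: closed_openC.
  by move=> x [/oG Gx /oK Kx]; exact: near0I.
have Uopen : copen U.
  by rewrite UO => x [/oG Gx]; have /open_copen oQ' := oQ; move=> /oQ'; exact: near0I.
(* The piece and its complement in [G], each together with the full discs whose collars it contains.
   Both are open, they are disjoint, and they cover the punctured disc. *)
pose Ut : set C := U `|` \bigcup_(j in [set j | An j `<=` U]) Dj j.
pose Vt : set C := (G `&` ~` K) `|` \bigcup_(j in [set j | An j `&` U = set0]) Dj j.
have UG : U `<=` G by rewrite UO => x [].
have ann j : An j !=set0.
  have /andP[s0 sr] := srho j.
  exists (a j + ((s j + rho j) / 2)%:C%C); rewrite /An /= addrAC subrr add0r normc_real.
  clear -s0 sr; rewrite gtr0_norm; first by apply/andP; split; lra.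
  by rewrite divr_gt0//; lra.
have Uto : copen Ut.
  move=> x [/Uopen|[j jU /disc_open]]; apply: near0S => w; first by left.
  by right; exists j.
have Vto : copen Vt.
  move=> x [/Vopen|[j jU /disc_open]]; apply: near0S => w; first by left.
  by right; exists j.
have GEp : G `<=` Ep.
  by move=> x [x1 x2]; apply/EpE; split=> //; apply/eqP => x0; apply: x2; right.
have UtE : Ut `<=` Ep.
  move=> x [/UG/GEp//|[j _ xj]]; apply/EpE; exact: hin xj.
have cover x : Ep x -> Ut x \/ Vt x.
  move=> /EpE[x1 x0]; have [Gx|nGx] := pselect (G x).
    have [Kx|nKx] := pselect (K x); last by right; left.
    by left; left; rewrite UK.
  have [j xj] : exists j, Dj j x.
    apply: contrapT => nD; apply: nGx; split=> //.
    case=> [[j _ xj]|/= xe]; last by rewrite xe eqxx in x0.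
    by apply: nD; exists j; exact: closedD.
  have [jU|jU] := An_or j; first by left; right; exists j.
  by right; right; exists j.
have disj x : Ut x -> Vt x -> False.
  move=> [Ux|[i iU xi]] [[Gx nKx]|[j jV xj]].
  - by move: Ux; rewrite UK => -[].
  - have : (An j `&` U) x by split=> //; apply: GD => //; exact: UG.
    by rewrite jV.
  - by have := iU x (GD _ _ Gx xi); rewrite UK => -[].
  - have ij := sep _ _ _ xi xj; rewrite -ij in jV.
    have [u iu] := ann i; have : (An i `&` U) u by split=> //; exact: iU.
    by rewrite jV.
have Ute : Ut = Ep.
  apply: cEp; first by exists y; left.
  - exists Ut; first exact/open_copen.
    by apply/seteqP; split=> [x xU|x []//]; split=> //; exact: UtE.
  - exists (~` Vt); first by apply: open_closedC; exact/open_copen.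
    apply/seteqP; split=> [x xU|x [xE nV]]; first by split; [exact: UtE|exact: disj].
    by have [] := cover _ xE.
apply/seteqP; split=> // x Gx.
have : Ut x by rewrite Ute; exact: GEp.
by case=> [//|[j jU xj]]; apply: jU; exact: GD.
Qed.

End Topology.

(** * Choice of the radii *)

Section Assembly.
Context {R : realType}.
Local Notation C := (Cplx R).
Local Notation N := (@Normc.normc R).
Local Notation mu2 := (@lebesgue_measure R \x @lebesgue_measure R)%E.
Local Notation E2 := (plane_set (@unit_disc R)).
Implicit Types (z x : C).

(** Since [|den| >= 1 - |x|], the factor [(1 - |x|^2) / |den|] is at most [1 + |x|], whatever z
    is. *)
Lemma ukern_le z x (r : R) : unit_disc z -> unit_disc x -> 0 < r -> r <= N (x - z) ->
  N (ukern z x) <= 2 / r.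
Proof.
move=> z1 x1 r0 rx; have xz : x != z by rewrite -subr_eq0 -normc_gt0; apply: lt_le_trans rx.
have [z1' x1'] : N z < 1 /\ N x < 1 by [].
have d0 : 0 < N (den z x) by rewrite normc_gt0 den_neq0.
have xd : 1 - N x <= N (den z x).
  have := normc_dist 1 (x^*%C * z); rewrite normc1 normcM normc_conj ler_norml => /andP[_].
  rewrite -/(den z x); have : N x * N z <= N x by rewrite ler_piMr ?normc_ge0// ltW.
  lra.
rewrite normc_ukern// invfM mulrA; apply: ler_pM.
- by rewrite divr_ge0 ?(ltW d0)// subr_ge0 expr_le1 ?normc_ge0// ltW.
- by rewrite invr_ge0 normc_ge0.
- rewrite ler_pdivrMr//; have : (1 - N x) * (1 + N x) <= N (den z x) * 2.
    by apply: ler_pM => //; have := normc_ge0 x; lra.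
  lra.
- by rewrite lef_pV2 ?posrE ?normc_gt0 ?subr_eq0.
Qed.

Lemma near0_fin (n : nat) (P : nat -> C -> Prop) : (forall j, (j < n)%N -> near0 (P j)) ->
  near0 (fun w => forall j, (j < n)%N -> P j w).
Proof.
elim: n => [|n IH] h; first by exists 1.
have hn := near0I (IH (fun j jn => h j (ltnW jn))) (h n (ltnSn n)).
apply: near0S hn => w [h1 h2] j; rewrite ltnS leq_eqVlt => /orP[/eqP->//|]; exact: h1.
Qed.

Lemma closed_disc_compl (a : C) (s : R) : copen (~` closed_disc a s).
Proof.
move=> x /negP; rewrite /closed_disc /= -ltNge => sx.
exists (N (x - a) - s); first by rewrite subr_gt0.
move=> w hw /= ; apply/negP; rewrite -ltNge.
have := normc_dist (x + w - a) (x - a); rewrite (_ : x + w - a - (x - a) = w); last by ring.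
rewrite ler_norml => /andP[]; lra.
Qed.

Lemma copenD (A B : set C) : copen A -> copen (~` B) -> copen (A `\` B).
Proof. by move=> oA oB x [/oA Ax /oB Bx]; exact: near0I. Qed.

Lemma kdiag_le z x : N z <= N x -> unit_disc x -> kdiag z <= kdiag x.
Proof.
move=> zx x1; have x1' : N x < 1 by [].
have h : N z ^+ 2 <= N x ^+ 2 by rewrite ler_pXn2r ?nnegrE ?normc_ge0.
have h1 : N x ^+ 2 < 1 by rewrite expr_lt1 ?normc_ge0.
rewrite /kdiag lef_pV2 ?posrE ?exprn_gt0//; try lra.
have a1 : 0 <= 1 - N x ^+ 2 by lra.
have a2 : 0 <= 1 - N z ^+ 2 by lra.
by rewrite ler_pXn2r ?nnegrE// lerD2l lerN2.
Qed.

Lemma kdiag_gt0 z : unit_disc z -> 0 < kdiag z.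
Proof.
by move=> z1; rewrite /kdiag invr_gt0 exprn_gt0// subr_gt0 expr_lt1 ?normc_ge0.
Qed.

(** The test function is [kern z], whose norm on [O] is at most its norm on the disc. *)
Lemma kern_lower (O : set C) z : copen O -> O `<=` @unit_disc R -> O z ->
  ((kdiag z / mass 0)%:E <= bergman_kernel O z)%E.
Proof.
move=> oO OE Oz; have z1 := OE _ Oz; have m0 := @mass_gt0 R; have k0 := kdiag_gt0 z1.
have mO := plane_measurable oO; have mE := @disc_measurable R.
have iE := kern_integrable z1.
have OE2 : plane_set O `<=` E2 by move=> p /OE.
have iO : mu2.-integrable (plane_set O) (EFin \o (fun p => N (kern z (pt p)) ^+ 2)).
  exact: integrableS iE.
have up : sq_L2norm O (kern z) <= mass 0 * kdiag z.
  rewrite -kern_norm//; apply: Rintegral_subset => // p _; exact: sqr_ge0.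
have low : 0 < sq_L2norm O (kern z).
  have [e e0 he] := mu2_square oO Oz OE.
  (* From [|den| <= 2] one gets [|kern| >= 1/4], hence 1/16 for the square; the norm on [O] must be
     positive because it is divided by. *)
  have e1 : 0 < 1 / 16 * e by rewrite mulr_gt0// divr_gt0.
  apply: (lt_le_trans e1).
  apply: (@le_trans _ _ (Rintegral mu2 (plane_set O) (cst (1 / 16)))).
    rewrite Rintegral_cst//; first by rewrite ler_wpM2l.
  apply: le_Rintegral => //.
    apply: (@disc_integrable _ O (cst (1/16)) (1/16)) => // p _.
      by move=> d d0; exists 1 => // q _ _; rewrite subrr normr0.
    by rewrite /cst ger0_norm// divr_ge0.
  move=> p /OE p1; rewrite /sq_modulus /=.
  have d2 : N (den z (pt p)) <= 2.
    apply: (le_trans (normcB_le _ _)); rewrite normc1 normcM normc_conj.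
    have : N (pt p) * N z <= 1 by rewrite mulr_ile1 ?normc_ge0// ltW.
    lra.
  have d0 : 0 < N (den z (pt p)) by rewrite normc_gt0 den_neq0.
  have -> : 1 / 16 = ((2 ^+ 2)^-1) ^+ 2 :> R by field.
  rewrite -/(pt p) normc_kern ler_pXn2r ?nnegrE ?invr_ge0 ?sqr_ge0//.
  by rewrite lef_pV2 ?posrE ?exprn_gt0// ler_pXn2r ?nnegrE ?(ltW d0).
apply: (@le_trans _ _ (N (kern z z) ^+ 2 / sq_L2norm O (kern z))%:E).
  rewrite lee_fin kern_diag normc_real gtr0_norm// ler_pdivlMr//.
  apply: (@le_trans _ _ (kdiag z / mass 0 * (mass 0 * kdiag z))).
    by rewrite ler_wpM2l// divr_ge0// ltW.
  rewrite le_eqVlt; apply/orP; left; apply/eqP; field.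
  by rewrite gt_eqF.
apply: ereal_sup_ubound; exists (kern z) => //; split.
  split=> // x /OE x1; apply/derivable_wirt; exact: wirt_kern.
by exists z => //; rewrite kern_diag -normc_eq0 normc_real gtr0_norm// gt_eqF.
Qed.

Lemma farthest (c : C) (r : R) : 0 < r ->
  exists2 x, closed_disc c r x & forall z, closed_disc c r z -> N z <= N x.
Proof.
move=> r0; pose d : C := if c == 0 then 1 else c / (N c)%:C%C.
have cd : c = (N c)%:C%C * d.
  rewrite /d; case: ifPn => [/eqP->|c0]; first by rewrite normc0 mul0r.
  rewrite mulrCA divff ?mulr1//.
  by rewrite -normc_eq0 normc_real normr_eq0 normc_eq0.
have Nd : N d = 1.
  rewrite /d; case: ifPn => [_|c0]; first exact: normc1.
  by rewrite normcM normcV normc_real ger0_norm ?normc_ge0// divff// normc_eq0.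
exists (c + r%:C%C * d).
  by rewrite /closed_disc /= addrAC subrr add0r normcM Nd normc_real mulr1 gtr0_norm.
move=> z; rewrite /closed_disc /= => zr.
have -> : N (c + r%:C%C * d) = N c + r.
  rewrite {1}cd -mulrDl -real_complexD normcM Nd mulr1 normc_real ger0_norm ?addr_ge0 ?normc_ge0 ?(ltW r0)//.
by have := normcD_le c (z - c); rewrite addrC subrK; lra.
Qed.

End Assembly.

Theorem proposition5p2 (R : realType) (a : nat -> Cplx R) (B : set (Cplx R))
    (r : nat -> R) (M : R)
    (a_unit : forall j, unit_disc (a j))
    (a_inj : injective a)
    (a_cvg : a @ \oo --> (0 : Cplx R))
    (B_disc : is_closed_disc B)
    (B_unit : B `<=` unit_disc)
    (B_0 : B 0)
    (B_a : forall j, ~ B (a j))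
    (r_gt0 : forall j, 0 < r j)
    (r_disj : forall j k, j <> k ->
       closed_disc (a j) (r j) `&` closed_disc (a k) (r k) = set0)
    (B_disj : forall j, B `&` closed_disc (a j) (r j) = set0)
    (D := fun N : nat => unit_disc `\` \bigcup_(j < N) closed_disc (a j) (r j))
    (D_bound : forall N, (0 < N)%N ->
       forall z, B z -> (bergman_kernel (D N) z < M%:E)%E) :
  exists s : nat -> R,
    [/\ s @ \oo --> (0 : R),
        (forall j, 0 < s j <= r j)
      & let G := unit_disc `\` (\bigcup_j closed_disc (a j) (s j) `|` [set 0]) in
        is_domain G /\
        (forall z, (B `&` G) z -> (bergman_kernel G z < M%:E)%E)].
Proof.
pose N := @Normc.normc R; pose m := mass (0 : Cplx R).
have m0 : 0 < m := mass_gt0.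
have BN z j : B z -> r j < N (z - a j).
  move=> Bz; rewrite ltNge; apply/negP => h.
  have : (B `&` closed_disc (a j) (r j)) z by split.
  by rewrite B_disj.
have [zs Bzs zsmax] : exists2 zs, B zs & forall z, B z -> N z <= N zs.
  by have [c [rr [rr0 ->]]] := B_disc; exact: farthest.
have zs1 := B_unit _ Bzs; have ks0 := kdiag_gt0 zs1.
pose M0 := kdiag zs / m.
have M00 : 0 < M0 by rewrite divr_gt0.
have M0M : M0 < M.
  have oD : copen (D 1%N).
    apply: copenD; first exact: copen_disc.
    move=> x /= nx; have nx0 : (~` closed_disc (a 0%N) (r 0%N)) x.
      by move=> h; apply: nx; exists 0%N.
    apply: near0S (closed_disc_compl nx0) => w hw [j /=]; rewrite ltnS leqn0 => /eqP->; exact: hw.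
  have Dzs : D 1%N zs.
    split=> // -[j _ h]; have := BN _ j Bzs; rewrite /closed_disc /= in h.
    by rewrite ltNge h.
  rewrite -lte_fin; apply: le_lt_trans (D_bound 1%N isT zs Bzs).
  by apply: kern_lower => //; move=> x [].
(* The final bound is [M0 + 2 gap], strictly below [M]. One gap pays for the factor [1 + th], as
   [th * M0 = gap]; the other pays for the cutoffs, whose energy [4 delta] satisfies
   [(1 + th^-1) * (4 * delta) = gap * m ^+ 2]. *)
pose gap := (M - M0) / 4.
have gap0 : 0 < gap by rewrite divr_gt0// subr_gt0.
pose th := gap / M0.
have th0 : 0 < th by rewrite divr_gt0.
pose delta := gap * m ^+ 2 / (1 + th^-1) / 4.
have thi0 : 0 < 1 + th^-1 by rewrite addr_gt0// invr_gt0.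
have m20 : 0 < m ^+ 2 by rewrite exprn_gt0.
have delta0 : 0 < delta by rewrite !divr_gt0// mulr_gt0.
(* The first bound keeps the disc of radius [rho j] at distance at least [r j / 2] from every point
   of [B], the second keeps it inside the unit disc. *)
pose rho j := Num.min (r j / 2) ((1 - N (a j)) / 2).
have rho0 j : 0 < rho j.
  by rewrite lt_min !divr_gt0// subr_gt0; exact: a_unit.
have rhor j : rho j <= r j / 2 by rewrite ge_min lexx.
have rhoa j : rho j <= (1 - N (a j)) / 2 by rewrite ge_min lexx orbT.
(* This is [(2 / (r j / 2)) ^+ 2], the bound of [|ukern|^2] near the j-th hole for all z in [B]
   simultaneously. *)
pose w j := 16 / r j ^+ 2.
have w0 j : 0 < w j by rewrite divr_gt0// exprn_gt0.
have e0 j : 0 < delta / 2 ^+ j.+1 / w j by rewrite divr_gt0// divr_gt0// exprn_gt0.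
have sep i j x : N (x - a i) < rho i -> N (x - a j) < rho j -> i = j.
  move=> xi xj; apply: contrapT => ij.
  have : (closed_disc (a i) (r i) `&` closed_disc (a j) (r j)) x.
    have ri := r_gt0 i; have rj := r_gt0 j; have hi := rhor i; have hj := rhor j.
    by clear -xi xj ri rj hi hj; split; rewrite /closed_disc /= -/N; lra.
  by rewrite r_disj.
have inD j x : N (x - a j) < rho j -> unit_disc x /\ x != 0.
  move=> xj; have ha : N (a j) < 1 := a_unit j; have hi := rhoa j; split.
    have := normcD_le (x - a j) (a j); rewrite subrK -/N => h.
    by clear -xj ha hi h; rewrite /unit_disc /= -/N; lra.
  apply/eqP => x0; have := BN _ j B_0; rewrite x0 in xj; have hr := rhor j; have rj := r_gt0 j.
  by clear -xj hr rj; lra.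
have hole j : exists t : R * (R[i] -> R) * (R[i] -> R[i]),
  [/\ 0 < t.1.1 < rho j, forall x, hasdbar (fun x => (t.1.2 x)%:C%C) t.2 x,
      forall x, 0 <= t.1.2 x <= 1,
      forall x, N (x - a j) < t.1.1 -> t.1.2 x = 0 /\ t.2 x = 0 &
      (forall x, rho j <= N (x - a j) -> t.1.2 x = 1 /\ t.2 x = 0) /\
      RI (fun x => N (t.2 x) ^+ 2) <= delta / 2 ^+ j.+1 / w j].
  have [t [ch [gr h]]] := hole_cutoff (a j) (rho0 j) (e0 j).
  by exists (t, ch, gr).
have [H HP] := choice hole.
pose s' j := (H j).1.1; pose chi j := (H j).1.2; pose g j := (H j).2.
have s'0 j : 0 < s' j < rho j by case: (HP j).
have hd j x : hasdbar (fun x => (chi j x)%:C%C) (g j) x.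
  by case: (HP j) => _ h _ _ _; exact: h.
have chi01 j x : 0 <= chi j x <= 1 by case: (HP j) => _ _ h _ _; exact: h.
have inn j x : N (x - a j) < s' j -> chi j x = 0 /\ g j x = 0.
  by case: (HP j) => _ _ _ h _; exact: h.
have out j x : rho j <= N (x - a j) -> chi j x = 1 /\ g j x = 0.
  by case: (HP j) => _ _ _ _ [h _]; exact: h.
have en j : w j * RI (fun x => N (g j x) ^+ 2) <= delta / 2 ^+ j.+1.
  by case: (HP j) => _ _ _ _ [_ h]; rewrite mulrC -ler_pdivlMr.
(* Halving puts the closed disc inside the open disc where the cutoff vanishes, so the cutoff
   vanishes near each of its points; the other term forces convergence to 0. *)
pose s j := Num.min (s' j / 2) (j.+1%:R^-1).
have s0 j : 0 < s j.
  by rewrite lt_min invr_gt0 ltr0n andbT divr_gt0//; have /andP[] := s'0 j.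
have ss' j : s j < s' j.
  have /andP[h _] := s'0 j; rewrite gt_min; apply/orP; left.
  by clear -h; lra.
have srho j : s j < rho j.
  by apply: lt_trans (ss' j) _; have /andP[] := s'0 j.
have sr j : s j <= r j.
  have h1 := srho j; have h2 := rhor j; have h3 := r_gt0 j.
  by clear -h1 h2 h3; lra.
have sn j : s j <= j.+1%:R^-1 by rewrite ge_min lexx orbT.
have scvg : s @ \oo --> (0 : R).
  apply: (@squeeze_cvgr _ _ _ _ (fun=> 0) (fun j => j.+1%:R^-1)).
  - by near=> j; rewrite (ltW (s0 j)) sn.
  - exact: cvg_cst.
  - exact: cvg_harmonic.
have tail (e : R) : 0 < e -> exists n, forall j, (n <= j)%N -> N (a j) + s j < e.
  move=> e1; have e2 : 0 < e / 2 by rewrite divr_gt0.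
  have [n1 _ h1] : \forall j \near \oo, N (a j) < e / 2.
    have nb : nbhs (0 : Cplx R) (fun x => N x < e / 2).
      by apply/nbhs_near0; exists (e / 2) => // x hx; rewrite add0r.
    exact: (a_cvg _ nb).
  have /cvgrPdist_lt/(_ _ e2)[n2 _ h2] := scvg.
  exists (maxn n1 n2) => j; rewrite geq_max => /andP[/h1/= k1 /h2/=].
  rewrite sub0r normrN gtr0_norm// => k2.
  by clear -k1 k2; lra.
exists s; split => //; first by move=> j; rewrite s0 sr.
move=> G.
have GE : G `<=` unit_disc by move=> x [].
(* Away from 0 this is a local condition on finitely many discs: by [tail] the others lie in the
   disc of radius [|x| / 2] about 0. *)
have oG : copen G.
  move=> x [x1 nx].
  have x0 : x != 0 by apply/eqP => h; apply: nx; right.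
  have Nx : 0 < N x by rewrite normc_gt0.
  have Nx2 : 0 < N x / 2 by rewrite divr_gt0.
  have [n hn] := tail _ Nx2.
  have hfin : near0 (fun w => forall j, (j < n)%N -> (~` closed_disc (a j) (s j)) (x + w)).
    apply: near0_fin => j _; apply: closed_disc_compl => h.
    by apply: nx; left; exists j.
  have hhalf : near0 (fun w => N x / 2 < N (x + w)).
    exists (N x / 2) => // v hv.
    have := normc_dist (x + v) x; rewrite addrAC subrr add0r ler_norml => /andP[h _].
    by rewrite /N in hv h *; clear -hv h; lra.
  apply: near0S (near0I (copen_disc x1) (near0I hfin hhalf)) => v [v1 [v2 v3]].
  split=> // -[[j _ hj]|/= v0]; last first.
    by rewrite v0 /N normc0 in v3; move: Nx2; rewrite ltNge ltW.
  have [jn|jn] := ltnP j n; first exact: (v2 j jn).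
  have := hn _ jn; rewrite /closed_disc /= in hj.
  have := normcD_le (x + v - a j) (a j); rewrite subrK.
  by rewrite /N in v3 *; clear -hj v3; lra.
have BG z : B z -> z != 0 -> G z.
  move=> Bz z0; split; first exact: B_unit.
  case=> [[j _ h]|/= h]; last by rewrite h eqxx in z0.
  have := BN _ j Bz; rewrite ltNge => /negP; apply.
  by apply: le_trans (sr j).
split.
  split; first exact/open_copen.
    by apply: (perforated_connected oG _ inD sep) => j; rewrite s0 srho.
  have [c [rr [rr0 BE]]] := B_disc.
  have [c0|c0] := eqVneq c 0.
    exists (rr%:C%C); apply: BG.
      by rewrite BE c0; change (N (rr%:C%C - 0) <= rr); rewrite subr0 /N normc_real gtr0_norm.
    by rewrite -normc_eq0 normc_real normr_eq0 gt_eqF.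
  exists c; apply: BG => //.
  by rewrite BE; change (N (c - c) <= rr); rewrite subrr /N normc0 ltW.
move=> z [Bz Gz].
have z1 : unit_disc z := GE _ Gz.
have z0 : z != 0 by apply/eqP => h; case: Gz => _; apply; right.
have Nz : 0 < N z by rewrite normc_gt0.
have [chi1 [V [g1 [p1 p2 p3 p4 [p5 p6 p7 p8]]]]] := bcut_exists z1 (divr_gt0 delta0 (ltr0Sn _ 3)).
(* This is [(2 / (|z| / 2)) ^+ 2], which bounds [|ukern|^2] on the disc of radius [|z| / 2] about 0,
   where the cutoff at 0 has its gradient. *)
pose c0 := 16 / N z ^+ 2.
have c00 : 0 < c0 by rewrite divr_gt0// exprn_gt0.
have Nz2 : 0 < N z / 2 by rewrite divr_gt0.
have e00 : 0 < delta / (4 * c0) by rewrite divr_gt0// mulr_gt0.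
have [s00 [chi2 [g2 [/andP[q1 q1'] q2 q3 q4 [q5 q6]]]]] := hole_cutoff 0 Nz2 e00.
(* The holes from the n-th on lie where the cutoff at 0 vanishes; only the earlier ones need their
   own cutoffs. *)
have [n hn] := tail _ q1.
have [X [G3 [W [t1 t2 t3 t4 [t5 t6 t7 t8]]]]] :=
  holes (fun j => ltW (w0 j)) sep hd chi01 inn out en n.
pose chi12 x := chi1 x * chi2 x.
pose g12 x := g1 x * (chi2 x)%:C%C + (chi1 x)%:C%C * g2 x.
pose chiT x := chi12 x * X x.
pose gT x := g12 x * (X x)%:C%C + (chi12 x)%:C%C * G3 x.
(* The inequality [sq2] is used twice, so the two inner cutoffs of the product get a factor 4 and
   the holes a factor 2. The energies add up to [delta + delta + 2 * delta]. *)
pose WT x := 4 * V x + (4 * c0 * N (g2 x) ^+ 2 + 2 * W x).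
have cg2 x : ccont g2 x by case: (q2 x).
have r2 : rcont (fun x => 4 * c0 * N (g2 x) ^+ 2) by apply: rcontZ; exact: rcont_sq.
have r3 : rcont (fun x => 2 * W x) by exact: rcontZ.
have r1 : rcont (fun x => 4 * V x) by exact: rcontZ.
have rWT : rcont WT by apply: rcontD => //; exact: rcontD.
have hT x : hasdbar (fun x => (chiT x)%:C%C) gT x.
  by apply: (cutoff_mul (chi1 := chi12) (g1 := g12)) => //; exact: cutoff_mul.
have chi12b x : 0 <= chi12 x <= 1.
  have /andP[k1 k2] := p2 x; have /andP[k3 k4] := q3 x.
  by rewrite mulr_ge0//= -[leRHS]mulr1 ler_pM.
have chiTb x : 0 <= chiT x <= 1.
  have /andP[k1 k2] := chi12b x; have /andP[k3 k4] := t2 x.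
  by rewrite mulr_ge0//= -[leRHS]mulr1 ler_pM.
have WT0 x : 0 <= WT x.
  rewrite /WT; apply: addr_ge0; first exact: mulr_ge0.
  by apply: addr_ge0; [apply: mulr_ge0; [exact: mulr_ge0 (ltW c00)|exact: sqr_ge0]|exact: mulr_ge0].
have zero1 x : chi1 x = 0 /\ g1 x = 0 -> chiT x = 0 /\ gT x = 0.
  by move=> [k1 k2]; rewrite /chiT /gT /chi12 /g12 k1 k2 !(mul0r, real_complex0, addr0).
have zero2 x : chi2 x = 0 /\ g2 x = 0 -> chiT x = 0 /\ gT x = 0.
  by move=> [k1 k2]; rewrite /chiT /gT /chi12 /g12 k1 k2 real_complex0 !(mulr0, mul0r, real_complex0, addr0).
have zero3 x : X x = 0 /\ G3 x = 0 -> chiT x = 0 /\ gT x = 0.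
  by move=> [k1 k2]; rewrite /chiT /gT k1 k2 real_complex0 !(mulr0, addr0).
have offG x : ~ G x -> near0 (fun v => chiT (x + v) = 0 /\ gT (x + v) = 0).
  move=> nG; have [x1|/p3] := pselect (unit_disc x); last first.
    by apply: near0S => v; exact: zero1.
  have small : N x < s00 -> near0 (fun v => chiT (x + v) = 0 /\ gT (x + v) = 0).
    move=> xs; have xs' : N (x - 0) < s00 by rewrite subr0.
    have [d d0 hdd] := @disc_open _ 0 s00 x xs'.
    by exists d => // v /hdd /= h; apply: zero2; exact: q4.
  have : (\bigcup_j closed_disc (a j) (s j) `|` [set 0]) x.
    by apply: contrapT => h; apply: nG.
  case=> [[j _ xj]|/= xe]; last by apply: small; rewrite xe /N normc0.
  have [jn|jn] := ltnP j n.
    have [d d0 hdd] := @disc_open _ (a j) (s' j) x (le_lt_trans xj (ss' j)).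
    by exists d => // v /hdd /= h; apply: zero3; exact: t3 h.
  apply: small; apply: le_lt_trans (hn _ jn).
  have := normcD_le (x - a j) (a j); rewrite subrK /closed_disc /= in xj *.
  by rewrite /N; clear -xj; lra.
have nearz : near0 (fun v => chiT (z + v) = 1 /\ gT (z + v) = 0).
  have n2 : near0 (fun v => chi2 (z + v) = 1 /\ g2 (z + v) = 0).
    exists (N z / 2) => // v hv; apply: q5; rewrite subr0.
    have := normc_dist (z + v) z; rewrite addrAC subrr add0r ler_norml => /andP[h _].
    by rewrite /N in hv h *; clear -hv h; lra.
  have n3 : near0 (fun v => X (z + v) = 1 /\ G3 (z + v) = 0).
    have : near0 (fun v => forall j, (j < n)%N -> rho j <= N (z + v - a j)).
      apply: near0_fin => j _; exists (r j / 2); first by rewrite divr_gt0.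
      move=> v hv; have h1 := BN _ j Bz; have h2 := rhor j.
      have := normc_dist (z + v - a j) (z - a j); rewrite (_ : z + v - a j - (z - a j) = v); last by ring.
      rewrite ler_norml => /andP[h _].
      by rewrite /N in h h1 *; clear -hv h h1 h2; lra.
    by apply: near0S => v; exact: t4.
  apply: near0S (near0I p4 (near0I n2 n3)) => v [[k1 k2] [[k3 k4] [k5 k6]]].
  by rewrite /chiT /gT /chi12 /g12 k1 k2 k3 k4 k5 k6 !(mul0r, mulr0, mulr1, addr0).
have sq2 (u v : R[i]) : N (u + v) ^+ 2 <= 2 * (N u ^+ 2 + N v ^+ 2).
  have h := normcD_le u v; have h1 : N (u + v) ^+ 2 <= (N u + N v) ^+ 2.
    by rewrite ler_pXn2r ?nnegrE ?addr_ge0 ?normc_ge0.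
  have h2 := sqr_ge0 (N u - N v); apply: (le_trans h1).
  by clear -h2; lra.
have damp (c : R) (u : R[i]) : 0 <= c <= 1 -> N (u * c%:C%C) ^+ 2 <= N u ^+ 2.
  move=> /andP[k1 k2]; rewrite /N normcM normc_real ger0_norm// ler_pXn2r ?nnegrE ?mulr_ge0 ?normc_ge0//.
  by rewrite ler_piMr ?normc_ge0.
have gTW x : G x -> N (gT x * ukern z x) ^+ 2 <= WT x.
  move=> /GE x1; set u := ukern z x.
  have b1 : N (g1 x * u) ^+ 2 <= V x by have [] := p7 x x1.
  have b2 : N (g2 x * u) ^+ 2 <= c0 * N (g2 x) ^+ 2.
    have [h|h] := leP (N z / 2) (N x).
      have h' : N z / 2 <= N (x - 0) by rewrite subr0.
      have [_ ->] := q5 x h'.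
      by rewrite mul0r /N normc0 expr0n mulr0.
    have xz : N z / 2 <= N (x - z).
      have := normc_dist z x; rewrite ler_norml normc_distC => /andP[_ k].
      by rewrite /N in h k *; clear -h k; lra.
    have uu := ukern_le z1 x1 Nz2 xz.
    rewrite /N normcM exprMn mulrC ler_wpM2r ?sqr_ge0//.
    apply: (@le_trans _ _ ((2 / (N z / 2)) ^+ 2)).
      by rewrite ler_pXn2r ?nnegrE ?normc_ge0// divr_ge0// ltW.
    rewrite le_eqVlt; apply/orP; left; apply/eqP; rewrite /c0.
    by field; rewrite gt_eqF.
  have b3 : N (G3 x * u) ^+ 2 <= W x.
    rewrite /N normcM exprMn; apply: t7; first exact: sqr_ge0.
    move=> j _ xj; have h1 := BN _ j Bz; have h2 := rhor j; have rj := r_gt0 j.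
    have xz : r j / 2 <= N (x - z).
      have := normcD_le (x - a j) (z - x); rewrite (_ : x - a j + (z - x) = z - a j); last by ring.
      by rewrite (normc_distC z x); rewrite /N in h1 xj *; clear -h1 h2 xj; lra.
    have rj2 : 0 < r j / 2 by rewrite divr_gt0.
    have uu := ukern_le z1 x1 rj2 xz.
    apply: (@le_trans _ _ ((2 / (r j / 2)) ^+ 2)).
      by rewrite ler_pXn2r ?nnegrE ?normc_ge0// divr_ge0// ltW.
    rewrite le_eqVlt; apply/orP; left; apply/eqP; rewrite /w.
    by field; rewrite gt_eqF.
  have E12 : N (g12 x * u) ^+ 2 <= 2 * (V x + c0 * N (g2 x) ^+ 2).
    rewrite /g12 mulrDl; apply: (le_trans (sq2 _ _)); rewrite ler_wpM2l// lerD//.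
      by rewrite mulrAC; apply: le_trans b1; apply: damp.
    by rewrite (mulrC _ (g2 x)) mulrAC; apply: le_trans b2; apply: damp.
  rewrite /gT mulrDl; apply: (le_trans (sq2 _ _)).
  have F1 : N (g12 x * (X x)%:C%C * u) ^+ 2 <= N (g12 x * u) ^+ 2.
    by rewrite mulrAC; apply: damp.
  have F2 : N ((chi12 x)%:C%C * G3 x * u) ^+ 2 <= N (G3 x * u) ^+ 2.
    by rewrite (mulrC _ (G3 x)) mulrAC; apply: damp.
  rewrite /WT; clear -F1 F2 E12 b3; lra.
have IWT : ReI (fun x => (WT x)%:C%C) <= 4 * delta.
  rewrite -/(RI WT) /WT RID//; last exact: rcontD.
  rewrite RID// !RIZ//; last exact: rcont_sq.
  have k1 : 4 * RI V <= delta by move: p8; rewrite -/(RI V) => h; clear -h; lra.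
  have k2 : 4 * c0 * RI (fun x => N (g2 x) ^+ 2) <= delta.
    have c04 : 0 < 4 * c0 by apply: mulr_gt0.
    move: q6; rewrite (ler_pdivlMr _ _ c04) => h.
    by apply: le_trans h; rewrite mulrC.
  have k3 : 2 * RI W <= 2 * delta.
    have y1 : 1 - (2 ^+ n)^-1 <= 1 :> R by rewrite gerBl invr_ge0 exprn_ge0.
    by rewrite ler_wpM2l//; apply: (le_trans t8); exact: ler_piMr (ltW delta0) y1.
  by clear -k1 k2 k3; lra.
have kz : kdiag z <= kdiag zs by apply: kdiag_le => //; exact: zsmax.
apply: (@le_lt_trans _ _ (M0 + 2 * gap)%:E); last first.
  by rewrite lte_fin /gap; clear -M0M; lra.
apply: ge_ereal_sup => _ [f [[holf intf] _] <-]; rewrite lee_fin.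
set F := sq_L2norm G f.
have F0 : 0 <= F by apply: Rintegral_ge0 => p _; exact: sqr_ge0.
(* For [F = 0] the quotient is 0, since the inverse of 0 is 0. *)
have [Fe|Fn] := eqVneq F 0.
  by rewrite Fe invr0 mulr0; apply: addr_ge0; [exact: ltW|apply: mulr_ge0 => //; exact: ltW].
have Fp : 0 < F by rewrite lt_def Fn.
have holf' x : G x -> exists A, wirt f x A 0 by move=> /holf /derivable_wirt.
have := estimate oG GE holf' hT chiTb offG Gz nearz rWT WT0 gTW IWT intf th0 Fp.
rewrite -/m; set Y := Rintegral _ _ _; have -> : Y = F by [].
set S := (1 + th) * _ + _ => HS.
have HS2 : S <= (M0 + 2 * gap) * m ^+ 2.
  have l1 : (1 + th) * (m * kdiag z) <= (M0 + gap) * m ^+ 2.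
    apply: (@le_trans _ _ ((1 + th) * (m * kdiag zs))).
      by rewrite ler_wpM2l ?addr_ge0 ?(ltW th0)// ler_wpM2l// ltW.
    have E1 : kdiag zs = M0 * m by rewrite divfK ?gt_eqF.
    have E2 : gap = th * M0 by rewrite divfK ?gt_eqF.
    by rewrite le_eqVlt; apply/orP; left; apply/eqP; rewrite E1 E2; ring.
  have l2 : (1 + th^-1) * (4 * delta) = gap * m ^+ 2.
    have E3 : delta * 4 * (1 + th^-1) = gap * m ^+ 2 by rewrite !divfK ?gt_eqF.
    by rewrite -E3; ring.
  by rewrite /S l2; clear -l1; lra.
rewrite ler_pdivrMr// -(ler_pM2r m20); apply: (le_trans HS).
apply: (@le_trans _ _ (F * ((M0 + 2 * gap) * m ^+ 2))); first by rewrite ler_wpM2l.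
by rewrite le_eqVlt; apply/orP; left; apply/eqP; ring.
Unshelve. all: by end_near. Qed.
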